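(* Assume that $\delta=1/2$. Then, as $n\to\infty$, $\frac{S_n}{\sqrt{n\log n}}$ converges in distribution to $$\mathcal{N}_d\left(0,\ \frac{1}{m}\sum_{v\in V_{\mathfrak{o}}}(v-\bar v)(v-\bar v)^\top\right).$$
   Context: Setting. Let $d\ge 1$ and let $\mathcal{S}_{\mathfrak{e}},\mathcal{S}_{\mathfrak{o}},V_{\mathfrak{e}},V_{\mathfrak{o}}\subset\mathbf{R}^d$, with $V_{\mathfrak{o}},V_{\mathfrak{e}}$ finite, satisfy: (1) $x+v\in\mathcal{S}_{\mathfrak{o}}$ for $x\in\mathcal{S}_{\mathfrak{e}}$, $v\in V_{\mathfrak{o}}$; (2) $x+v\in\mathcal{S}_{\mathfrak{e}}$ for $x\in\mathcal{S}_{\mathfrak{o}}$, $v\in V_{\mathfrak{e}}$; (3) $V_{\mathfrak{o}}=-V_{\mathfrak{e}}$; (4) $0\in\mathcal{S}_{\mathfrak{e}}$; (5) $V_{\mathfrak{o}}\cap V_{\mathfrak{e}}=\emptyset$. Put $V=V_{\mathfrak{o}}\cup V_{\mathfrak{e}}$, let $m$ be the common cardinality of $V_{\mathfrak{o}}$ and $V_{\mathfrak{e}}$, assume $m\ge2$, and set $\bar v=\frac1m\sum_{v\in V_{\mathfrak{o}}}v$. Fix $p,q\in[0,1]$ and set $\alpha=\frac{mp-1}{m-1}$, $\beta=\frac{mq-1}{m-1}$, $\delta=\frac12(\alpha-\beta)$. For each $k\ge2$ and $v\in V$ let $G_k(v)$ be a random variable with values in $V_{\mathfrak{o}}$ if $k$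 is odd and in $V_{\mathfrak{e}}$ if $k$ is even, with the following law. Let $W$ denote $V_{\mathfrak{o}}$ if $k$ is odd and $V_{\mathfrak{e}}$ if $k$ is even, and let $w\in W$. If $v\in W$, then $\boldsymbol{P}(G_k(v)=w)=p$ for $w=v$ and $\frac{1-p}{m-1}$ for $w\ne v$. If $v\in V\setminus W$ (so $-v\in W$), then $\boldsymbol{P}(G_k(v)=w)=q$ for $w=-v$ and $\frac{1-q}{m-1}$ for $w\neq -v$. Let $X_1$ be uniform on $V_{\mathfrak{o}}$ and, for $n\ge1$, let $\mathcal{U}_n$ be uniform on $\{1,\dots,n\}$. The $\sigma$-fields $\sigma(X_1),\ \sigma(\mathcal{U}_1,\{G_2(v)\}_{v\in V}),\ \sigma(\mathcal{U}_2,\{G_3(v)\}_{v\in V}),\dots$ are independent, and for each $n\ge1$, $\mathcal{U}_n$ is independent of $\{G_{n+1}(v)\}_{v\in V}$. Define, for $n\geq 1$, $X_{n+1}=G_{n+1}(X_{\mathcal{U}_n})$; and $S_0=0$, $S_{n+1}=S_n+X_{n+1}$ for $n\ge0$ (the elephant random walk). $\mathcal{N}_d(0,\Sigma)$ is the $d$-dimensional Gaussian distribution with mean $0$ and (possibly singular) covariance matrix $\Sigma$. *)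

(* Defs.v *)
From HB Require Import structures.
From mathcomp Require Import all_boot all_order all_algebra finmap.
From mathcomp Require Import all_classical all_reals all_analysis.

Set Implicit Arguments.
Unset Strict Implicit.
Unset Printing Implicit Defensive.

Import Order.TTheory GRing.Theory Num.Theory.
Import numFieldNormedType.Exports.

Local Open Scope classical_set_scope.
Local Open Scope ring_scope.

(* R^d with its Borel sigma-algebra; convertible to ['cV[R]_d]. *)
Notation borel_cV R d := (g_sigma_algebraType (@open 'cV[R]_d)).

Section gaussian.
Context {R : realType}.

(* The library's [normal_prob a 0] is by convention not the Dirac mass at [a],
   so the degenerate case is treated apart. The second parameter of
   [normal_prob] is the standard deviation. *)
Definition normal_law (a var : R) (A : set R) : \bar R :=
  if var == 0 then \d_a A else normal_prob a (Num.sqrt var) A.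

(* N_d(a, Sigma), Sigma possibly singular: the law of a random vector all of
   whose linear functionals <t, .> are N(<t, a>, <t, Sigma t>). *)
Definition is_gaussian (d : nat) (mu : probability (borel_cV R d) R)
    (a : 'cV[R]_d) (Sigma : 'M[R]_d) : Prop :=
  forall (t : 'cV[R]_d) (A : set R), measurable A ->
    mu [set x : 'cV[R]_d | A ((t^T *m x) 0 0)] =
    normal_law ((t^T *m a) 0 0) ((t^T *m Sigma *m t) 0 0) A.

Definition cvg_in_distribution d0 (Omega : measurableType d0)
    (P : probability Omega R) (d : nat) (Y : nat -> Omega -> 'cV[R]_d)
    (mu : probability (borel_cV R d) R) : Prop :=
  forall f : 'cV[R]_d -> R, continuous f ->
    (exists M : R, forall x, `|f x| <= M) ->
    (\int[P]_w (f (Y n w))%:E @[n --> \oo] --> \int[mu]_x (f x)%:E)%E.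

End gaussian.

Section independence.
Context {d : measure_display} {T : measurableType d} {R : realType}.
Variable P : probability T R.

Definition independent_systems (I : choiceType) (F : I -> set (set T)) : Prop :=
  forall (J : {fset I}) (E : I -> set T), (forall j, j \in J -> F j (E j)) ->
    P (\bigcap_(j in [set` J]) E j) = (\prod_(j <- J) P (E j))%E.

Definition independent_pair (F1 F2 : set (set T)) : Prop :=
  forall A B, F1 A -> F2 B -> P (A `&` B) = (P A * P B)%E.

Definition uniform_rv (K : choiceType) (X : T -> K) (A : {fset K}) : Prop :=
  (forall w, X w \in A) /\
  (forall a, a \in A -> P [set w | X w = a] = ((#|` A|%:R)^-1)%:E).

End independence.

Record erw_lattice (R : realType) (d : nat) (Se So : set 'cV[R]_d)
    (Ve Vo : {fset 'cV[R]_d}) : Prop := ErwLattice {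
  erw_even_step : forall x v, Se x -> v \in Vo -> So (x + v);
  erw_odd_step : forall x v, So x -> v \in Ve -> Se (x + v);
  erw_opp : Vo = [fset (- v)%R | v in Ve]%fset;
  erw_origin : Se 0;
  erw_disjoint : (Vo `&` Ve = fset0)%fset }.

Section elephant.
Context {R : realType} {d : nat}.
Variables Ve Vo : {fset 'cV[R]_d}.

(* The set W of admissible steps at time k. *)
Definition steps_at (k : nat) : {fset 'cV[R]_d} := if odd k then Vo else Ve.

(* The common value of P(G_k(v) = w), for w in W = steps_at k. *)
Definition step_weight (p q : R) (k : nat) (v w : 'cV[R]_d) : R :=
  let m : R := #|` Vo|%:R in
  if v \in steps_at k then (if w == v then p else (1 - p) / (m - 1))
  else (if w == - v then q else (1 - q) / (m - 1)).

Definition step_mean : 'cV[R]_d := (#|` Vo|%:R)^-1 *: \sum_(v <- Vo) v.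

Definition step_covariance : 'M[R]_d :=
  (#|` Vo|%:R)^-1 *:
  \sum_(v <- Vo) ((v - step_mean) *m (v - step_mean)^T).

Definition erw_delta (p q : R) : R :=
  let m : R := #|` Vo|%:R in
  let alpha := (m * p - 1) / (m - 1) in
  let beta := (m * q - 1) / (m - 1) in
  2^-1 * (alpha - beta).

Context {d0 : measure_display} {Omega : measurableType d0}.
Variable P : probability Omega R.

Definition sigma_steps (G : nat -> 'cV[R]_d -> {RV P >-> borel_cV R d})
    (k : nat) : set (set Omega) :=
  <<s \bigcup_(v in [set` (Vo `|` Ve)%fset]) g_sigma_algebra_preimage (G k v) >>.

(* The n-th of the sigma-fields required to be independent: sigma(X_1) for
   n = 0 and sigma(U_n, {G_{n+1}(v)}_v) for n >= 1. *)
Definition sigma_block (X1 : {RV P >-> borel_cV R d})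
    (U : nat -> {RV P >-> nat})
    (G : nat -> 'cV[R]_d -> {RV P >-> borel_cV R d}) (n : nat) :
    set (set Omega) :=
  if n == 0%N then g_sigma_algebra_preimage X1
  else <<s g_sigma_algebra_preimage (U n) `|` sigma_steps G n.+1 >>.

(* [G k v] is only constrained for k >= 2 and v in V, [U n] and [X n] only for
   n >= 1. The joint law of {G_k(v)}_v is left free. *)
Record elephant_random_walk (p q : R) (X1 : {RV P >-> borel_cV R d})
    (U : nat -> {RV P >-> nat})
    (G : nat -> 'cV[R]_d -> {RV P >-> borel_cV R d})
    (X S : nat -> Omega -> 'cV[R]_d) : Prop := ElephantRandomWalk {
  erw_G_values : forall k v w, (2 <= k)%N -> v \in (Vo `|` Ve)%fset ->
    (G k v w : 'cV[R]_d) \in steps_at k;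
  erw_G_law : forall k (v w : 'cV[R]_d), (2 <= k)%N ->
    v \in (Vo `|` Ve)%fset -> w \in steps_at k ->
    P [set x | G k v x = w] = (step_weight p q k v w)%:E;
  erw_X1_law : uniform_rv P (X1 : Omega -> 'cV[R]_d) Vo;
  erw_U_law : forall n, (1 <= n)%N ->
    uniform_rv P (U n) [fset i in iota 1 n]%fset;
  erw_independent : independent_systems P (sigma_block X1 U G);
  erw_U_G_independent : forall n, (1 <= n)%N ->
    independent_pair P (g_sigma_algebra_preimage (U n)) (sigma_steps G n.+1);
  erw_X_first : forall x, X 1%N x = X1 x;
  erw_X_rec : forall n x, (1 <= n)%N ->
    X n.+1 x = G n.+1 (X (U n x) x) x;
  erw_S_first : forall x, S 0%N x = 0;
  erw_S_rec : forall n x, S n.+1 x = S n x + X n.+1 x }.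

End elephant.

(* Main.v *)
Require Import Defs.
From HB Require Import structures.
From mathcomp Require Import all_boot all_order all_algebra finmap.
From mathcomp Require Import all_classical all_reals all_analysis.
From mathcomp Require Import measurable_realfun charge.
From mathcomp Require Import ring lra zify.

Set Implicit Arguments.
Unset Strict Implicit.
Unset Printing Implicit Defensive.

Import Order.TTheory GRing.Theory Num.Theory.
Import numFieldNormedType.Exports.

Local Open Scope classical_set_scope.
Local Open Scope ring_scope.

(** Turn every step made at an even time: [Y_k = (-1)^(k-1) X_k] always lies in
    [Vo], and the next [Y] recalls a uniformly chosen earlier one, repeating it
    with probability [p] or [q] according to the parity of the time elapsed.
    Fix a direction [t] and let [z v = <t, v - v_bar>]. Up to a bounded term
    [<t, S_n>] is the alternating sum [A_n] of the [z Y_k]. Let [A'_n] be the sum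
    without signs. Conditionally on the past, the next increment of [A] has mean
      [delta A_n / n + (-1)^n c' A'_n / n],
    where [delta = 1/2] forces [c' <= 1/2].
    The oscillating term is, up to [O(1/n)], minus the increment of
    [(c'/2) (-1)^n A'_n / n]; adding that bounded quantity to [A_n] gives a
    corrected sum [Q_n] whose drift is [delta Q_n / n] up to [O(1/n)]
    ([corrected], [incr_drift]). The second moments [x_n] of [Q_n] satisfy
    [x_(n+1) <= (1 + 1/n) x_n + C], so that [x_n = O(n log n)]
    ([corrected_second_moment]). The same holds with the parts of [A] and [A']
    exchanged, since both coefficients are at most [1/2], and the means [A_n / n]
    and [A'_n / n] are [O(n^(-1/4))] in [L^1] ([mean_sum_L1]).

    As [delta = 1/2], the drift of [Q_n] is compensated by the growth of
    [sqrt n]: the increments of [W_n = Q_n / sqrt n] have conditional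
    mean [O(n^(-5/4))] in [L^1], and conditional second moment [v / (n + 1)] up to
    an error of that size, where [v] is the variance of [z] under the uniform law
    on [Vo]. Hence
      [E cos (th W_(n+1) + b) = exp (- th^2 v / (2 (n+1))) E cos (th W_n + b)
       + O(th n^(-5/4))]
    ([char_avg_step]). Errors are summable and the exponents add up to
    [th^2 v / 2] times a harmonic sum; taking [th = (log n)^(-1/2)] gives the
    limit [exp (- v / 2) cos b] ([scaled_char_cvg]), which is the value for the
    Gaussian law of the statement.

    Convergence of these cosines gives weak convergence by Levy's theorem
    ([levy_continuity]): the second moments give tightness, and on a cube a
    continuous function is a uniform limit of trigonometric sums that keep its
    bounds ([trig_approx_error]). The theorem is proved for positive normalized
    functionals, so that it applies to the averages over finitely many histories
    which describe the walk ([hist_avg], [integral_history]) and to integrals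
    alike; applied to a constant sequence it shows that cosines determine a law
    ([eq_prob_cos]). The Gaussian law itself is that of a sum of the vectors
    [(v - v_bar) / sqrt m] with independent standard normal coefficients
    ([gaussian_existence]). *)

(** * Elementary estimates *)

Section real_bounds.
Variable R : realType.
Implicit Types x d : R.

(** Integrating a sign: each Taylor inequality for sine and cosine below
    follows from one of lower order by this step. *)
Lemma derive_ge0_from0 (f df : R -> R) : (forall x, is_derive x 1 f (df x)) ->
  (forall x, 0 <= x -> 0 <= df x) -> f 0 = 0 -> forall x, 0 <= x -> 0 <= f x.
Proof.
move=> fdf df0 f0 x x0.
have [|c] := @MVT_segment R f df 0 x x0 (fun y _ => fdf y).
  apply: continuous_subspaceT => y; apply: differentiable_continuous.
  by apply/derivable1_diffP; apply: ex_derive.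
rewrite in_itv/= => /andP[c0 _]; rewrite f0 !subr0 => ->.
by rewrite mulr_ge0// df0.
Qed.

Lemma sin_le x : 0 <= x -> sin x <= x.
Proof.
move=> x0; rewrite -subr_ge0.
have D (y : R) : is_derive y 1 (fun x => x - sin x) ((fun x => 1 - cos x) y).
  exact: is_deriveB.
apply: (derive_ge0_from0 D _ _ x0) => [y _|].
  by rewrite subr_ge0 cos_le1.
by rewrite sin0 subr0.
Qed.

Lemma norm_sin_le x : `|sin x| <= `|x|.
Proof.
wlog x0 : x / 0 <= x.
  move=> wl; have [/wl//|/ltW] := leP 0 x.
  by rewrite -oppr_ge0 => /wl; rewrite sinN !normrN.
rewrite (ger0_norm x0) ler_norml sin_le// andbT.
rewrite lerNl -subr_ge0.
have D (y : R) : is_derive y 1 (fun x => x - (- sin x)) ((fun x => 1 - (- cos x)) y).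
  exact: is_deriveB.
apply: (derive_ge0_from0 D _ _ x0) => [y _|].
  by rewrite opprK addrC -lerBlDr sub0r cos_geN1.
by rewrite sin0 oppr0 subr0.
Qed.

Lemma cos_half x : cos x = 1 - 2 * sin (x / 2) ^+ 2.
Proof.
have {1}-> : x = (x / 2) *+ 2 by rewrite -mulr_natr divfK.
by rewrite cos_mulr2n cos2sin2 -mulr_natl; ring.
Qed.

Lemma cos_ge_quad x : 1 - x ^+ 2 / 2 <= cos x.
Proof.
rewrite cos_half lerD2l lerN2.
have : sin (x / 2) ^+ 2 <= (x / 2) ^+ 2.
  by rewrite -[leLHS]real_normK ?num_real// -[leRHS]real_normK ?num_real// lerXn2r ?nnegrE// norm_sin_le.
by rewrite exprMn; lra.
Qed.

Lemma sin_ge_cubic x : 0 <= x -> x - x ^+ 3 / 6 <= sin x.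
Proof.
move=> x0; rewrite -subr_ge0.
have D (y : R) : is_derive y 1 (fun x => sin x - (x - x ^+ 3 / 6))
    ((fun x => cos x - (1 - x ^+ 2 / 2)) y).
  by apply: is_derive_eq; rewrite /GRing.scale/=; field.
apply: (derive_ge0_from0 D _ _ x0) => [y _|].
  by rewrite subr_ge0 cos_ge_quad.
by rewrite sin0 expr0n/= mul0r !subr0.
Qed.

Lemma sin_taylor x : `|sin x - x| <= `|x| ^+ 3 / 6.
Proof.
wlog x0 : x / 0 <= x.
  move=> wl; have [/wl//|/ltW] := leP 0 x.
  by rewrite -oppr_ge0 => /wl; rewrite sinN -opprD !normrN.
have := sin_le x0; have := sin_ge_cubic x0.
by rewrite (ger0_norm x0) ler_norml => ? ?; apply/andP; split; lra.
Qed.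

(** Through [1 - cos x = 2 sin^2 (x/2)] the error factors as [(u - sin u) (u +
    sin u)] with [u = x/2], so bounds on sine suffice. *)
Lemma cos_taylor x : `|cos x - 1 + x ^+ 2 / 2| <= `|x| ^+ 3 / 2.
Proof.
wlog x0 : x / 0 <= x.
  move=> wl; have [/wl//|/ltW] := leP 0 x.
  by rewrite -oppr_ge0 => /wl; rewrite cosN sqrrN normrN.
rewrite cos_half (ger0_norm x0); set u := x / 2.
have u0 : 0 <= u by rewrite /u divr_ge0.
have -> : x = 2 * u by rewrite /u mulrC divfK.
have h1 := sin_le u0; have h2 := sin_ge_cubic u0; have h3 := norm_sin_le u.
rewrite (_ : _ + _ = 2 * ((u - sin u) * (u + sin u))); last by field.
have hs : u - sin u <= u ^+ 2.
  have [u6|u6] := leP u 6.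
    apply: (@le_trans _ _ (u ^+ 3 / 6)); first by lra.
    by rewrite exprS; have := sqr_ge0 u; nra.
  move: h3; rewrite ler_norml (ger0_norm u0) => /andP[h3 _].
  by rewrite expr2; nra.
have hp : u + sin u <= 2 * u by lra.
have hp0 : 0 <= u + sin u.
  by move: h3; rewrite ler_norml (ger0_norm u0) => /andP[h3 _]; lra.
rewrite ger0_norm; last by rewrite !mulr_ge0// subr_ge0.
have -> : (2 * u) ^+ 3 / 2 = 2 * (u ^+ 2 * (2 * u)) by field.
by rewrite ler_pM2l// ler_pM// subr_ge0.
Qed.

(** The third-order remainder matters: an increment of size [n^(-1/2)] leaves
    an error [n^(-3/2)], which is summable. *)
Lemma cos_second_order x d b :
  `|cos (x + d + b) - (cos (x + b) - sin (x + b) * d - cos (x + b) * (d ^+ 2 / 2))|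
   <= `|d| ^+ 3.
Proof.
have -> : x + d + b = (x + b) + d by ring.
rewrite (cosD (x + b) d).
rewrite (_ : _ - _ = cos (x + b) * (cos d - 1 + d ^+ 2 / 2) - sin (x + b) * (sin d - d)); last by field.
rewrite (le_trans (ler_normB _ _))// !normrM.
have h1 : `|cos (x + b)| * `|cos d - 1 + d ^+ 2 / 2| <= 1 * (`|d| ^+ 3 / 2).
  by rewrite ler_pM// ?cos_max ?cos_taylor.
have h2 : `|sin (x + b)| * `|sin d - d| <= 1 * (`|d| ^+ 3 / 6).
  by rewrite ler_pM// ?sin_max ?sin_taylor.
by have : 0 <= `|d| ^+ 3 by []; lra.
Qed.

Lemma cos_lipschitz x y : `|cos x - cos y| <= `|x - y|.
Proof.
set a := (x + y) / 2; set d := (x - y) / 2.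
have -> : x = a + d by rewrite /a /d; field.
have -> : y = a - d by rewrite /a /d; field.
have -> : a + d - (a - d) = 2 * d by ring.
rewrite cosD cosB.
have -> : cos a * cos d - sin a * sin d - (cos a * cos d + sin a * sin d) =
  2 * (- sin a * sin d) by ring.
rewrite !(normrM 2) ler_wpM2l// -[leRHS]mul1r normrM normrN.
by apply: ler_pM => //; [exact: sin_max|exact: norm_sin_le].
Qed.

Lemma expRN_taylor x : 0 <= x -> `|expR (- x) - (1 - x)| <= x ^+ 2.
Proof.
move=> x0; have h1 := expR_ge1Dx (- x).
rewrite ger0_norm; last by lra.
have h2 := expR_ge1Dx x; have ex := expR_gt0 (-x).
have : expR (- x) * expR x = 1 by rewrite mulrC expRxMexpNx_1.
have h3 : expR (- x) * (1 + x) <= expR (- x) * expR x by rewrite ler_wpM2l// ltW.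
move=> h4; rewrite h4 in h3.
suff : expR (- x) <= 1 - x + x ^+ 2 by lra.
rewrite -(@ler_pM2r _ (1 + x)); last by lra.
apply: (le_trans h3); have : 0 <= x ^+ 3 by rewrite exprn_ge0.
by rewrite exprS; lra.
Qed.

(** [k] is the relative growth of the normalization [sqrt n]. That [n k] is
    [1/2] up to [O(1/n)] is what cancels a drift with coefficient [1/2]. *)
Lemma sqrt_succ (n : nat) : let k := Num.sqrt n.+2%:R / Num.sqrt n.+1%:R - 1 in
  0 <= k /\ k <= (2 * n.+1%:R)^-1 /\
  `|2^-1 - n.+1%:R * k| <= (8 * n.+1%:R)^-1 :> R.
Proof.
move=> k.
set r := Num.sqrt n.+1%:R in k *.
have r0 : 0 < r by rewrite sqrtr_gt0.
have r2 : r ^+ 2 = n.+1%:R by rewrite sqr_sqrtr.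
set r1 := Num.sqrt n.+2%:R in k *.
have r12 : r1 ^+ 2 = r ^+ 2 + 1 by rewrite sqr_sqrtr// r2 natr1.
have r10 : 0 < r1 by rewrite sqrtr_gt0.
have rr1 : r <= r1 by rewrite ler_wsqrtr// ler_nat.
have k0 : 0 <= k by rewrite subr_ge0 ler_pdivlMr// mul1r.
have rk : r1 = r * (1 + k) by rewrite /k addrC subrK mulrC divfK// gt_eqF.
have e : r ^+ 2 * (k * (2 + k)) = 1.
  by have := r12; rewrite rk => h; apply: (@addrI _ (r ^+ 2)); rewrite -h; ring.
rewrite -r2.
have r20 : 0 < r ^+ 2 by rewrite exprn_gt0.
have k1 : r ^+ 2 * k * 2 <= 1.
  rewrite -[leRHS]e mulrA; apply: ler_wpM2l; last by rewrite lerDl.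
  by apply: mulr_ge0 => //; exact: ltW.
split=> //; split.
  by rewrite -[leRHS]mul1r ler_pdivlMr ?mulr_gt0// (le_trans _ k1)//; lra.
have -> : 2^-1 - r ^+ 2 * k = r ^+ 2 * k * k / 2
  by transitivity (2^-1 * (r ^+ 2 * (k * (2 + k))) - r ^+ 2 * k);
    [rewrite e mulr1|field].
rewrite ger0_norm; last by rewrite !mulr_ge0// ltW.
rewrite -[leRHS]mul1r ler_pdivlMr ?mulr_gt0//.
have -> : r ^+ 2 * k * k / 2 * (8 * r ^+ 2) = (r ^+ 2 * k * 2) * (r ^+ 2 * k * 2) by field.
have k2 : 0 <= r ^+ 2 * k * 2 by rewrite !mulr_ge0// ltW.
exact: mulr_ile1.
Qed.

(** A power bound, cruder than the logarithm, which is enough wherever errors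
    only have to be summable. *)
Lemma harmonic_le_sqrt n : series harmonic n.+1 <= 2 * Num.sqrt n.+1%:R :> R.
Proof.
elim: n => [|n IH].
  by rewrite seriesEnat/= big_nat1 /= invr1 sqrtr1; lra.
rewrite seriesSr/=; apply: (le_trans (lerD IH (lexx _))).
have [k0 [k1 _]] := sqrt_succ n; move: k0 k1.
set r := Num.sqrt n.+1%:R; set r1 := Num.sqrt n.+2%:R => k0 k1.
have r0 : 0 < r by rewrite sqrtr_gt0.
have r2 : r ^+ 2 = n.+1%:R by rewrite sqr_sqrtr.
have r12 : r1 ^+ 2 = n.+2%:R by rewrite sqr_sqrtr.
have r10 : 0 < r1 by rewrite sqrtr_gt0.
have r11 : 1 <= r1 by rewrite -sqrtr1 ler_wsqrtr// ler1n.
have rr1 : r <= r1 by rewrite ler_wsqrtr// ler_nat.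
rewrite -r12.
have e : (r1 - r) * (r1 + r) = 1 by rewrite -subr_sqr r12 r2 -natrB// subSnn.
rewrite -lerBrDl -mulrBr -[leLHS]mul1r ler_pdivrMr ?exprn_gt0// -[leLHS]e.
have -> : 2 * (r1 - r) * r1 ^+ 2 = (r1 - r) * (2 * r1 ^+ 2) by ring.
rewrite ler_wpM2l ?subr_ge0//.
have h : r1 * 1 <= r1 * r1 by rewrite ler_wpM2l// ltW.
by rewrite expr2; lra.
Qed.

Definition quartic_inv (n : nat) : R := (Num.sqrt (Num.sqrt n.+1%:R))^-1.

Lemma quartic_inv_gt0 n : 0 < quartic_inv n.
Proof. by rewrite invr_gt0 !sqrtr_gt0. Qed.

Lemma quartic_inv4 n : quartic_inv n ^+ 4 = n.+1%:R^-1.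
Proof. by rewrite exprVn (exprM _ 2 2) !sqr_sqrtr ?sqrtr_ge0. Qed.

(** Summability of [n^(-5/4)] in telescoping form, as [n^(-5/4)] is minus four
    times the derivative of [n^(-1/4)]; the factor [8] absorbs the ratio of
    consecutive values. *)
Lemma quartic_inv_telescope n :
  quartic_inv n ^+ 5 <= 8 * (quartic_inv n - quartic_inv n.+1).
Proof.
have := quartic_inv4 n; have := quartic_inv4 n.+1.
have := quartic_inv_gt0 n; have := quartic_inv_gt0 n.+1.
set x := quartic_inv n; set y := quartic_inv n.+1 => y0 x0 y4 x4.
have yx : y <= x.
  by rewrite lef_pV2 ?posrE ?sqrtr_gt0// !ler_wsqrtr// ler_nat.
have xy : x ^+ 4 - y ^+ 4 = x ^+ 4 * y ^+ 4.
  rewrite x4 y4 -[n.+2%:R]natr1; field.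
  by rewrite ?natr1 ?nat1r ?natr1 !pnatr_eq0.
have y2 : x ^+ 4 <= 2 * y ^+ 4.
  rewrite x4 y4 -[leLHS]mul1r ler_pdivrMr// mulrAC ler_pdivlMr// mul1r -natrM ler_nat.
  by rewrite mul2n -addnn addSn addnS !ltnS leq_addr.
have : x ^+ 4 * (x ^+ 4 / 2) <= 4 * x ^+ 3 * (x - y).
  apply: (@le_trans _ _ (x ^+ 4 * y ^+ 4)).
    by apply: ler_wpM2l; [rewrite exprn_ge0 ?ltW|lra].
  rewrite -xy (_ : x ^+ 4 - y ^+ 4 = (x ^+ 3 + x ^+ 2 * y + x * y ^+ 2 + y ^+ 3) * (x - y)); last by ring.
  rewrite ler_wpM2r ?subr_ge0//.
  have a1 : x ^+ 2 * y <= x ^+ 2 * x by rewrite ler_wpM2l ?sqr_ge0.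
  have a2 : x * y ^+ 2 <= x * x ^+ 2
    by apply: ler_wpM2l; [exact: ltW|rewrite lerXn2r ?nnegrE ?(ltW x0) ?(ltW y0)].
  have a3 : y ^+ 3 <= x ^+ 3 by rewrite lerXn2r ?nnegrE ?(ltW x0) ?(ltW y0).
  have e3 : x ^+ 2 * x = x ^+ 3 by ring.
  have e4 : x * x ^+ 2 = x ^+ 3 by ring.
  by lra.
rewrite (_ : x ^+ 4 * (x ^+ 4 / 2) = x ^+ 3 * (x ^+ 5 / 2)); last by field.
rewrite (_ : 4 * x ^+ 3 * (x - y) = x ^+ 3 * (4 * (x - y))); last by ring.
by rewrite ler_pM2l ?exprn_gt0//; lra.
Qed.

Lemma ln_succ n : ln n.+2%:R = ln n.+1%:R + ln (1 + n.+1%:R^-1) :> R.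
Proof.
rewrite -lnM ?posrE ?addr_gt0 ?invr_gt0//.
by rewrite mulrDr mulr1 divff ?pnatr_eq0// natr1.
Qed.

Lemma ln_le_harmonic n : ln n.+2%:R <= series harmonic n.+1 :> R.
Proof.
have h k : ln (1 + k.+1%:R^-1) <= k.+1%:R^-1 :> R.
  by rewrite le_ln1Dx// (lt_le_trans (ltrN10 R))// invr_ge0.
elim: n => [|n IH]; rewrite ln_succ.
  by rewrite seriesEnat/= big_nat1 ln1 add0r h.
by rewrite seriesSr/= lerD.
Qed.

Lemma harmonic_le_ln n : series harmonic n.+1 <= 1 + ln n.+1%:R :> R.
Proof.
elim: n => [|n IH].
  by rewrite seriesEnat/= big_nat1 /= invr1 ln1 addr0.
rewrite seriesSr/= ln_succ addrA lerD//.
rewrite -lerN2 -lnV ?posrE ?addr_gt0 ?invr_gt0//.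
rewrite (_ : (1 + _)^-1 = 1 - n.+2%:R^-1).
  by rewrite le_ln1Dx// ltrN2 invf_lt1// ltr1n.
rewrite -[n.+2%:R]natr1; by field; rewrite !(nat1r, natr1) !pnatr_eq0.
Qed.

Lemma ln_nat_unbounded (A : R) : \forall n \near \oo, A <= ln n.+1%:R.
Proof.
near=> n.
have An : expR A <= n%:R by near: n; exact: nbhs_infty_ger.
rewrite -ler_expR lnK ?posrE// (le_trans An)// ler_nat//.
Unshelve. all: by end_near. Qed.

Lemma cvg_inv_sqrt_ln : (Num.sqrt (ln n.+1%:R))^-1 @[n --> \oo] --> (0 : R).
Proof.
apply/cvgrPdist_le => e e0; near=> n.
have h : e ^- 2 <= ln n.+1%:R by near: n; exact: ln_nat_unbounded.
have e2 : 0 < e ^- 2 by rewrite invr_gt0 exprn_gt0.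
rewrite sub0r normrN ger0_norm ?invr_ge0 ?sqrtr_ge0//.
have ln0 : 0 < ln n.+1%:R :> R by apply: lt_le_trans h.
rewrite invf_ple ?posrE ?sqrtr_gt0//.
have -> : e^-1 = Num.sqrt (e ^- 2) by rewrite -exprVn sqrtr_sqr ger0_norm// invr_ge0 ltW.
by rewrite ler_wsqrtr.
Unshelve. all: by end_near. Qed.

(** The sum starts at [1/2] because the first step carries no Gaussian factor
    in the recursion for the characteristic function. *)
Lemma cvg_harmonic_ln :
  (Num.sqrt (ln n.+1%:R))^-1 ^+ 2 * (series harmonic n.+1 - 1) @[n --> \oo] --> (1 : R).
Proof.
apply: (@squeeze_cvgr _ _ _ _ (fun n => 1 - (Num.sqrt (ln n.+1%:R))^-1 ^+ 2) (fun=> 1)).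
- near=> n.
  have ln1 : 1 <= ln n.+1%:R :> R by near: n; exact: ln_nat_unbounded.
  have ln0 : 0 < ln n.+1%:R :> R by apply: lt_le_trans ln1.
  rewrite exprVn sqr_sqrtr ?(ltW ln0)//.
  have -> : 1 - (ln n.+1%:R)^-1 = (ln n.+1%:R)^-1 * (ln n.+1%:R - 1) :> R.
    by rewrite mulrBr mulVf ?gt_eqF// mulr1.
  have h1 := ln_le_harmonic n; have h2 := harmonic_le_ln n.
  have h3 : ln n.+1%:R <= ln n.+2%:R :> R by rewrite ler_ln ?posrE// ler_nat.
  apply/andP; split.
    by apply: ler_wpM2l; [rewrite invr_ge0 ltW|lra].
  rewrite -[leRHS](mulVf (lt0r_neq0 ln0)).
  by apply: ler_wpM2l; [rewrite invr_ge0 ltW|lra].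
- have : 1 - (Num.sqrt (ln n.+1%:R))^-1 * (Num.sqrt (ln n.+1%:R))^-1
      @[n --> \oo] --> (1 - 0 * 0 : R).
    apply: cvgB; first exact: cvg_cst.
    by apply: cvgM; exact: cvg_inv_sqrt_ln.
  by rewrite mulr0 subr0.
- exact: cvg_cst.
Unshelve. all: by end_near. Qed.

End real_bounds.

(** * Averages over the histories of the turned steps *)

Section history_law.
Variables (R : realType) (V : eqType) (v0 : V) (Vs : seq V) (p q : R).
Local Notation m := ((size Vs)%:R : R).

Definition copy_weight (a : R) (v y : V) : R :=
  if y == v then a else (1 - a) / (m - 1).

(** A history lists the steps from the newest to the oldest, so position [k]
    lies [k.+1] steps before the next one: the two times have the same parity,
    and the copying probability is [p], exactly when [k] is odd. *)
Definition trans (h : seq V) (y : V) : R :=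
  (size h)%:R^-1 *
  \sum_(k < size h) copy_weight (if odd k then p else q) (nth v0 h k) y.

Definition step_avg (h : seq V) (f : V -> R) : R :=
  \sum_(y <- Vs) trans h y * f y.

(** The mean of [F] over the first [n.+1] turned steps, with the last step
    averaged out first. In this recursive form an estimate for one step
    extends to all [n] by induction. *)
Fixpoint hist_avg (n : nat) (F : seq V -> R) : R :=
  if n is n'.+1 then hist_avg n' (fun h => step_avg h (fun y => F (y :: h)))
  else m^-1 * \sum_(y <- Vs) F [:: y].

Definition hist (n : nat) (h : seq V) : bool :=
  (size h == n.+1) && all (mem Vs) h.

(** The step made at time [k.+1] gets the sign [s ^+ k]: [s = -1] undoes the
    turning and gives the walk, [s = 1] gives the companion sum in its drift. *)
Fixpoint signed_sum (s : R) (z : V -> R) (h : seq V) : R :=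
  if h is y :: h' then signed_sum s z h' + s ^+ size h' * z y else 0.

Lemma hist_cons n y h : y \in Vs -> hist n h -> hist n.+1 (y :: h).
Proof. by move=> yV /andP[/eqP sh ah]; rewrite /hist /= sh eqxx /= yV. Qed.

Lemma hist_size n h : hist n h -> size h = n.+1.
Proof. by case/andP => /eqP. Qed.

Section weights.
Hypotheses (uVs : uniq Vs) (m2 : (2 <= size Vs)%N).
Hypotheses (hp : 0 <= p <= 1) (hq : 0 <= q <= 1).

Let m1_gt0 : 0 < m - 1.
Proof. by rewrite subr_gt0 (_ : 1 = 1%:R) // ltr_nat. Qed.

Lemma copy_weight_ge0 a v y : 0 <= a <= 1 -> 0 <= copy_weight a v y.
Proof.
move=> /andP[a0 a1]; rewrite /copy_weight; case: ifP => // _.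
by rewrite divr_ge0 ?subr_ge0// -subr_ge0 ltW.
Qed.

(** The copying law is an affine combination of the point mass at [v] and of
    the uniform law; the coefficient of the point mass is the memory, and may
    be negative. *)
Lemma copy_weight_avg a v (f : V -> R) : v \in Vs ->
  \sum_(y <- Vs) copy_weight a v y * f y =
  (m * a - 1) / (m - 1) * f v + (1 - a) / (m - 1) * \sum_(y <- Vs) f y.
Proof.
move=> vV; rewrite (bigD1_seq v)//= [in RHS](bigD1_seq v)//= {1}/copy_weight eqxx.
rewrite (eq_bigr (fun y => (1 - a) / (m - 1) * f y)); last first.
  by move=> y /negbTE yv; rewrite /copy_weight yv.
rewrite -mulr_sumr; field; by rewrite gt_eqF.
Qed.

Lemma trans_ge0 h y : 0 <= trans h y.
Proof.
rewrite /trans mulr_ge0// sumr_ge0// => k _.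
by apply: copy_weight_ge0; case: ifP.
Qed.

(** Since [1_(k odd) = (1 - (-1)^k) / 2], a sum with weights alternating in
    the age is a combination of the two signed sums. The sign [(-1)^(size h)]
    comes from counting ages instead of times. *)
Lemma parity_sum (a b : R) (z : V -> R) h :
  \sum_(k < size h) (if odd k then a else b) * z (nth v0 h k) =
  (a + b) / 2 * signed_sum 1 z h +
  (-1) ^+ size h * ((a - b) / 2) * signed_sum (-1) z h.
Proof.
elim: h a b => [|y h IH] a b /=; first by rewrite big_ord0; ring.
rewrite big_ord_recl/= (eq_bigr
  (fun k : 'I_(size h) => (if odd k then b else a) * z (nth v0 h k))); last first.
  by move=> k _ /=; case: odd.
rewrite IH expr1n exprS.
have -> : (-1) ^+ size h = (if odd (size h) then -1 else 1) :> R.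
  by rewrite -signr_odd; case: odd; rewrite ?expr1 ?expr0.
by case: odd; field.
Qed.

Lemma step_avgE n h (f : V -> R) : hist n h ->
  step_avg h f = (size h)%:R^-1 * \sum_(k < size h)
   (let a := if odd k then p else q in
    (m * a - 1) / (m - 1) * f (nth v0 h k)
    + (1 - a) / (m - 1) * \sum_(y <- Vs) f y).
Proof.
move=> /andP[_ /allP ah]; rewrite /step_avg /trans.
under eq_bigr do rewrite -mulrA mulr_suml.
rewrite -mulr_sumr exchange_big/=; congr (_ * _); apply: eq_bigr => k _.
by rewrite copy_weight_avg//; apply: ah; rewrite mem_nth.
Qed.

Lemma step_avg_cst n h (c : R) : hist n h -> step_avg h (fun=> c) = c.
Proof.
move=> hh; rewrite (step_avgE _ hh).
rewrite (eq_bigr (fun=> c)).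
  rewrite sumr_const card_ord -[c *+ _]mulr_natr (hist_size hh) mulrCA mulVf ?mulr1//.
move=> k _ /=; rewrite big_const_seq count_predT iter_addr_0 -mulr_natr.
by field; rewrite gt_eqF.
Qed.

Lemma step_avg_le n h (f g : V -> R) : hist n h ->
  (forall y, y \in Vs -> f y <= g y) -> step_avg h f <= step_avg h g.
Proof.
move=> _ fg; rewrite /step_avg big_seq [leRHS]big_seq; apply: ler_sum => y yV.
by rewrite ler_wpM2l ?trans_ge0 ?fg.
Qed.

Lemma step_avg_eq h (f g : V -> R) :
  (forall y, y \in Vs -> f y = g y) -> step_avg h f = step_avg h g.
Proof. by move=> fg; rewrite /step_avg; apply: eq_big_seq => y /fg ->. Qed.

Lemma step_avgD h (f g : V -> R) :
  step_avg h (fun y => f y + g y) = step_avg h f + step_avg h g.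
Proof. by rewrite /step_avg -big_split/=; under eq_bigr do rewrite mulrDr. Qed.

Lemma step_avgZ h c (f : V -> R) :
  step_avg h (fun y => c * f y) = c * step_avg h f.
Proof. by rewrite /step_avg mulr_sumr; under eq_bigr do rewrite mulrCA. Qed.

(** A centred [z] does not see the uniform part of the copying law, so that
    only the memory coefficients are left. *)
Lemma step_avg_center n h (z : V -> R) : hist n h ->
  \sum_(y <- Vs) z y = 0 ->
  let a := (m * p - 1) / (m - 1) in let b := (m * q - 1) / (m - 1) in
  step_avg h z = ((a + b) / 2 * signed_sum 1 z h +
    (-1) ^+ size h * ((a - b) / 2) * signed_sum (-1) z h) / (size h)%:R.
Proof.
move=> hh z0 a b; rewrite (step_avgE _ hh) mulrC -parity_sum; congr (_ / _).
apply: eq_bigr => k _ /=; rewrite z0 mulr0 addr0.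
by case: odd.
Qed.

Lemma hist_avg_le n F G : (forall h, hist n h -> F h <= G h) ->
  hist_avg n F <= hist_avg n G.
Proof.
elim: n F G => [|n IH] F G FG /=.
  rewrite ler_wpM2l ?invr_ge0// big_seq [leRHS]big_seq ler_sum// => y yV.
  by apply: FG; rewrite /hist/= yV.
apply: IH => h hh; apply: (step_avg_le hh) => y yV.
by apply: FG; exact: hist_cons.
Qed.

Lemma hist_avg_eq n F G : (forall h, hist n h -> F h = G h) ->
  hist_avg n F = hist_avg n G.
Proof.
by move=> FG; apply/eqP; rewrite eq_le !hist_avg_le// => h /FG ->.
Qed.

Lemma hist_avgD n F G :
  hist_avg n (fun h => F h + G h) = hist_avg n F + hist_avg n G.
Proof.
elim: n F G => [|n IH] F G /=; first by rewrite big_split mulrDr.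
by rewrite -IH; apply: hist_avg_eq => h _; rewrite step_avgD.
Qed.

Lemma hist_avgZ n c F : hist_avg n (fun h => c * F h) = c * hist_avg n F.
Proof.
elim: n F => [|n IH] F /=; first by rewrite -mulr_sumr mulrCA.
by rewrite -IH; apply: hist_avg_eq => h _; rewrite step_avgZ.
Qed.

Lemma hist_avg_cst n c : hist_avg n (fun=> c) = c.
Proof.
elim: n => [|n IH] /=.
  rewrite big_const_seq count_predT iter_addr_0 -[c *+ _]mulr_natr mulrCA mulVf ?mulr1//.
  by rewrite pnatr_eq0; case: (size Vs) m2.
by rewrite -[RHS]IH; apply: hist_avg_eq => h hh; rewrite (step_avg_cst _ hh).
Qed.

Lemma hist_avg_norm n F : `|hist_avg n F| <= hist_avg n (fun h => `|F h|).
Proof.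
rewrite ler_norml lerNl -mulN1r -hist_avgZ !hist_avg_le// => h _; first exact: ler_norm.
by rewrite mulN1r -normrN ler_norm.
Qed.

(** Cauchy-Schwarz, from the pointwise bound [|F| <= (F^2 / M + M) / 2]. *)
Lemma hist_avg_norm_le n F M : 0 < M ->
  hist_avg n (fun h => F h ^+ 2) <= M ^+ 2 -> hist_avg n (fun h => `|F h|) <= M.
Proof.
move=> M0 FM.
apply: (@le_trans _ _ (hist_avg n (fun h => (2 * M)^-1 * F h ^+ 2 + M / 2))).
  apply: hist_avg_le => h _; rewrite -subr_ge0 -(real_normK (num_real (F h))).
  rewrite (_ : _ - _ = (2 * M)^-1 * (`|F h| - M) ^+ 2); last first.
    by field; rewrite gt_eqF.
  by rewrite mulr_ge0 ?sqr_ge0// invr_ge0 mulr_ge0// ltW.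
rewrite hist_avgD hist_avgZ hist_avg_cst.
apply: (@le_trans _ _ ((2 * M)^-1 * M ^+ 2 + M / 2)).
  by rewrite lerD2r ler_wpM2l// invr_ge0 mulr_ge0// ltW.
by rewrite le_eqVlt; apply/orP; left; apply/eqP; field; rewrite gt_eqF.
Qed.

Lemma signed_sum_bound n s z B h : s ^+ 2 = 1 -> hist n h ->
  (forall y, y \in Vs -> `|z y| <= B) ->
  `|signed_sum s z h| <= B * (size h)%:R.
Proof.
move=> s2 hh zB; have /allP ah : all (mem Vs) h by case/andP: hh.
elim: h ah {hh} => [|y h IH] ah /=; first by rewrite normr0 mulr0.
have s1 k : `|s ^+ k| = 1.
  have /eqP : `|s| ^+ 2 = 1 by rewrite -normrX s2 normr1.
  by rewrite sqrp_eq1// normrX => /eqP ->; rewrite expr1n.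
rewrite -natr1 mulrDr mulr1 (le_trans (ler_normD _ _))// lerD//.
  by apply: IH => x xh; apply: ah; rewrite inE xh orbT.
by rewrite normrM s1 mul1r; apply/zB/ah; rewrite inE eqxx.
Qed.

End weights.
End history_law.

(** * Characteristic function of the signed sums *)

Lemma normM_le (R : realDomainType) (x y X Y : R) :
  `|x| <= X -> `|y| <= Y -> `|x * y| <= X * Y.
Proof. by move=> xX yY; rewrite normrM ler_pM. Qed.

Lemma norm_sign (R : realDomainType) (s : R) k : s ^+ 2 = 1 -> `|s ^+ k| = 1.
Proof.
move=> s2; have /eqP : `|s| ^+ 2 = 1 by rewrite -normrX s2 normr1.
by rewrite sqrp_eq1// normrX => /eqP ->; rewrite expr1n.
Qed.

Lemma sqr_sign (R : realDomainType) (s : R) k : s ^+ 2 = 1 -> s ^+ k * s ^+ k = 1.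
Proof. by move=> s2; rewrite -expr2 exprAC s2 expr1n. Qed.

Section moments.
Variables (R : realType) (V : eqType) (v0 : V) (Vs : seq V) (p q : R).
Hypotheses (uVs : uniq Vs) (m2 : (2 <= size Vs)%N).
Hypotheses (hp : 0 <= p <= 1) (hq : 0 <= q <= 1).
Local Notation m := ((size Vs)%:R : R).
Local Notation step_avg := (step_avg v0 Vs p q).
Local Notation hist_avg := (hist_avg v0 Vs p q).
Local Notation hist := (hist Vs).

(** With [alpha = (m p - 1) / (m - 1)] and [beta = (m q - 1) / (m - 1)] this
    is [(alpha + s beta) / 2], so [memory_coef (-1)] is [delta]. *)
Definition memory_coef (s : R) : R :=
  ((m * p - 1) / (m - 1) + s * ((m * q - 1) / (m - 1))) / 2.

Let sac := step_avg_cst v0 p q uVs m2.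
Let sal := step_avg_le v0 m2 hp hq.
Let hac := hist_avg_cst v0 uVs m2 hp hq.
Let hal := hist_avg_le v0 m2 hp hq.
Let had := hist_avgD v0 m2 hp hq.
Let haz := hist_avgZ v0 m2 hp hq.

Let m1_gt0 : 0 < m - 1.
Proof. by rewrite subr_gt0 (_ : 1 = 1%:R) // ltr_nat. Qed.

Let m_ge2 : 2 <= m.
Proof. by rewrite (ler_nat R 2). Qed.

Lemma memory_coef_bound s : s ^+ 2 = 1 -> `|memory_coef s| <= 1.
Proof.
move=> s2.
have b (a : R) : 0 <= a <= 1 -> `|(m * a - 1) / (m - 1)| <= 1.
  move=> /andP[a0 a1]; rewrite ler_norml ler_pdivrMr// ler_pdivlMr//.
  have ma0 : 0 <= m * a by rewrite mulr_ge0.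
  have ma1 : m * a <= m by rewrite ler_piMr.
  by have h2 := m_ge2; apply/andP; split; lra.
rewrite /memory_coef normrM normfV normr_nat ler_pdivrMr// mul1r.
rewrite (le_trans (ler_normD _ _))// -[leRHS]/(1 + 1) lerD ?b//.
by rewrite normrM -[s]expr1 (norm_sign _ s2) mul1r b.
Qed.

Definition mean_sum (z : V -> R) (s : R) (h : seq V) : R :=
  signed_sum s z h / (size h)%:R.

Section corrected.
Variables (z : V -> R) (B : R).
Hypotheses (z0 : \sum_(y <- Vs) z y = 0) (zB : forall y, y \in Vs -> `|z y| <= B).
Variable s : R.
Hypothesis s2 : s ^+ 2 = 1.
Local Notation c := (memory_coef s).
Local Notation c' := (memory_coef (- s)).

Let s2' : (- s) ^+ 2 = 1.
Proof. by rewrite sqrrN. Qed.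
Let eps2 : (-1) ^+ 2 = 1 :> R.
Proof. by rewrite sqrrN expr1n. Qed.

Lemma mean_sum_bound t n h : t ^+ 2 = 1 -> hist n h -> `|mean_sum z t h| <= B.
Proof.
move=> t2 hh; rewrite normrM normfV normr_nat.
rewrite (hist_size hh) ler_pdivrMr// -(hist_size hh).
exact: (signed_sum_bound t2 hh zB).
Qed.

(** The conditional mean of the next increment of [signed_sum s]: its own mean
    with coefficient [c], and the other one with coefficient [c'] and a sign
    that alternates in time. The cases [s = 1] and [s = -1] are exchanged by
    that sign. *)
Lemma step_avg_sign n h : hist n h ->
  s ^+ size h * step_avg h z =
  c * mean_sum z s h + (-1) ^+ size h * c' * mean_sum z (- s) h.
Proof.
move=> hh; rewrite (step_avg_center v0 p q uVs m2 hh z0) /mean_sum /memory_coef.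
have := sqr_sign (size h) eps2.
set e := (-1) ^+ size h => e2.
have /eqP := s2; rewrite sqrf_eq1 => /orP[]/eqP ->.
  by rewrite expr1n; field; rewrite (hist_size hh) pnatr_eq0/= gt_eqF.
rewrite opprK -/e; transitivity
 (((m * p - 1) / (m - 1) + (m * q - 1) / (m - 1)) / 2 * e * signed_sum 1 z h / (size h)%:R +
  (e * e) * ((m * p - 1) / (m - 1) - (m * q - 1) / (m - 1)) / 2 * signed_sum (-1) z h/ (size h)%:R).
  by field; rewrite (hist_size hh) pnatr_eq0/= gt_eqF.
by rewrite e2; field; rewrite (hist_size hh) pnatr_eq0/= gt_eqF.
Qed.

(** A slowly varying quantity with alternating sign is, to first order, minus
    the increment of half of itself. The added term is therefore chosen so
    that its increment cancels the oscillating part of the drift of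
    [signed_sum s]. *)
Definition corrected (h : seq V) : R :=
  signed_sum s z h + c' / 2 * (-1) ^+ size h * mean_sum z (- s) h.

(** The increment of [corrected] is affine in the value [z y] of the new step,
    with constant term [incr0] and slope [incr1]. *)
Definition incr0 (h : seq V) : R :=
  - (c' / 2) * (-1) ^+ size h * mean_sum z (- s) h * (2 - (size h).+1%:R^-1).

Definition incr1 (h : seq V) : R :=
  s ^+ size h * (1 - c' / 2 * (size h).+1%:R^-1).

Lemma corrected_cons n h y : hist n h ->
  corrected (y :: h) = corrected h + (incr0 h + incr1 h * z y).
Proof.
move=> hh; rewrite /corrected /incr0 /incr1 /mean_sum/= exprS.
rewrite [(- s) ^+ size h]exprNn mulN1r.
have := sqr_sign (size h) eps2.
set e := (-1) ^+ size h => e2; rewrite -natr1; set N := (size h)%:R.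
have N0 : 0 < N by rewrite /N (hist_size hh).
transitivity (signed_sum s z h + s ^+ size h * z y +
   c' / 2 * - e * ((signed_sum (- s) z h) / (N + 1)) -
   c' / 2 * (e * e) * (s ^+ size h * z y) / (N + 1)).
  by field; rewrite gt_eqF// ltr_wpDr.
rewrite e2; field; by rewrite !gt_eqF// ltr_wpDr.
Qed.

(** The oscillating term of [step_avg_sign] is gone at order one: what is left
    of it carries the factor [1 / (n + 1)]. *)
Lemma incr_drift n h : hist n h ->
  incr0 h + incr1 h * step_avg h z =
  c * mean_sum z s h + c' / 2 * (size h).+1%:R^-1 *
   ((-1) ^+ size h * mean_sum z (- s) h -
     (c * mean_sum z s h + (-1) ^+ size h * c' * mean_sum z (- s) h)).
Proof.
move=> hh; rewrite /incr1 mulrAC (step_avg_sign hh) /incr0.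
by field; rewrite nat1r pnatr_eq0.
Qed.

Let avg_bound n h : hist n h ->
  `|c * mean_sum z s h + (-1) ^+ size h * c' * mean_sum z (- s) h| <= B.
Proof.
move=> hh; rewrite -(step_avg_sign hh) normrM (norm_sign _ s2) mul1r.
rewrite ler_norml; apply/andP; split.
  rewrite -(sac (-B) hh).
  by apply: (sal hh) => y /zB; rewrite ler_norml => /andP[].
rewrite -(sac B hh).
by apply: (sal hh) => y /zB; rewrite ler_norml => /andP[].
Qed.

Let half_coef t : t ^+ 2 = 1 -> `|memory_coef t / 2| <= 2^-1.
Proof.
by move=> t2; rewrite normrM normfV normr_nat ler_piMl ?memory_coef_bound.
Qed.

Let B_ge0 n h : hist n h -> 0 <= B.
Proof. by move=> hh; apply: le_trans (mean_sum_bound s2 hh). Qed.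

Let next_inv n h : hist n h ->
  [/\ 0 < (size h).+1%:R^-1 :> R, (size h).+1%:R^-1 <= 1 :> R &
      (size h)%:R * (size h).+1%:R^-1 <= 1 :> R].
Proof.
move=> hh; split; first by rewrite invr_gt0.
  by rewrite invf_le1// ler1n.
by rewrite ler_pdivrMr// mul1r ler_nat.
Qed.

Lemma corrected_diff n h : hist n h ->
  `|corrected h - signed_sum s z h| <= B / 2.
Proof.
move=> hh; rewrite /corrected addrAC subrr add0r.
rewrite -mulrA (le_trans (normM_le (half_coef s2') (lexx _)))// mulrC.
by rewrite ler_pM2r// normrM (norm_sign _ eps2) mul1r (mean_sum_bound _ hh).
Qed.

Lemma corrected_bound n h : hist n h ->
  `|corrected h| <= 3 / 2 * B * (size h)%:R.
Proof.
move=> hh; have B0 := B_ge0 hh.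
rewrite -(subrK (signed_sum s z h) (corrected h)).
apply: (le_trans (ler_normD _ _)).
have h1 := corrected_diff hh; have h2 := signed_sum_bound s2 hh zB.
have N1 : 1 <= (size h)%:R :> R by rewrite ler1n (hist_size hh).
have : B * 1 <= B * (size h)%:R by rewrite ler_wpM2l.
by lra.
Qed.

Lemma incr0_bound n h : hist n h -> `|incr0 h| <= `|mean_sum z (- s) h|.
Proof.
move=> hh; have [j0 j1 _] := next_inv hh.
rewrite (_ : incr0 h = - (c' / 2 * (2 - (size h).+1%:R^-1) *
    (-1) ^+ size h * mean_sum z (- s) h)); last by rewrite /incr0; ring.
rewrite normrN normrM ler_piMl// normrM (norm_sign _ eps2) mulr1.
apply: (@le_trans _ _ (2^-1 * 2)); last by rewrite mulVf.
move: j0 j1; set j := _.+1%:R^-1 => j0 j1.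
by rewrite normM_le ?half_coef// ger0_norm; lra.
Qed.

Lemma incr1_bound n h : hist n h -> `|incr1 h| <= 3 / 2.
Proof.
move=> hh; have [j0 j1 _] := next_inv hh.
rewrite normrM (norm_sign _ s2) mul1r (le_trans (ler_normB _ _))// normr1.
have : `|c' / 2 * (size h).+1%:R^-1| <= 2^-1 * 1.
  by apply: normM_le; rewrite ?half_coef// ger0_norm// ltW.
by lra.
Qed.

Lemma incr_bound n h y : hist n h -> y \in Vs ->
  `|incr0 h + incr1 h * z y| <= 3 * B.
Proof.
move=> hh yV; have B0 := B_ge0 hh.
apply: (le_trans (ler_normD _ _)).
have h1 := le_trans (incr0_bound hh) (mean_sum_bound s2' hh).
have := normM_le (incr1_bound hh) (zB yV).
by lra.
Qed.

(** The drift multiplies the square by about [1 + 2 c / n], and [2 c <= 1].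
    The cross terms stay bounded because [Q / N] is bounded and the correction
    is bounded. *)
Lemma corrected_sqr_step n h : hist n h -> c <= 2^-1 ->
  step_avg h (fun y => corrected (y :: h) ^+ 2) <=
  (1 + (size h)%:R^-1) * corrected h ^+ 2 + 14 * B ^+ 2.
Proof.
move=> hh c12; have B0 := B_ge0 hh; have [j0 j1 Nj] := next_inv hh.
set Q := corrected h.
have N0 : 0 < (size h)%:R :> R by rewrite (hist_size hh).
apply: (@le_trans _ _ (step_avg h (fun y =>
   (Q ^+ 2 + 9 * B ^+ 2 + 2 * Q * incr0 h) + 2 * Q * incr1 h * z y))).
  apply: (sal hh) => y yV; rewrite (corrected_cons _ hh) -/Q.
  have := incr_bound hh yV; set D := incr0 h + _ => D3.
  have : D ^+ 2 <= (3 * B) ^+ 2.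
    by rewrite -[D ^+ 2]real_normK ?num_real// lerXn2r ?nnegrE ?mulr_ge0.
  rewrite [2 * Q * incr1 h * z y](_ : _ = 2 * Q * D - 2 * Q * incr0 h); last first.
    by rewrite /D; ring.
  by move=> D9; rewrite sqrrD -mulrA -mulr_natl; lra.
rewrite step_avgD step_avgZ (sac _ hh).
have -> : Q ^+ 2 + 9 * B ^+ 2 + 2 * Q * incr0 h +
    2 * Q * incr1 h * step_avg h z =
  Q ^+ 2 + 9 * B ^+ 2 + 2 * Q * (incr0 h + incr1 h * step_avg h z) by ring.
rewrite (incr_drift hh).
set a := mean_sum z s h; set e := (-1) ^+ size h; set a' := mean_sum z (- s) h.
set j := (size h).+1%:R^-1; set N := (size h)%:R.
have aB : `|a| <= B by exact: (mean_sum_bound s2 hh).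
have a'B : `|e * a'| <= B.
  by rewrite normrM (norm_sign _ eps2) mul1r (mean_sum_bound s2' hh).
have Qa : Q = N * a + c' / 2 * (e * a').
  rewrite /Q /corrected -/a' -/e -mulrA; congr (_ + _).
  by rewrite /a /mean_sum -/N mulrC divfK// lt0r_neq0.
have QN : `|Q / N| <= 3 / 2 * B.
  by rewrite normrM normfV (gtr0_norm N0) ler_pdivrMr// (corrected_bound hh).
have x1 : `|c' / 2 * (e * a')| <= 2^-1 * B by apply: normM_le => //; exact: half_coef.
have x2 : `|c * (Q / N) * (c' / 2 * (e * a'))| <= 1 * (3 / 2 * B) * (2^-1 * B).
  by apply: normM_le => //; apply: normM_le => //; exact: memory_coef_bound.
have x3 : `|c' / 2 * ((N * j) * (Q / N)) * (e * a' - (c * a + e * c' * a'))| <=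
     2^-1 * (1 * (3 / 2 * B)) * (B + B).
  apply: normM_le; last by rewrite (le_trans (ler_normB _ _))// lerD// (avg_bound hh).
  apply: normM_le; first exact: half_coef.
  by apply: normM_le => //; rewrite ger0_norm// mulr_ge0// ltW.
have x4 : c * (Q ^+ 2 / N) <= 2^-1 * (Q ^+ 2 / N).
  by apply: ler_wpM2r => //; apply: divr_ge0; [exact: sqr_ge0|exact: ltW].
have -> : 2 * Q * (c * a + c' / 2 * j * (e * a' - (c * a + e * c' * a'))) =
   2 * (c * (Q ^+ 2 / N)) - 2 * (c * (Q / N) * (c' / 2 * (e * a')))
   + 2 * (c' / 2 * ((N * j) * (Q / N)) * (e * a' - (c * a + e * c' * a'))).
  have -> : Q ^+ 2 / N = Q / N * (N * a + c' / 2 * (e * a')) by rewrite -Qa; ring.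
  field; exact: lt0r_neq0.
move: x2 x3; rewrite !ler_norml => /andP[x21 x22] /andP[x31 x32].
have -> : (1 + N^-1) * Q ^+ 2 = Q ^+ 2 + Q ^+ 2 / N by ring.
by lra.
Qed.

(** The recursion [x_(n+1) = (1 + 1/n) x_n + C] is solved by [C n H_n] with
    [H_n] the harmonic sum: this is where the logarithm of the normalization
    originates. *)
Lemma corrected_second_moment n : c <= 2^-1 ->
  hist_avg n (fun h => corrected h ^+ 2) <=
  14 * B ^+ 2 * n.+1%:R * series harmonic n.+1.
Proof.
move=> c12; elim: n => [|n IH].
  have -> : series (@harmonic R) 1 = 1 by rewrite seriesEnat/= big_nat1 /= invr1.
  rewrite !mulr1.
  rewrite -[leRHS](hac 0).
  apply: hal => h hh; have := corrected_bound hh.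
  rewrite (hist_size hh) mulr1 => QB.
  have B0 := B_ge0 hh.
  rewrite -[_ ^+ 2]real_normK ?num_real//.
  apply: (@le_trans _ _ ((3 / 2 * B) ^+ 2)).
    by rewrite lerXn2r ?nnegrE ?mulr_ge0.
  by have := sqr_ge0 B; rewrite exprMn; lra.
rewrite /=.
apply: (@le_trans _ _ (hist_avg n (fun h =>
   (1 + n.+1%:R^-1) * corrected h ^+ 2 + 14 * B ^+ 2))).
  apply: hal => h hh.
  by rewrite -(hist_size hh); exact: (corrected_sqr_step hh).
rewrite had hac haz.
rewrite [series _ n.+2]seriesS /=; set H := series _ _ in IH *.
apply: (@le_trans _ _ ((1 + n.+1%:R^-1) * (14 * B ^+ 2 * n.+1%:R * H) + 14 * B ^+ 2)).
  by apply: lerD => //; apply: ler_wpM2l => //; rewrite addr_ge0 ?invr_ge0.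
rewrite le_eqVlt; apply/orP; left; apply/eqP.
rewrite -[n.+2%:R]natr1 -!natr1; field.
by rewrite !natr1 !pnatr_eq0.
Qed.

Lemma signed_sum_second_moment n : c <= 2^-1 ->
  hist_avg n (fun h => signed_sum s z h ^+ 2) <=
  29 * B ^+ 2 * n.+1%:R * series harmonic n.+1.
Proof.
move=> c12.
apply: (@le_trans _ _ (hist_avg n (fun h =>
   2 * corrected h ^+ 2 + 2^-1 * B ^+ 2))).
  apply: hal => h hh.
  have := corrected_diff hh; have B0 := B_ge0 hh.
  set x := corrected h; set y := signed_sum s z h => xy.
  have : (x - y) ^+ 2 <= (B / 2) ^+ 2.
    by rewrite -[(x - y) ^+ 2]real_normK ?num_real// lerXn2r ?nnegrE ?mulr_ge0.
  (* [y^2 = 2 x^2 + 2 (x - y)^2 - (2 x - y)^2] *)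
  have := sqr_ge0 (2 * x - y).
  by nra.
rewrite had hac haz.
have H1 : 1 <= n.+1%:R * series (@harmonic R) n.+1.
  rewrite seriesEnat/= big_nat_recl//= invr1.
  rewrite mulr_ege1// ?ler1n// lerDl sumr_ge0// => i _.
have := corrected_second_moment n c12; have := sqr_ge0 B.
have : B ^+ 2 * 1 <= B ^+ 2 * (n.+1%:R * series (@harmonic R) n.+1).
  by rewrite ler_wpM2l// sqr_ge0.
by rewrite -![_ * _ * _ * series _ _]mulrA; lra.
Qed.

Lemma step_avg_center_bound n h : hist n h ->
  `|step_avg h z| <= `|mean_sum z s h| + `|mean_sum z (- s) h|.
Proof.
move=> hh; rewrite -[X in X <= _]mul1r -(norm_sign (size h) s2) -normrM.
rewrite (step_avg_sign hh) (le_trans (ler_normD _ _))//; apply: lerD.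
  by rewrite normrM ler_piMl// memory_coef_bound.
rewrite normrM ler_piMl// normrM (norm_sign _ eps2) mul1r.
exact: memory_coef_bound.
Qed.

(** The second moment of the mean is at most of order [n^(-2) n sqrt n =
    n^(-1/2)]. *)
Lemma mean_sum_L1 n : 0 < B -> c <= 2^-1 ->
  hist_avg n (fun h => `|mean_sum z s h|) <= 8 * B * quartic_inv R n.
Proof.
move=> B0 c12; have w0 := quartic_inv_gt0 R n.
apply: (hist_avg_norm_le uVs m2 hp hq); first by rewrite !mulr_gt0.
apply: (@le_trans _ _ (hist_avg n (fun h =>
    n.+1%:R ^- 2 * signed_sum s z h ^+ 2))).
  by apply: hal => h hh; rewrite /mean_sum (hist_size hh) exprMn exprVn mulrC.
rewrite haz.
apply: (@le_trans _ _ (n.+1%:R ^- 2 *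
    (29 * B ^+ 2 * n.+1%:R * (2 * Num.sqrt n.+1%:R)))).
  rewrite ler_wpM2l ?invr_ge0// (le_trans (signed_sum_second_moment n c12))//.
  apply: ler_wpM2l; last exact: harmonic_le_sqrt.
  by apply: mulr_ge0 => //; apply: mulr_ge0 => //; exact: sqr_ge0.
rewrite /quartic_inv; set r := Num.sqrt n.+1%:R.
have r0 : 0 < r by rewrite sqrtr_gt0.
have -> : n.+1%:R = r ^+ 2 by rewrite sqr_sqrtr.
have -> : (8 * B * (Num.sqrt r)^-1) ^+ 2 = 64 * B ^+ 2 / r.
  by rewrite -[in RHS](@sqr_sqrtr _ r) ?sqrtr_ge0//; field; rewrite sqrtr_eq0 -ltNge.
have -> : (r ^+ 2) ^- 2 * (29 * B ^+ 2 * r ^+ 2 * (2 * r)) = 58 * B ^+ 2 / r.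
  by field; rewrite gt_eqF.
by rewrite ler_pM2r ?invr_gt0//; have := sqr_ge0 B; lra.
Qed.

Definition normalized (h : seq V) : R := corrected h / Num.sqrt (size h)%:R.

Definition shrink (h : seq V) : R :=
  Num.sqrt (size h).+1%:R / Num.sqrt (size h)%:R - 1.

Definition norm_incr (h : seq V) (y : V) : R :=
  (incr0 h + incr1 h * z y - corrected h * shrink h) / Num.sqrt (size h).+1%:R.

Lemma normalized_cons n h y : hist n h ->
  normalized (y :: h) = normalized h + norm_incr h y.
Proof.
move=> hh; rewrite /normalized (corrected_cons _ hh) /norm_incr /shrink /=.
by field; rewrite !sqrtr_eq0 -!ltNge (hist_size hh) !ltr0n.
Qed.

Let shrinkP n h : hist n h ->
  [/\ 0 <= shrink h, (size h)%:R * shrink h <= 2^-1, shrink h <= (2 * (size h)%:R)^-1 &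
   `|2^-1 - (size h)%:R * shrink h| <= (8 * (size h)%:R)^-1].
Proof.
move=> hh; have [k0 [k1 k2]] := sqrt_succ R n.
rewrite /shrink (hist_size hh); split=> //.
by move: k1; rewrite invfM [2^-1 * _]mulrC -ler_pdivlMl// invrK.
Qed.

Let corrected_split n h : hist n h -> corrected h =
  (size h)%:R * mean_sum z s h + c' / 2 * ((-1) ^+ size h * mean_sum z (- s) h).
Proof.
move=> hh; rewrite /corrected -mulrA; congr (_ + _).
by rewrite /mean_sum mulrC divfK// (hist_size hh) pnatr_eq0.
Qed.

Definition mean_size (h : seq V) : R := `|mean_sum z s h| + `|mean_sum z (- s) h|.

(** Here the critical value enters: the drift [c / n] of the corrected sum and
    the relative growth [1 / (2 n)] of [sqrt n] cancel when [c = 1/2], so the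
    normalized sum has no drift up to a mean divided by [n]. *)
Lemma norm_incr_drift n h : hist n h -> c = 2^-1 ->
  `|step_avg h (norm_incr h)| <=
  2 * mean_size h / (size h)%:R.
Proof.
move=> hh c12; have [k0 _ k1 k2] := shrinkP hh.
have r1 : 1 <= Num.sqrt (size h).+1%:R :> R.
  by rewrite -[X in X <= _]sqrtr1 ler_wsqrtr// ler1n.
have r0 : 0 < Num.sqrt (size h).+1%:R :> R by apply: lt_le_trans r1.
rewrite (_ : step_avg h _ = (incr0 h + incr1 h * step_avg h z -
    corrected h * shrink h) / Num.sqrt (size h).+1%:R); last first.
  transitivity (step_avg h (fun y => (incr0 h - corrected h * shrink h) /
      Num.sqrt (size h).+1%:R + incr1 h / Num.sqrt (size h).+1%:R * z y)).
    by apply: step_avg_eq => y _; rewrite /norm_incr; ring.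
  by rewrite step_avgD (sac _ hh) step_avgZ; ring.
rewrite normrM normfV (gtr0_norm r0) ler_pdivrMr//.
apply: (@le_trans _ _ (2 * mean_size h / (size h)%:R)); last first.
  by rewrite ler_peMr// !mulr_ge0// addr_ge0.
rewrite (incr_drift hh) (corrected_split hh) c12 /mean_size.
set a := mean_sum z s h; set e := (-1) ^+ size h; set a' := mean_sum z (- s) h.
move: k0 k1 k2; set k := shrink h => k0 k1 k2.
have j0 : 0 <= (size h).+1%:R^-1 :> R by rewrite invr_ge0.
have : (size h).+1%:R^-1 <= (size h)%:R^-1 :> R.
  by rewrite lef_pV2 ?posrE ?ltr0n ?(hist_size hh)// ler_nat.
move: j0; set j := (size h).+1%:R^-1; rewrite invfM in k1; rewrite invfM in k2.
have : 0 <= (size h)%:R^-1 :> R by rewrite invr_ge0.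
move: k1 k2; set i := (size h)%:R^-1; set N := (size h)%:R => k1 k2 i0 j0 ji.
have ea : `|e * a'| = `|a'| by rewrite normrM (norm_sign _ eps2) mul1r.
have x1 : `|(2^-1 - N * k) * a| <= 8^-1 * i * `|a| by exact: normM_le.
have x2 : `|c' / 2 * k * (e * a')| <= 2^-1 * (2^-1 * i) * `|a'|.
  rewrite -ea; apply: normM_le => //; apply: normM_le; first exact: half_coef.
  by rewrite ger0_norm.
have x3 : `|c' / 2 * j * (e * a' - (2^-1 * a + e * c' * a'))| <=
    2^-1 * i * (`|a'| + (`|a| + `|a'|)).
  apply: normM_le; first by apply: normM_le; rewrite ?half_coef// ger0_norm.
  rewrite (le_trans (ler_normB _ _))// ea lerD//.
  rewrite (le_trans (ler_normD _ _))// lerD//.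
    by rewrite normrM ler_piMl// ger0_norm// invf_le1// ler1n.
  by rewrite mulrAC mulrC normrM ea ler_piMl// memory_coef_bound.
rewrite (_ : _ - _ = (2^-1 - N * k) * a - c' / 2 * k * (e * a') +
  c' / 2 * j * (e * a' - (2^-1 * a + e * c' * a'))); last by ring.
rewrite (le_trans (ler_normD _ _))//.
apply: (le_trans (lerD (ler_normB _ _) (lexx _))).
have ia : 0 <= i * `|a| by rewrite mulr_ge0.
have ia' : 0 <= i * `|a'| by rewrite mulr_ge0.
have -> : 2 * (`|a| + `|a'|) * i = 2 * (i * `|a|) + 2 * (i * `|a'|) by ring.
by lra.
Qed.

Let corrected_shrink n h : hist n h ->
  `|corrected h * shrink h| <= `|mean_sum z s h| / 2 + `|mean_sum z (- s) h| / 4.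
Proof.
move=> hh; have [k0 k1 k2 _] := shrinkP hh.
rewrite (corrected_split hh) mulrDl (le_trans (ler_normD _ _))// lerD//.
  rewrite mulrAC [X in _ <= X]mulrC; apply: normM_le => //.
  by rewrite ger0_norm// mulr_ge0.
rewrite mulrC mulrA.
have -> : `|mean_sum z (- s) h| / 4 = 2^-1 * 2^-1 * `|mean_sum z (- s) h| by field.
apply: normM_le; last by rewrite normrM (norm_sign _ eps2) mul1r.
apply: normM_le; last exact: half_coef.
rewrite ger0_norm// (le_trans k2)// lef_pV2 ?posrE//.
  by rewrite ler_peMr// ler1n (hist_size hh).
by rewrite mulr_gt0// ltr0n (hist_size hh).
Qed.

Lemma norm_incr_bound n h y : hist n h -> y \in Vs ->
  `|Num.sqrt (size h).+1%:R * norm_incr h y| <= 4 * B.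
Proof.
move=> hh yV; rewrite /norm_incr mulrC divfK; last first.
  by rewrite sqrtr_eq0 -ltNge ltr0n.
rewrite (le_trans (ler_normB _ _))//.
have h1 := incr_bound hh yV; have h2 := corrected_shrink hh.
have h3 := mean_sum_bound s2 hh; have h4 := mean_sum_bound s2' hh.
have B0 := B_ge0 hh.
by lra.
Qed.

(** The rescaled increment is the signed new step [+- z y] up to terms that
    are small in mean, and the sign disappears in the square. *)
Lemma norm_incr_sqr n h y : hist n h -> y \in Vs ->
  `|(Num.sqrt (size h).+1%:R * norm_incr h y) ^+ 2 - z y ^+ 2| <=
  (2 * mean_size h + B / (size h)%:R) * (5 * B).
Proof.
move=> hh yV; have := norm_incr_bound hh yV.
set D := Num.sqrt _ * _ => D4.
have S2 := sqr_sign (size h) s2.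
have -> : D ^+ 2 - z y ^+ 2 = (D - s ^+ size h * z y) * (D + s ^+ size h * z y).
  transitivity (D ^+ 2 - (s ^+ size h * s ^+ size h) * z y ^+ 2); last by ring.
  by rewrite S2 mul1r.
have Sz : `|s ^+ size h * z y| <= B by rewrite normrM (norm_sign _ s2) mul1r zB.
apply: normM_le; last first.
  by rewrite (le_trans (ler_normD _ _))//; lra.
have -> : D - s ^+ size h * z y = incr0 h -
   c' / 2 * (size h).+1%:R^-1 * (s ^+ size h * z y) - corrected h * shrink h.
  rewrite /D /norm_incr mulrC divfK; last by rewrite sqrtr_eq0 -ltNge ltr0n.
  by rewrite /incr1; ring.
have h1 := corrected_shrink hh; have h2 := incr0_bound hh.
have h3 : `|c' / 2 * (size h).+1%:R^-1 * (s ^+ size h * z y)| <=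
   2^-1 * (size h)%:R^-1 * B.
  apply: normM_le => //; apply: normM_le; first exact: half_coef.
  rewrite ger0_norm ?invr_ge0// lef_pV2 ?posrE ?ltr0n ?(hist_size hh)// ler_nat//.
have h4 : 0 <= B / (size h)%:R by rewrite mulr_ge0 ?invr_ge0 ?(B_ge0 hh).
rewrite (le_trans (ler_normB _ _))//.
apply: (le_trans (lerD (ler_normB _ _) (lexx _))).
have a0 := normr_ge0 (mean_sum z s h); have a'0 := normr_ge0 (mean_sum z (- s) h).
rewrite (_ : 2^-1 * _ * B = 2^-1 * (B / (size h)%:R)) in h3; last by ring.
rewrite /mean_size; lra.
Qed.

End corrected.

Lemma step_avg_norm_le n h (f : V -> R) K : hist n h ->
  (forall y, y \in Vs -> `|f y| <= K) -> `|step_avg h f| <= K.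
Proof.
move=> hh fK; rewrite ler_norml; apply/andP; split.
  rewrite -(sac (- K) hh); apply: (sal hh) => y /fK.
  by rewrite ler_norml => /andP[].
by rewrite -(sac K hh); apply: (sal hh) => y /fK; rewrite ler_norml => /andP[].
Qed.

Definition step_variance (z : V -> R) : R := m^-1 * \sum_(y <- Vs) z y ^+ 2.

Section charfun.
Variables (z : V -> R) (B : R).
Hypotheses (z0 : \sum_(y <- Vs) z y = 0) (zB : forall y, y \in Vs -> `|z y| <= B).
Hypothesis B1 : 1 <= B.
Variable s : R.
Hypothesis s2 : s ^+ 2 = 1.
Hypotheses (c12 : memory_coef s = 2^-1) (c'12 : memory_coef (- s) <= 2^-1).

Local Notation W := (normalized z s).
Local Notation var := (step_variance z).
Let z2 (y : V) : R := z y ^+ 2 - var.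

Let B0 : 0 < B. Proof. exact: lt_le_trans B1. Qed.

Let z2_bound y : y \in Vs -> 0 <= z y ^+ 2 <= B ^+ 2.
Proof.
move=> yV; rewrite sqr_ge0 -[z y ^+ 2]real_normK ?num_real//.
by rewrite lerXn2r ?nnegrE ?zB// ltW.
Qed.

Let m_gt0 : 0 < m.
Proof. by rewrite ltr0n; case: (size Vs) m2. Qed.

Lemma step_variance_bound : 0 <= var <= B ^+ 2.
Proof.
apply/andP; split.
  by rewrite mulr_ge0 ?invr_ge0// sumr_ge0// => y _; exact: sqr_ge0.
rewrite /step_variance mulrC ler_pdivrMr//.
apply: (@le_trans _ _ (\sum_(y <- Vs) B ^+ 2)).
  rewrite big_seq [leRHS]big_seq; apply: ler_sum => y yV.
  by have /andP[] := z2_bound yV.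
by rewrite big_const_seq count_predT iter_addr_0 mulr_natr.
Qed.

Let z2_center : \sum_(y <- Vs) z2 y = 0.
Proof.
rewrite sumrB big_const_seq count_predT iter_addr_0 -mulr_natl.
by rewrite /step_variance mulrA divff ?mul1r ?subrr// gt_eqF.
Qed.

Let z2B y : y \in Vs -> `|z2 y| <= B ^+ 2.
Proof.
move=> yV; have := z2_bound yV; have := step_variance_bound.
rewrite ler_norml /z2 => /andP[v0' v1] /andP[z0' z1].
by apply/andP; split; lra.
Qed.

(** Second-order expansion of the cosine around the previous value. The
    first-order term is controlled by [norm_incr_drift]. In the second-order
    term the conditional variance of the new step differs from [var] by the
    conditional mean of the centred function [z2], which is again a
    combination of signed means. The third-order term is bounded through
    [|norm_incr h| <= 4 B / sqrt (n + 2)], whence [64 B^3]. *)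
Lemma char_step n h th b : hist n h -> 0 <= th <= 1 ->
  `|step_avg h (fun y => cos (th * W (y :: h) + b)) -
    (1 - th ^+ 2 * var / 2 / n.+2%:R) * cos (th * W h + b)| <=
  th / n.+1%:R * ((2 + 5 * B) * mean_size z s h + 2^-1 * mean_size z2 s h +
    (3 * B ^+ 2 + 64 * B ^+ 3) * quartic_inv R n).
Proof.
move=> hh /andP[th0 th1].
set x := th * W h; set C := cos (x + b); set S := sin (x + b).
set D := norm_incr z s h; set r1 : R := Num.sqrt (size h).+1%:R.
have r1_gt0 : 0 < r1 by rewrite sqrtr_gt0 ltr0n.
have r1E : r1 ^+ 2 = n.+2%:R by rewrite /r1 (hist_size hh) sqr_sqrtr.
pose err y := cos (x + th * D y + b) - (C - S * (th * D y) - C * ((th * D y) ^+ 2 / 2)).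
have rD y : (r1 * D y) ^+ 2 = n.+2%:R * D y ^+ 2 by rewrite exprMn r1E.
have lin (e f g g' : V -> R) (a0 a1 a2 a3 : R) :
    step_avg h (fun y => e y + (a0 + (a1 * f y + (a2 * g y + (a2 * g' y + a3))))) =
    step_avg h e + (a0 + (a1 * step_avg h f +
      (a2 * step_avg h g + (a2 * step_avg h g' + a3)))).
  by rewrite !step_avgD !step_avgZ !(sac _ hh).
pose k := - (C * th ^+ 2 / 2 / n.+2%:R).
have -> : step_avg h (fun y => cos (th * W (y :: h) + b)) =
  step_avg h err + C - S * th * step_avg h D +
  k * (step_avg h (fun y => (r1 * D y) ^+ 2 - z y ^+ 2) + step_avg h z2 + var).
  transitivity (step_avg h (fun y => err y + (C + ((- (S * th)) * D y +
     (k * ((r1 * D y) ^+ 2 - z y ^+ 2) + (k * z2 y + k * var)))))).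
    apply: step_avg_eq => y yV.
    rewrite (normalized_cons _ _ _ hh) mulrDr -/x -/(D y) /err /k /z2.
    rewrite rD; field.
    by rewrite -(natrD _ 2) pnatr_eq0.
  by rewrite lin; ring.
have Cb : `|C| <= 1 by exact: cos_max.
have Sb : `|S| <= 1 by exact: sin_max.
have kb : `|k| <= th / n.+1%:R / 2.
  rewrite (_ : k = - C * (th * (th / n.+2%:R) / 2)); last by rewrite /k; ring.
  rewrite -[X in _ <= X]mul1r; apply: normM_le; first by rewrite normrN.
  rewrite ger0_norm ?mulr_ge0 ?invr_ge0// ler_wpM2r// ler_wpM2l//.
  apply: (@le_trans _ _ n.+2%:R^-1); first by rewrite ler_piMl// invr_ge0.
  by rewrite lef_pV2 ?posrE// ler_nat.
set w := quartic_inv R n; have w0 : 0 < w by exact: quartic_inv_gt0.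
have w1 : w <= 1.
  rewrite invf_le1 ?sqrtr_gt0 ?sqrtr_gt0//.
  by rewrite -[leLHS]sqrtr1 ler_wsqrtr// -[leLHS]sqrtr1 ler_wsqrtr// ler1n.
have w2 : (Num.sqrt n.+1%:R)^-1 = w ^+ 2 :> R.
  by rewrite exprVn sqr_sqrtr ?sqrtr_ge0.
have w4 : n.+1%:R^-1 = w ^+ 4 :> R by rewrite quartic_inv4.
have ww : w ^+ 2 <= w by rewrite expr2 ler_piMl// ltW.
have r1w : r1^-1 <= w.
  apply: le_trans ww; rewrite -w2 lef_pV2 ?posrE ?sqrtr_gt0//.
  by rewrite ler_wsqrtr// (hist_size hh) ler_nat.
have e1 : `|step_avg h err| <= th / n.+1%:R * (64 * B ^+ 3 * w).
  apply: (step_avg_norm_le hh) => y yV.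
  apply: (le_trans (cos_second_order _ _ _)).
  have := norm_incr_bound zB s2 hh yV; rewrite -/r1 -/(D y) => h4.
  have h5 : `|D y| <= 4 * B * r1^-1.
    by rewrite ler_pdivlMr// mulrC -[X in X * _](gtr0_norm r1_gt0) -normrM.
  rewrite normrM (ger0_norm th0) exprMn.
  apply: (@le_trans _ _ (th * (4 * B * r1^-1) ^+ 3)).
    apply: ler_pM => //; rewrite ?exprn_ge0//.
      by rewrite exprS ler_piMr// exprn_ile1.
    by rewrite lerXn2r// nnegrE !mulr_ge0// ?invr_ge0 ltW.
  rewrite -[leRHS]mulrA; apply: ler_wpM2l => //.
  rewrite (_ : (4 * B * r1^-1) ^+ 3 = r1 ^- 2 * (64 * B ^+ 3 * r1^-1)); last by field; rewrite gt_eqF.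
  have B3 : 0 <= 64 * B ^+ 3 by rewrite mulr_ge0// exprn_ge0// ltW.
  rewrite r1E; apply: ler_pM.
  - by rewrite invr_ge0.
  - by rewrite mulr_ge0// invr_ge0 ltW.
  - by rewrite lef_pV2 ?posrE// ler_nat.
  - exact: ler_wpM2l.
have e2 := norm_incr_drift z0 s2 hh c12.
have e3 : `|step_avg h (fun y => (r1 * D y) ^+ 2 - z y ^+ 2)| <=
    (2 * mean_size z s h + B * w) * (5 * B).
  apply: (step_avg_norm_le hh) => y yV.
  apply: (le_trans (norm_incr_sqr zB s2 hh yV)).
  rewrite ler_wpM2r ?mulr_ge0 ?(ltW B0)// lerD2l ler_wpM2l ?(ltW B0)//.
  rewrite (hist_size hh) w4; apply: (le_trans _ ww).
  by rewrite (exprD w 2 2) ler_piMl ?sqr_ge0// (le_trans ww).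
have e4 := step_avg_center_bound z2_center s2 hh.
rewrite (_ : _ - _ = step_avg h err - S * th * step_avg h D +
  k * (step_avg h (fun y => (r1 * D y) ^+ 2 - z y ^+ 2) + step_avg h z2)); last first.
  by rewrite /k; ring.
rewrite (le_trans (ler_normD _ _))//.
apply: (le_trans (lerD (ler_normB _ _) (lexx _))).
have e5 : `|S * th * step_avg h D| <= 1 * th * (2 * mean_size z s h / n.+1%:R).
  apply: normM_le; first by apply: normM_le => //; rewrite ger0_norm.
  by rewrite -(hist_size hh).
have e6 : `|k * (step_avg h (fun y => (r1 * D y) ^+ 2 - z y ^+ 2) + step_avg h z2)| <=
   th / n.+1%:R / 2 * ((2 * mean_size z s h + B * w) * (5 * B) + mean_size z2 s h).
  by apply: normM_le => //; rewrite (le_trans (ler_normD _ _))// lerD.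
apply: (le_trans (lerD (lerD e1 e5) e6)).
rewrite -subr_ge0 (_ : _ - _ = th / n.+1%:R * (B ^+ 2 * w / 2)); last by field; rewrite nat1r pnatr_eq0.
by rewrite !mulr_ge0// ?invr_ge0// ?sqr_ge0// ltW.
Qed.

Definition char_avg (n : nat) (th b : R) : R :=
  hist_avg n (fun h => cos (th * W h + b)).

Lemma char_avg_bound n th b : `|char_avg n th b| <= 1.
Proof.
rewrite (le_trans (hist_avg_norm v0 m2 hp hq _ _))// -[leRHS](hac n 1).
by apply: hal => h hh; exact: cos_max.
Qed.

Let mean_size_L1 n : hist_avg n (mean_size z s) <= 16 * B * quartic_inv R n.
Proof.
have s2' : (- s) ^+ 2 = 1 by rewrite sqrrN.
rewrite had (le_trans (lerD (mean_sum_L1 z0 zB s2 n B0 _)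
  (mean_sum_L1 z0 zB s2' n B0 c'12)))// ?c12//.
by rewrite le_eqVlt; apply/orP; left; apply/eqP; ring.
Qed.

Let mean_size2_L1 n : hist_avg n (mean_size z2 s) <= 16 * B ^+ 2 * quartic_inv R n.
Proof.
have s2' : (- s) ^+ 2 = 1 by rewrite sqrrN.
have B20 : 0 < B ^+ 2 by rewrite exprn_gt0.
rewrite had (le_trans (lerD (mean_sum_L1 z2_center z2B s2 n B20 _)
  (mean_sum_L1 z2_center z2B s2' n B20 c'12)))// ?c12//.
by rewrite le_eqVlt; apply/orP; left; apply/eqP; ring.
Qed.

(** The means that appear in [char_step] are [O(n^(-1/4))] in [L^1], so that
    the recursion holds with a summable error. The bounds on [B] collapse the
    polynomial in [B] to its highest power, using [1 <= B]. *)
Lemma char_avg_step n th b : 0 <= th <= 1 ->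
  `|char_avg n.+1 th b - expR (- (th ^+ 2 * var / 2 / n.+2%:R)) * char_avg n th b|
  <= th * (188 * B ^+ 4) * quartic_inv R n ^+ 5.
Proof.
move=> th01; have /andP[th0 th1] := th01.
set x := th ^+ 2 * var / 2 / n.+2%:R; set w := quartic_inv R n.
have w0 : 0 < w by exact: quartic_inv_gt0.
have w4 : n.+1%:R^-1 = w ^+ 4 by rewrite quartic_inv4.
have w1 : w <= 1.
  rewrite invf_le1 ?sqrtr_gt0 ?sqrtr_gt0//.
  by rewrite -[leLHS]sqrtr1 ler_wsqrtr// -[leLHS]sqrtr1 ler_wsqrtr// ler1n.
have [v0' vB] := andP step_variance_bound.
have x0 : 0 <= x by rewrite divr_ge0// divr_ge0// mulr_ge0// sqr_ge0.
have B2 : B <= B ^+ 2 by rewrite expr2 ler_peMr// ltW.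
have B3 : B ^+ 2 <= B ^+ 3 by rewrite [leRHS]exprS ler_peMl// sqr_ge0.
have B4 : B ^+ 3 <= B ^+ 4 by rewrite [leRHS]exprS ler_peMl// exprn_ge0// ltW.
rewrite (_ : _ - _ = hist_avg n (fun h =>
    step_avg h (fun y => cos (th * W (y :: h) + b)) - (1 - x) * cos (th * W h + b))
    + (- (expR (- x) - (1 - x))) * char_avg n th b); last first.
  have -> : hist_avg n (fun h => step_avg h (fun y => cos (th * W (y :: h) + b)) -
      (1 - x) * cos (th * W h + b)) =
    hist_avg n (fun h => step_avg h (fun y => cos (th * W (y :: h) + b)) +
      (- (1 - x)) * cos (th * W h + b)).
    by apply: (hist_avg_eq v0 m2 hp hq) => h _; rewrite mulNr.
  by rewrite had haz /char_avg /=; ring.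
rewrite (le_trans (ler_normD _ _))//.
have e1 : `|- (expR (- x) - (1 - x)) * char_avg n th b| <= th * (B ^+ 4 / 4 * w ^+ 5).
  apply: (@le_trans _ _ (x ^+ 2 * 1)).
    by apply: normM_le; rewrite ?char_avg_bound// normrN expRN_taylor.
  rewrite mulr1 /x.
  have -> : (th ^+ 2 * var / 2 / n.+2%:R) ^+ 2 =
    th * (th ^+ 3 * (var ^+ 2 / 4 * n.+2%:R ^- 2)).
    by field; rewrite -(natrD _ 2) pnatr_eq0.
  rewrite ler_wpM2l// -[leRHS]mul1r; apply: ler_pM.
  - by rewrite exprn_ge0.
  - by apply: mulr_ge0; [rewrite divr_ge0 ?exprn_ge0|rewrite invr_ge0 exprn_ge0].
  - by rewrite exprn_ile1.
  - apply: ler_pM; [by rewrite divr_ge0 ?exprn_ge0|by rewrite invr_ge0 exprn_ge0| |].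
      by rewrite ler_wpM2r// (exprM B 2 2) lerXn2r ?nnegrE ?sqr_ge0.
    apply: (@le_trans _ _ (n.+1%:R ^- 2)).
      by rewrite lef_pV2 ?posrE ?exprn_gt0// lerXn2r ?nnegrE// ler_nat.
    rewrite -exprVn w4 -exprM ler_wiXn2l// ltW//.
have e2 : `|hist_avg n (fun h => step_avg h (fun y => cos (th * W (y :: h) + b)) -
    (1 - x) * cos (th * W h + b))| <=
   th * w ^+ 4 * ((2 + 5 * B) * (16 * B * w) + 2^-1 * (16 * B ^+ 2 * w) +
    (3 * B ^+ 2 + 64 * B ^+ 3) * w).
  rewrite (le_trans (hist_avg_norm v0 m2 hp hq _ _))//.
  apply: (@le_trans _ _ (hist_avg n (fun h => th * w ^+ 4 *
    ((2 + 5 * B) * mean_size z s h + (2^-1 * mean_size z2 s h +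
    (3 * B ^+ 2 + 64 * B ^+ 3) * w))))).
    apply: hal => h hh; rewrite -w4 [(2 + 5 * B) * _ + _]addrA.
    exact: char_step.
  have lin (f g : seq V -> R) (a0 a1 a2 a3 : R) :
      hist_avg n (fun h => a0 * (a1 * f h + (a2 * g h + a3))) =
      a0 * (a1 * hist_avg n f + (a2 * hist_avg n g + a3)).
    by rewrite haz had haz had haz hac.
  rewrite lin.
  rewrite -[(2 + 5 * B) * (16 * B * w) + _ + _]addrA.
  apply: ler_wpM2l; first by rewrite mulr_ge0// exprn_ge0// ltW.
  apply: lerD; first by apply: ler_wpM2l => //; rewrite addr_ge0// mulr_ge0// ltW.
  by apply: lerD => //; exact: ler_wpM2l.
apply: (le_trans (lerD e2 e1)).
have -> : th * (188 * B ^+ 4) * w ^+ 5 = th * w ^+ 5 * (188 * B ^+ 4) by ring.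
have -> : th * w ^+ 4 * ((2 + 5 * B) * (16 * B * w) + 2^-1 * (16 * B ^+ 2 * w) +
    (3 * B ^+ 2 + 64 * B ^+ 3) * w) + th * (B ^+ 4 / 4 * w ^+ 5) =
  th * w ^+ 5 * (32 * B + 91 * B ^+ 2 + 64 * B ^+ 3 + B ^+ 4 / 4) by field.
apply: ler_wpM2l; first by rewrite mulr_ge0// exprn_ge0// ltW.
by have := exprn_ge0 4 (ltW B0); lra.
Qed.

(** The Gaussian factors are at most [1], so errors of the recursion simply
    add up. *)
Lemma char_avg_telescope n th b : 0 <= th <= 1 ->
  `|char_avg n th b -
    expR (- (th ^+ 2 * var / 2 * (series harmonic n.+1 - 1))) * char_avg 0 th b|
  <= th * (188 * B ^+ 4) * (8 * (1 - quartic_inv R n)).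
Proof.
move=> th01; have /andP[th0 th1] := th01.
elim: n => [|n IH].
  have -> : series (@harmonic R) 1 = 1 by rewrite seriesEnat/= big_nat1 /= invr1.
  rewrite subrr mulr0 oppr0 expR0 mul1r subrr normr0.
  by rewrite /quartic_inv !sqrtr1 invr1 subrr !mulr0.
have [v0' vB] := andP step_variance_bound.
rewrite seriesSr/=; set H := series _ _ in IH *.
set y := th ^+ 2 * var / 2 in IH *.
have y0 : 0 <= y by rewrite divr_ge0// mulr_ge0// sqr_ge0.
have -> : expR (- (y * (H + n.+2%:R^-1 - 1))) =
   expR (- (y / n.+2%:R)) * expR (- (y * (H - 1))).
  by rewrite -expRD; congr expR; ring.
set E := expR (- (y / n.+2%:R)); set F := expR _ in IH *.
have E1 : `|E| <= 1.
  by rewrite ger0_norm ?expR_ge0// expR_le1 oppr_le0 mulr_ge0// invr_ge0.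
rewrite (_ : _ - _ = (char_avg n.+1 th b - E * char_avg n th b) +
   E * (char_avg n th b - F * char_avg 0 th b)); last by ring.
rewrite (le_trans (ler_normD _ _))//.
have := char_avg_step n b th01; rewrite -/y -/E => h1.
have h2 := normM_le E1 IH.
have h3 := quartic_inv_telescope R n.
apply: (le_trans (lerD h1 h2)).
rewrite mul1r -mulrDr; apply: ler_wpM2l; last by lra.
by rewrite mulr_ge0// mulr_ge0// exprn_ge0// ltW.
Qed.

Lemma char_avg_estimate n th b : 0 <= th <= 1 ->
  `|char_avg n th b -
    expR (- (th ^+ 2 * var / 2 * (series harmonic n.+1 - 1))) * cos b|
  <= th * (1508 * B ^+ 4).
Proof.
move=> th01; have /andP[th0 th1] := th01.
have [v0' vB] := andP step_variance_bound.
have := char_avg_telescope n b th01; set E := expR _ => h1.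
have E1 : `|E| <= 1.
  rewrite ger0_norm ?expR_ge0// expR_le1 oppr_le0 mulr_ge0//.
    by rewrite divr_ge0// mulr_ge0// sqr_ge0.
  rewrite subr_ge0 seriesEnat/= big_nat_recl//= invr1 lerDl sumr_ge0// => i _.
have h2 : `|char_avg 0 th b - cos b| <= th * (2 * B).
  rewrite -[cos b](hac 0) /char_avg -mulN1r -haz -had.
  rewrite (le_trans (hist_avg_norm v0 m2 hp hq _ _))// -[leRHS](hac 0).
  apply: hal => h hh; rewrite mulN1r (le_trans (cos_lipschitz _ _))//.
  rewrite addrK normrM (ger0_norm th0) ler_wpM2l//.
  have := corrected_bound zB s2 hh.
  by rewrite /normalized (hist_size hh) sqrtr1 divr1; have := B0; lra.
have B4 : B <= B ^+ 4.
  by rewrite exprS; apply: ler_peMr; [exact: ltW|exact: exprn_ege1].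
have h3 := normM_le E1 h2.
rewrite (_ : _ - _ = (char_avg n th b - E * char_avg 0 th b) +
   E * (char_avg 0 th b - cos b)); last by ring.
rewrite (le_trans (ler_normD _ _))//.
apply: (le_trans (lerD h1 h3)).
rewrite mul1r -mulrA -mulrDr ler_wpM2l//.
have : 188 * B ^+ 4 * (8 * (1 - quartic_inv R n)) <= 188 * B ^+ 4 * 8.
  apply: ler_wpM2l; first by rewrite mulr_ge0// exprn_ge0// ltW.
  by have := quartic_inv_gt0 R n; lra.
by have := exprn_ge0 4 (ltW B0); lra.
Qed.

(** Dividing by [sqrt (n ln n)] amounts to evaluating the normalized sum at
    the frequency [th = (ln n)^(-1/2)]. Then [th^2 H_n] tends to [1] while
    every error is [O(th)], uniformly in [n]; a bounded change of the sum is
    likewise absorbed. *)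
Lemma scaled_char_cvg (g : seq V -> R) (K b : R) :
  (forall n h, hist n h -> `|g h - signed_sum s z h| <= K) ->
  hist_avg n (fun h => cos ((Num.sqrt (n.+1%:R * ln n.+1%:R))^-1 * g h + b))
    @[n --> \oo] --> expR (- (var / 2)) * cos b.
Proof.
move=> gK.
pose th n : R := (Num.sqrt (ln n.+1%:R))^-1.
have th_cvg : th n @[n --> \oo] --> 0.
  exact: cvg_inv_sqrt_ln.
pose E n := expR (- (th n ^+ 2 * var / 2 * (series harmonic n.+1 - 1))) * cos b.
have E_cvg : E n @[n --> \oo] --> expR (- (var / 2)) * cos b.
  apply: cvgM; last exact: cvg_cst.
  apply: continuous_cvg; first exact: continuous_expR.
  apply: cvgN.
  have -> : var / 2 = 1 * (var / 2) by rewrite mul1r.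
  have -> : (fun n => th n ^+ 2 * var / 2 * (series harmonic n.+1 - 1)) =
      (fun n => th n ^+ 2 * (series harmonic n.+1 - 1) * (var / 2)).
    by apply/funext => n; ring.
  by apply: cvgM; [exact: cvg_harmonic_ln|exact: cvg_cst].
rewrite -[X in _ --> X]addr0.
have -> : (fun n => hist_avg n (fun h =>
    cos ((Num.sqrt (n.+1%:R * ln n.+1%:R))^-1 * g h + b))) =
  (fun n => E n + (hist_avg n (fun h =>
    cos ((Num.sqrt (n.+1%:R * ln n.+1%:R))^-1 * g h + b)) - E n)).
  by apply/funext => n; ring.
apply: cvgD => //.
apply/norm_cvg0P.
apply: (@squeeze_cvgr _ _ _ _ (fun=> 0) (fun n => th n * (B / 2 + K + 1508 * B ^+ 4))).
- near=> n.
  rewrite normr_ge0/=.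
  have ln1 : 1 <= ln n.+1%:R :> R by near: n; exact: ln_nat_unbounded.
  have th01 : 0 <= th n <= 1.
    rewrite invr_ge0 sqrtr_ge0/= invf_le1 ?sqrtr_gt0 ?(lt_le_trans _ ln1)//.
    by rewrite -[leLHS]sqrtr1 ler_wsqrtr.
  have /andP[th0 th1] := th01.
  rewrite (_ : _ - _ = (hist_avg n (fun h =>
    cos ((Num.sqrt (n.+1%:R * ln n.+1%:R))^-1 * g h + b)) - char_avg n (th n) b) +
    (char_avg n (th n) b - E n)); last by ring.
  rewrite (le_trans (ler_normD _ _))// mulrDr; apply: lerD; last first.
    exact: char_avg_estimate.
  rewrite /char_avg -[X in _ - X]mul1r -mulNr -haz -had.
  rewrite (le_trans (hist_avg_norm v0 m2 hp hq _ _))// -[leRHS](hac n).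
  apply: hal => h hh; rewrite mulN1r (le_trans (cos_lipschitz _ _))//.
  have -> : (Num.sqrt (n.+1%:R * ln n.+1%:R))^-1 * g h + b - (th n * W h + b) =
    th n * ((Num.sqrt n.+1%:R)^-1 * (g h - corrected z s h)).
    by rewrite sqrtrM// invfM /normalized (hist_size hh) /th; ring.
  rewrite normrM (ger0_norm th0) ler_wpM2l//.
  rewrite -[leRHS]mul1r; apply: normM_le.
    rewrite ger0_norm ?invr_ge0 ?sqrtr_ge0// invf_le1 ?sqrtr_gt0//.
    by rewrite -[leLHS]sqrtr1 ler_wsqrtr// ler1n.
  have h1 := corrected_diff zB s2 hh; have h2 := gK _ _ hh.
  rewrite (_ : _ - _ = (g h - signed_sum s z h) - (corrected z s h - signed_sum s z h)); last by ring.
  by rewrite (le_trans (ler_normB _ _))//; lra.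
- exact: cvg_cst.
- rewrite -[X in _ --> X](mul0r (B / 2 + K + 1508 * B ^+ 4)).
  by apply: cvgM => //; exact: cvg_cst.
Unshelve. all: by end_near. Qed.

(** This bound is what provides tightness. *)
Lemma scaled_second_moment (g : seq V -> R) (K : R) : 0 <= K ->
  (forall n h, hist n h -> `|g h - signed_sum s z h| <= K) ->
  \forall n \near \oo, hist_avg n (fun h =>
    ((Num.sqrt (n.+1%:R * ln n.+1%:R))^-1 * g h) ^+ 2) <= 116 * B ^+ 2 + 2 * K ^+ 2.
Proof.
move=> K0 gK; near=> n.
have ln1 : 1 <= ln n.+1%:R :> R by near: n; exact: ln_nat_unbounded.
set L := n.+1%:R * ln n.+1%:R.
have L1 : 1 <= L by rewrite mulr_ege1// ler1n.
have L0 : 0 < L by apply: lt_le_trans L1.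
apply: (@le_trans _ _ (hist_avg n (fun h => L^-1 * (2 * signed_sum s z h ^+ 2 + 2 * K ^+ 2)))).
  apply: hal => h hh; rewrite exprMn exprVn sqr_sqrtr ?(ltW L0)//.
  apply: ler_wpM2l; first by rewrite invr_ge0 ltW.
  have := gK _ _ hh; set x := g h; set y := signed_sum _ _ _ => xy.
  have : (x - y) ^+ 2 <= K ^+ 2.
    by rewrite -[(x - y) ^+ 2]real_normK ?num_real// lerXn2r ?nnegrE.
  (* [x^2 = 2 y^2 + 2 (x - y)^2 - (x - 2 y)^2] *)
  have := sqr_ge0 (x - 2 * y).
  by nra.
have lin (f : seq V -> R) (a0 a1 a2 : R) :
    hist_avg n (fun h => a0 * (a1 * f h + a2)) = a0 * (a1 * hist_avg n f + a2).
  by rewrite haz had haz hac.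
rewrite lin.
have h1 := signed_sum_second_moment z0 zB s2 n (_ : memory_coef s <= 2^-1).
rewrite c12 in h1; have {h1} h1 := h1 (lexx _).
have h2 := harmonic_le_ln R n.
rewrite ler_pdivrMl// mulrDr; apply: lerD; last first.
  by rewrite ler_peMl// mulr_ge0// sqr_ge0.
rewrite (le_trans (ler_wpM2l _ h1))//.
rewrite (_ : 2 * (29 * B ^+ 2 * n.+1%:R * series harmonic n.+1) =
   (58 * B ^+ 2 * n.+1%:R) * series harmonic n.+1); last by ring.
rewrite (_ : L * (116 * B ^+ 2) = (58 * B ^+ 2 * n.+1%:R) * (2 * ln n.+1%:R)); last by rewrite /L; ring.
apply: ler_wpM2l; last by lra.
by rewrite mulr_ge0// mulr_ge0// sqr_ge0.
Unshelve. all: by end_near. Qed.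

End charfun.
End moments.

(** * A positive trigonometric kernel *)

Section fejer_kernel.
Variable R : realType.
Implicit Types u x : R.

Lemma cos_mul_sin (a x : R) : 2 * sin a * cos x = sin (x + a) - sin (x - a).
Proof. by rewrite sinD sinB; ring. Qed.

Lemma cos_mul (x y : R) : cos x * cos y = 2^-1 * (cos (x + y) + cos (x - y)).
Proof. by rewrite cosD cosB; field. Qed.

Definition grid (N : nat) (j : nat) : R := 2 * pi * j%:R / N%:R.

(** A sum over roots of unity; it telescopes after multiplication by [2 sin
    (pi k / N)]. *)
Lemma sum_cos_grid N k u : (0 < k < N)%N ->
  \sum_(j < N) cos (k%:R * (u - grid N j)) = 0.
Proof.
move=> /andP[k0 kN]; have N0 : (0 < N)%N by exact: leq_trans kN.
pose a : R := pi * k%:R / N%:R.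
have sa : 0 < sin a.
  apply: sin_gt0_pi; rewrite /a divr_gt0 ?mulr_gt0 ?pi_gt0 ?ltr0n//=.
  by rewrite ltr_pdivrMr ?ltr0n// ltr_pM2l ?pi_gt0// ltr_nat.
apply/(mulfI (lt0r_neq0 (mulr_gt0 (ltr0n R 2) sa))); rewrite mulr0 mulr_sumr.
pose g (j : nat) := sin (k%:R * u - 2 * a * j%:R + a).
rewrite (eq_bigr (fun j : 'I_N => - (g j.+1 - g j))); last first.
  move=> j _; rewrite cos_mul_sin /g opprB; congr (sin _ - sin _).
    by rewrite /grid /a; field; rewrite pnatr_eq0 -lt0n.
  by rewrite /grid /a -natr1; field; rewrite pnatr_eq0 -lt0n.
rewrite sumrN -(big_mkord xpredT (fun j => g j.+1 - g j)) telescope_sumr//.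
have -> : g N = g 0%N.
  rewrite /g mulr0 subr0 addrAC.
  rewrite -[LHS](periodicn (@sinD2pi R) k); congr sin.
  by rewrite /a -[pi *+ 2]mulr_natl -[_ *+ k]mulr_natr; field; rewrite pnatr_eq0 -lt0n.
by rewrite subrr oppr0.
Qed.

Lemma cos_pow_expand m x :
  (2 * cos x) ^+ m = \sum_(k < m.+1) 'C(m, k)%:R * cos ((m%:R - 2 * k%:R) * x).
Proof.
elim: m => [|m IH].
  by rewrite big_ord1 expr0 bin0 mulr0 subrr mul0r cos0 mulr1.
pose G (k : nat) := cos ((m.+1%:R - 2 * k%:R) * x).
rewrite exprS IH mulr_sumr.
rewrite (eq_bigr (fun k : 'I_m.+1 => 'C(m, k)%:R * G k + 'C(m, k)%:R * G k.+1)); last first.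
  move=> k _; rewrite -mulrDr mulrCA; congr (_ * _).
  rewrite /G -mulrA cos_mul mulrA divff ?mul1r//; congr (_ + _).
    by congr cos; rewrite -!natr1; ring.
  by rewrite -cosN; congr cos; rewrite -!natr1; ring.
rewrite big_split/= [RHS]big_ord_recl/=.
rewrite [in RHS](eq_bigr (fun k : 'I_m.+1 => 'C(m, k.+1)%:R * G k.+1 + 'C(m, k)%:R * G k.+1)); last first.
  by move=> k _; rewrite /bump/= add1n binS natrD mulrDl.
rewrite big_split/= addrA; congr (_ + _).
rewrite [in LHS]big_ord_recl [in RHS]big_ord_recr/= (bin_small (ltnSn m)) mul0r addr0 !bin0.
by congr (_ + _); apply: eq_bigr => k _.
Qed.

(** A power of cosine has frequencies at most [n]; a grid with more than [n]
    points annihilates all of them but the constant one, whose coefficient is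
    the central binomial coefficient. *)
Lemma sum_cos_pow N n u : (n < N)%N ->
  \sum_(j < N) cos ((u - grid N j) / 2) ^+ (2 * n) =
  N%:R * 'C(2 * n, n)%:R / 4 ^+ n.
Proof.
move=> nN; apply: (mulfI (_ : 4 ^+ n != 0)); first by rewrite expf_neq0.
rewrite mulrCA mulfV ?mulr1 ?expf_neq0// mulr_sumr.
rewrite (eq_bigr (fun j : 'I_N => \sum_(k < (2 * n).+1)
    'C(2 * n, k)%:R * cos ((n%:R - k%:R) * (u - grid N j)))); last first.
  move=> j _; have -> : 4 ^+ n = 2 ^+ (2 * n) :> R by rewrite exprM; congr (_ ^+ n); ring.
  rewrite -exprMn cos_pow_expand.
  by apply: eq_bigr => k _; congr (_ * cos _); rewrite natrM; field.
rewrite exchange_big/=.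
have n2 : (n < (2 * n).+1)%N by lia.
rewrite (bigD1 (Ordinal n2))//= -mulr_sumr.
rewrite (eq_bigr (fun=> 1)); last by move=> j _; rewrite subrr mul0r cos0.
rewrite sumr_const card_ord mulrC big1 ?addr0// => k kn.
rewrite -mulr_sumr; apply/eqP; rewrite mulf_eq0; apply/orP; right; apply/eqP.
have [kn'|nk] := leqP k n.
  have k0 : (0 < n - k < N)%N.
    have : (k : nat) != n by apply: contra kn => /eqP e; apply/eqP/val_inj.
    by lia.
  rewrite -[RHS](sum_cos_grid u k0); apply: eq_bigr => j _.
  by rewrite natrB.
have k0 : (0 < k - n < N)%N by have := ltn_ord k; lia.
rewrite -[RHS](sum_cos_grid u k0); apply: eq_bigr => j _.
by rewrite -cosN natrB 1?ltnW//; congr cos; ring.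
Qed.

(** Normalized so that the translates along the grid form a partition of
    unity: sums over the grid then play the part of convolutions. *)
Definition kernel (n : nat) u : R :=
  4 ^+ n / (n.+2%:R * 'C(2 * n, n)%:R) * cos (u / 2) ^+ (2 * n).

Let central_bin_gt0 n : 0 < 'C(2 * n, n)%:R :> R.
Proof. by rewrite ltr0n bin_gt0; lia. Qed.

Lemma kernel_ge0 n u : 0 <= kernel n u.
Proof.
apply: mulr_ge0; first by apply: divr_ge0; [exact: exprn_ge0|exact: mulr_ge0].
by rewrite exprM exprn_ge0// sqr_ge0.
Qed.

Lemma kernel_sum n u : \sum_(j < n.+2) kernel n (u - grid n.+2 j) = 1.
Proof.
rewrite -mulr_sumr sum_cos_pow//; field.
by rewrite expf_neq0// !gt_eqF// -(natrD _ 2) ltr0n.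
Qed.

Lemma central_binS n : n.+1%:R * 'C(2 * n.+1, n.+1)%:R =
  (2 * (2 * n + 1))%:R * 'C(2 * n, n)%:R :> R.
Proof.
rewrite -!natrM; congr _%:R.
have h1 := mul_bin_diag (2 * n.+1) n.
have h2 := mul_bin_down (2 * n + 1) n.
apply/eqP; rewrite -(eqn_pmul2l (ltn0Sn n)); apply/eqP.
have -> : (2 * n.+1 = (2 * n + 1).+1)%N by lia.
have e1 : ((2 * n.+1).-1 = 2 * n + 1)%N by lia.
have e2 : ((2 * n + 1).-1 = 2 * n)%N by lia.
have e3 : (2 * n + 1 - n = n.+1)%N by lia.
have e4 : (2 * n.+1 = (2 * n + 1).+1)%N by lia.
rewrite e1 e4 in h1; rewrite e2 e3 in h2.
by nia.
Qed.

(** The kernel concentrates near its centre. As [sin^2 = 1 - cos^2], the sum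
    compares two consecutive central binomial coefficients. *)
Lemma kernel_sin_sum n u :
  \sum_(j < n.+2) kernel n (u - grid n.+2 j) * sin ((u - grid n.+2 j) / 2) ^+ 2 =
  (2 * n.+1%:R)^-1.
Proof.
rewrite (eq_bigr (fun j : 'I_n.+2 => kernel n (u - grid n.+2 j) -
  4 ^+ n / (n.+2%:R * 'C(2 * n, n)%:R) * cos ((u - grid n.+2 j) / 2) ^+ (2 * n.+1))); last first.
  by move=> j _; rewrite sin2cos2 /kernel mulnS exprD; ring.
rewrite sumrB kernel_sum -mulr_sumr sum_cos_pow//.
have h := central_binS n.
have b0 := lt0r_neq0 (central_bin_gt0 n).
have -> : 'C(2 * n.+1, n.+1)%:R = (2 * (2 * n + 1))%:R * 'C(2 * n, n)%:R / n.+1%:R :> R.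
  by rewrite -h mulrAC divff ?mul1r// pnatr_eq0.
rewrite exprS !natrM natrD natrM -[n.+2%:R]natr1 -[n.+1%:R]natr1; field.
by rewrite b0 expf_neq0// !natr1 !pnatr_eq0.
Qed.

(** The range exceeds a half period because grid points are spread over [[0, 2
    pi]] while arguments may leave the centre by [1]; [eta <= 1] keeps the
    comparison valid for [|y|] past [pi], where [sin (|y| / 2)] decreases. *)
Lemma sin_half_far (eta y : R) : 0 < eta <= 1 -> eta <= `|y| <= pi + 1 ->
  sin (eta / 2) ^+ 2 <= sin (y / 2) ^+ 2.
Proof.
move=> /andP[e0 e1].
wlog y0 : y / 0 <= y.
  move=> wl; have [/wl//|/ltW] := leP 0 y.
  by rewrite -oppr_ge0 => /wl; rewrite normrN mulNr sinN sqrrN.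
rewrite (ger0_norm y0) => /andP[ey yp].
have pi2 := @pi_ge2 R.
have se : 0 <= sin (eta / 2) by apply: sin_ge0_pi; apply/andP; split; lra.
have mono (v : R) : eta / 2 <= v <= pi / 2 -> sin (eta / 2) <= sin v.
  move=> /andP[v0 v1]; move: v0; rewrite le_eqVlt => /predU1P[->//|v0].
  by rewrite ltW// ltr_sin// in_itv/=; apply/andP; split; lra.
suff h : sin (eta / 2) <= sin (y / 2).
  by rewrite lerXn2r ?nnegrE// (le_trans se).
have [yl|yl] := leP (y / 2) (pi / 2); first by apply: mono; apply/andP; split; lra.
have -> : sin (y / 2) = sin (pi - y / 2).
  by rewrite sinB sinpi cospi; ring.
by apply: mono; apply/andP; split; lra.
Qed.

End fejer_kernel.

(** * Approximation by trigonometric sums *)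

Section trig_functions.
Variables (R : realType) (d : nat).
Implicit Types f g : 'cV[R]_d -> R.

(** Closed under products although only sums are primitive, since a product of
    cosines is a sum of cosines; the phases [b] let sines in. *)
Inductive trig_fun : ('cV[R]_d -> R) -> Prop :=
| trig_cos (t : 'cV[R]_d) (b : R) :
    trig_fun (fun x => cos ((t^T *m x) 0 0 + b))
| trig_add f g : trig_fun f -> trig_fun g -> trig_fun (fun x => f x + g x)
| trig_scale (c : R) f : trig_fun f -> trig_fun (fun x => c * f x).

Lemma trig_cst (c : R) : trig_fun (fun=> c).
Proof.
have -> : (fun _ : 'cV[R]_d => c) =
    (fun x => c * cos (((0 : 'cV[R]_d)^T *m x) 0 0 + 0)).
  by apply/funext => x; rewrite trmx0 mul0mx mxE addr0 cos0 mulr1.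
exact/trig_scale/trig_cos.
Qed.

Lemma trig_mul f g : trig_fun f -> trig_fun g -> trig_fun (fun x => f x * g x).
Proof.
move=> tf; elim: tf g => {f} [t b g|f1 f2 _ IH1 _ IH2 g tg|c f _ IH g tg].
- elim=> {g} [t' b'|g1 g2 _ IH1 _ IH2|c g _ IH].
  + have -> : (fun x : 'cV[R]_d => cos ((t^T *m x) 0 0 + b) * cos ((t'^T *m x) 0 0 + b')) =
      (fun x => 2^-1 * (cos (((t + t')^T *m x) 0 0 + (b + b')) +
                        cos (((t - t')^T *m x) 0 0 + (b - b')))).
      apply/funext => x; rewrite cos_mul [(t + t')^T]linearD [(t - t')^T]linearB /= mulmxDl mulmxBl !mxE.
      by congr (_ * (cos _ + cos _)); ring.
    by apply: trig_scale; apply: trig_add; exact: trig_cos.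
  + have -> : (fun x : 'cV[R]_d => cos ((t^T *m x) 0 0 + b) * (g1 x + g2 x)) =
      (fun x => cos ((t^T *m x) 0 0 + b) * g1 x + cos ((t^T *m x) 0 0 + b) * g2 x).
      by apply/funext => x; rewrite mulrDr.
    exact: trig_add.
  + have -> : (fun x : 'cV[R]_d => cos ((t^T *m x) 0 0 + b) * (c * g x)) =
      (fun x => c * (cos ((t^T *m x) 0 0 + b) * g x)).
      by apply/funext => x; rewrite mulrCA.
    exact: trig_scale.
- have -> : (fun x => (f1 x + f2 x) * g x) = (fun x => f1 x * g x + f2 x * g x).
    by apply/funext => x; rewrite mulrDl.
  by apply: trig_add; [exact: IH1|exact: IH2].
- have -> : (fun x => c * f x * g x) = (fun x => c * (f x * g x)).
    by apply/funext => x; rewrite mulrA.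
  by apply: trig_scale; exact: IH.
Qed.

Lemma trig_exp f n : trig_fun f -> trig_fun (fun x => f x ^+ n).
Proof.
move=> tf; elim: n => [|n IH]; first exact: trig_cst.
have -> : (fun x => f x ^+ n.+1) = (fun x => f x * f x ^+ n).
  by apply/funext => x; rewrite exprS.
exact: trig_mul.
Qed.

Lemma trig_sum (I : Type) (r : seq I) (F : I -> 'cV[R]_d -> R) :
  (forall i, trig_fun (F i)) -> trig_fun (fun x => \sum_(i <- r) F i x).
Proof.
move=> tF; elim: r => [|i r IH].
  by under eq_fun do rewrite big_nil; exact: trig_cst.
by under eq_fun do rewrite big_cons; exact: trig_add.
Qed.

Lemma trig_prod (I : Type) (r : seq I) (F : I -> 'cV[R]_d -> R) :
  (forall i, trig_fun (F i)) -> trig_fun (fun x => \prod_(i <- r) F i x).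
Proof.
move=> tF; elim: r => [|i r IH].
  by under eq_fun do rewrite big_nil; exact: trig_cst.
by under eq_fun do rewrite big_cons; exact: trig_mul.
Qed.

Lemma trig_coord (i : 'I_d) (a b : R) : trig_fun (fun x => cos (a * x i 0 + b)).
Proof.
have -> : (fun x : 'cV[R]_d => cos (a * x i 0 + b)) =
    (fun x => cos (((a *: delta_mx i 0 : 'cV[R]_d)^T *m x) 0 0 + b)).
  apply/funext => x; congr (cos (_ + _)).
  rewrite linearZ/= -scalemxAl mxE trmx_delta -rowE mxE//.
exact: trig_cos.
Qed.

Lemma trig_kernel n (i : 'I_d) (a b : R) :
  trig_fun (fun x => kernel n (a * x i 0 + b)).
Proof.
rewrite /kernel; apply: trig_scale; apply: trig_exp.
have -> : (fun x : 'cV[R]_d => cos ((a * x i 0 + b) / 2)) =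
    (fun x => cos (a / 2 * x i 0 + b / 2)).
  by apply/funext => x; congr cos; ring.
exact: trig_coord.
Qed.

(** Uniform continuity on a cube, in the form where only one of the two points
    has to lie in it: a grid point close to the cube may be outside. *)
Lemma unif_cont_cube f (K e : R) : continuous f -> 0 < e ->
  exists2 eta, 0 < eta & forall x y : 'cV[R]_d, (forall i, `|x i 0| <= K) ->
    (forall i, `|x i 0 - y i 0| < eta) -> `|f x - f y| <= e.
Proof.
move=> cf e0.
pose P (eta : R) (r : 'rV[R]_d) := forall y : 'cV[R]_d,
  (forall i, `|r 0 i - y i 0| < eta) -> `|f r^T - f y| <= e.
pose A := [set v : 'rV[R]_d | forall i, `[- K, K]%classic (v ord0 i)].
have cA : compact A by apply: (@rV_compact R d (fun=> `[- K, K]%classic)) => i; exact: segment_compact.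
have : \forall eta \near 0^'+, A `<=` P eta.
  move/compact_near_coveringP : cA; apply => r _.
  have /cvgrPdist_lt/(_ _ (divr_gt0 e0 (ltr0n R 2))) := cf r^T.
  move/nbhs_ballP => [dl /= dl0 hdl].
  have dl2 : 0 < dl / 2 by rewrite divr_gt0.
  exists (ball r (dl / 2), [set eta | eta < dl / 2]) => /=.
    by split; [exact: nbhsx_ballx|exact: nbhs_right_lt].
  move=> [r' eta] /= [[_ rr'] eta_lt] y yr'.
  have h1 : `|f r^T - f r'^T| < e / 2.
    apply: hdl; split=> // i j; rewrite !mxE.
    by apply: le_ball (rr' _ _); lra.
  have h2 : `|f r^T - f y| < e / 2.
    apply: hdl; split=> // i j; rewrite ord1 mxE -ball_normE/=.
    have := rr' 0 i; rewrite -ball_normE/= => h2; have h3 := yr' i.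
    rewrite (_ : _ - _ = (r 0 i - r' 0 i) + (r' 0 i - y i 0)); last by ring.
    by rewrite (le_lt_trans (ler_normD _ _))//; lra.
  rewrite (_ : _ - _ = (f r^T - f y) - (f r^T - f r'^T)); last by ring.
  by rewrite (le_trans (ler_normB _ _))//; lra.
move=> near_eta.
have [eta [eta0 AP]] : exists eta : R, 0 < eta /\ A `<=` P eta.
  near (0 : R)^'+ => eta; exists eta; split; first by near: eta; exact: nbhs_right_gt.
  by near: eta.
exists eta => // x y xK xy.
have := AP x^T; rewrite /P trmxK; apply; last by move=> i; rewrite mxE.
by move=> i; rewrite /= in_itv/= mxE -ler_norml.
Unshelve. all: by end_near. Qed.

Section approx.
Variables (f : 'cV[R]_d -> R) (M K : R).
Hypotheses (cf : continuous f) (fM : forall x, `|f x| <= M) (K0 : 0 < K).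

(** [x / K + pi] maps the cube well inside a period of the grid, away from its
    ends, where neighbours on the circle are not neighbours on the line. *)
Definition grid_point n (J : {ffun 'I_d -> 'I_n.+2}) : 'cV[R]_d :=
  \col_i (K * (grid R n.+2 (J i) - pi)).

Definition grid_weight n (J : {ffun 'I_d -> 'I_n.+2}) (x : 'cV[R]_d) : R :=
  \prod_(i < d) kernel n (K^-1 * x i 0 + pi - grid R n.+2 (J i)).

(** An analogue of the Bernstein operator: values of [f] on a grid averaged
    with the weights of a product of kernels. Positivity of the weights makes
    it keep the bounds of [f] on the whole space. *)
Definition trig_approx n (x : 'cV[R]_d) : R :=
  \sum_(J : {ffun 'I_d -> 'I_n.+2}) f (grid_point J) * grid_weight J x.

Lemma trig_approx_trig n : trig_fun (trig_approx n).
Proof.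
apply: trig_sum => J; apply: trig_scale; apply: trig_prod => i.
by under eq_fun do rewrite -addrA; exact: trig_kernel.
Qed.

Lemma grid_weight_ge0 n J x : 0 <= @grid_weight n J x.
Proof. by apply: prodr_ge0 => i _; exact: kernel_ge0. Qed.

Lemma grid_weight_sum n x : \sum_J @grid_weight n J x = 1.
Proof.
rewrite /grid_weight -(bigA_distr_bigA (fun i (j : 'I_n.+2) =>
  kernel n (K^-1 * x i 0 + pi - grid R n.+2 j))).
by rewrite big1// => i _; exact: kernel_sum.
Qed.

Let dist2 n (J : {ffun 'I_d -> 'I_n.+2}) (x : 'cV[R]_d) i :=
  sin ((K^-1 * x i 0 + pi - grid R n.+2 (J i)) / 2) ^+ 2.

Lemma grid_weight_concentration n x (i : 'I_d) :
  \sum_J @grid_weight n J x * dist2 J x i = (2 * n.+1%:R)^-1.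
Proof.
pose F i' (j : 'I_n.+2) := kernel n (K^-1 * x i' 0 + pi - grid R n.+2 j) *
  (if i' == i then sin ((K^-1 * x i' 0 + pi - grid R n.+2 j) / 2) ^+ 2 else 1).
rewrite (eq_bigr (fun J : {ffun 'I_d -> 'I_n.+2} => \prod_i' F i' (J i'))); last first.
  move=> J _; rewrite big_split/= -big_mkcond/=.
  by rewrite big_pred1_eq.
rewrite -(bigA_distr_bigA F) (bigD1 i)//= /F eqxx kernel_sin_sum big1 ?mulr1//.
move=> i' /negbTE i'i; rewrite i'i -[RHS](kernel_sum n (K^-1 * x i' 0 + pi)).
by apply: eq_bigr => j _; rewrite mulr1.
Qed.

Lemma trig_approx_bound n x : `|trig_approx n x| <= M.
Proof.
rewrite (le_trans (ler_norm_sum _ _ _))//.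
rewrite -[leRHS]mulr1 -(grid_weight_sum n x) mulr_sumr.
apply: ler_sum => J _; rewrite normrM (ger0_norm (grid_weight_ge0 _ _)).
by rewrite ler_wpM2r// grid_weight_ge0.
Qed.

(** Chebyshev's argument for Bernstein polynomials: grid points close to [x]
    contribute a small oscillation of [f], and the far ones have small total
    weight by [grid_weight_concentration]. *)
Lemma trig_approx_error (e : R) : 0 < e -> exists n, forall x : 'cV[R]_d,
  (forall i, `|x i 0| <= K) -> `|f x - trig_approx n x| <= e.
Proof.
move=> e0; have M0 : 0 <= M := le_trans (normr_ge0 _) (fM 0).
have e2 : 0 < e / 2 by rewrite divr_gt0.
have [eta eta0 uc] := unif_cont_cube K cf e2.
pose et := Num.min (eta / K) 1.
have et0 : 0 < et by rewrite lt_min ltr01 divr_gt0.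
have et1 : et <= 1 by rewrite ge_min lexx orbT.
have etK : K * et <= eta.
  by rewrite -ler_pdivlMl// mulrC ge_min lexx.
pose s0 := sin (et / 2) ^+ 2.
have s0_gt0 : 0 < s0.
  rewrite exprn_gt0// sin_gt0_pi//; have := @pi_ge2 R => pi2.
  by apply/andP; split; lra.
near \oo => n.
have hn : 2 * M / s0 * d%:R / (e / 2) <= n%:R by near: n; exact: nbhs_infty_ger.
exists n => x xK.
have -> : f x - trig_approx n x =
    \sum_J (f x - f (grid_point J)) * @grid_weight n J x.
  rewrite /trig_approx -[f x in LHS]mulr1 -(grid_weight_sum n x) mulr_sumr -sumrB.
  by apply: eq_bigr => J _; rewrite mulrBl.
rewrite (le_trans (ler_norm_sum _ _ _))//.
apply: (@le_trans _ _ (\sum_J (e / 2 * @grid_weight n J x +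
    2 * M / s0 * \sum_i (@grid_weight n J x * dist2 J x i)))).
  apply: ler_sum => J _; have w0 := @grid_weight_ge0 n J x.
  have -> : e / 2 * @grid_weight n J x +
      2 * M / s0 * \sum_i (@grid_weight n J x * dist2 J x i) =
    (e / 2 + 2 * M / s0 * \sum_i dist2 J x i) * @grid_weight n J x.
    by rewrite -mulr_sumr; ring.
  rewrite normrM (ger0_norm w0) ler_wpM2r//.
  have D0 i : 0 <= dist2 J x i by exact: sqr_ge0.
  have K2 : 0 <= 2 * M / s0 by apply: divr_ge0; [exact: mulr_ge0|exact: ltW].
  have xJ i : x i 0 - (grid_point J) i 0 = K * (K^-1 * x i 0 + pi - grid R n.+2 (J i)).
    by rewrite /grid_point mxE; field; exact: lt0r_neq0.
  have [/forallP near_J|/forallPn[i far]] := boolP [forall i, `|x i 0 - (grid_point J) i 0| < eta].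
    rewrite (le_trans (uc _ _ xK near_J))// lerDl mulr_ge0// sumr_ge0// => i _.
  apply: (@le_trans _ _ (2 * M)).
    by rewrite (le_trans (ler_normB _ _))// mulr_natl mulr2n lerD.
  rewrite -[X in X <= _]add0r; apply: lerD; first exact: ltW.
  rewrite (bigD1 i)//= mulrDr.
  have rest : 0 <= 2 * M / s0 * \sum_(j < d | j != i) dist2 J x j.
    by rewrite mulr_ge0// sumr_ge0.
  rewrite (le_trans _ (_ : 2 * M / s0 * dist2 J x i <= _)) ?lerDl//.
  rewrite mulrAC ler_pdivlMr// ler_wpM2l ?mulr_ge0//.
  apply: sin_half_far; rewrite ?et0//.
  move: far; rewrite -leNgt xJ normrM (gtr0_norm K0) => far.
  apply/andP; split; first by rewrite -(ler_pM2l K0) (le_trans etK).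
  have g0 : 0 <= grid R n.+2 (J i).
    by rewrite /grid !mulr_ge0 ?pi_ge0.
  have g1 : grid R n.+2 (J i) <= 2 * pi.
    rewrite /grid ler_pdivrMr// ler_wpM2l ?mulr_ge0 ?pi_ge0// ler_nat ltnW//.
  have : `|K^-1 * x i 0| <= 1.
    by rewrite normrM gtr0_norm ?invr_gt0// ler_pdivrMl// mulr1.
  move: g0 g1; set g := grid _ _ _; set a := K^-1 * _; rewrite !ler_norml.
  by move=> g0 g1 /andP[a0 a1]; apply/andP; split; lra.
rewrite big_split/= -!mulr_sumr grid_weight_sum mulr1 exchange_big/=.
rewrite (eq_bigr (fun=> (2 * n.+1%:R)^-1)); last by move=> i _; exact: grid_weight_concentration.
rewrite sumr_const card_ord -[_ *+ d]mulr_natl.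
have n0 : 0 < n.+1%:R :> R by [].
suff h : 2 * M / s0 * (d%:R * (2 * n.+1%:R)^-1) <= e / 2 by rewrite [leRHS]splitr lerD2l.
move: hn; rewrite ler_pdivrMr// => hn.
rewrite mulrA ler_pdivrMr ?mulr_gt0//.
apply: (le_trans hn); rewrite mulrC ler_wpM2l ?ltW//.
have nn : 0 <= n%:R :> R by [].
by rewrite -natr1; lra.
Unshelve. all: by end_near. Qed.

End approx.
End trig_functions.

(** * Levy's continuity theorem *)

Section levy.
Variables (R : realType) (d : nat).
Implicit Types f g : 'cV[R]_d -> R.

Definition bounded_continuous f := continuous f /\ exists M, forall x, `|f x| <= M.

Let continuous_add f g : continuous f -> continuous g ->
  continuous (fun x => f x + g x).
Proof. by move=> cf cg x; exact: (continuousD (cf x) (cg x)). Qed.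

Let continuous_mul f g : continuous f -> continuous g ->
  continuous (fun x => f x * g x).
Proof. by move=> cf cg x; exact: (continuousM (cf x) (cg x)). Qed.

Lemma continuous_sum_fun (I : Type) (r : seq I) (F : I -> 'cV[R]_d -> R) :
  (forall i, continuous (F i)) -> continuous (fun x => \sum_(i <- r) F i x).
Proof.
move=> cF; elim: r => [|i r IH].
  under eq_fun do rewrite big_nil.
  exact: cst_continuous.
by under eq_fun do rewrite big_cons; exact: continuous_add.
Qed.

Lemma continuous_linear_form (t : 'cV[R]_d) :
  continuous (fun x : 'cV[R]_d => (t^T *m x) 0 0).
Proof.
under eq_fun do rewrite mxE.
apply: continuous_sum_fun => i.
by apply: continuous_mul; [exact: cst_continuous|exact: coord_continuous].
Qed.

Lemma bounded_continuous_cst c : bounded_continuous (fun=> c).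
Proof. by split; [exact: cst_continuous|exists `|c|]. Qed.

Lemma bounded_continuousD f g : bounded_continuous f -> bounded_continuous g ->
  bounded_continuous (fun x => f x + g x).
Proof.
move=> [cf [M fM]] [cg [N gN]]; split.
  exact: continuous_add.
by exists (M + N) => x; rewrite (le_trans (ler_normD _ _))// lerD.
Qed.

Lemma bounded_continuousZ c f : bounded_continuous f ->
  bounded_continuous (fun x => c * f x).
Proof.
move=> [cf [M fM]]; split.
  by apply: continuous_mul => //; exact: cst_continuous.
by exists (`|c| * M) => x; rewrite normrM ler_wpM2l.
Qed.

Lemma bounded_continuous_trig f : trig_fun f -> bounded_continuous f.
Proof.
elim=> {f} [t b|f g _ + _|c f _]; last 2 first.
- exact: bounded_continuousD.
- exact: bounded_continuousZ.
split; last by exists 1 => x; exact: cos_max.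
move=> x; apply: continuous_comp; last exact: continuous_cos.
by apply: continuous_add; [exact: continuous_linear_form|exact: cst_continuous].
Qed.

Definition sqr_sum (x : 'cV[R]_d) : R := \sum_i x i 0 ^+ 2.

(** A continuous substitute for the indicator of the complement of a cube; its
    mean is bounded by a second moment. *)
Definition tail (K : R) (x : 'cV[R]_d) : R := Num.min 1 (K ^- 2 * sqr_sum x).

Lemma bounded_continuous_tail K : bounded_continuous (tail K).
Proof.
split.
  move=> x; apply: (@continuous_min _ _ (cst 1) (fun x => K ^- 2 * sqr_sum x)).
    exact: cst_continuous.
  apply: continuous_mul; first exact: cst_continuous.
  apply: continuous_sum_fun => i; under eq_fun do rewrite expr2.
  by apply: continuous_mul; exact: coord_continuous.
exists 1 => x; rewrite ger0_norm; first by rewrite /tail ge_min lexx.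
rewrite /tail le_min ler01 mulr_ge0//; first by rewrite invr_ge0 sqr_ge0.
by apply: sumr_ge0 => i _; exact: sqr_ge0.
Qed.

Lemma tail_ge0 K x : 0 <= tail K x.
Proof.
rewrite le_min ler01 mulr_ge0//; first by rewrite invr_ge0 sqr_ge0.
by apply: sumr_ge0 => i _; exact: sqr_ge0.
Qed.

Lemma tail_far K (x : 'cV[R]_d) i : 0 < K -> K < `|x i 0| -> tail K x = 1.
Proof.
move=> K0 xK; apply/min_idPl; rewrite ler_pdivlMl ?exprn_gt0// mulr1.
rewrite /sqr_sum (bigD1 i)//= (le_trans (_ : _ <= x i 0 ^+ 2))//.
  by rewrite -[leRHS]real_normK ?num_real// lerXn2r ?nnegrE ?(ltW K0) ?(ltW xK).
by rewrite lerDl sumr_ge0// => j _; exact: sqr_ge0.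
Qed.

(** Expectations known only through bounded continuous functions. Averages
    over histories and integrals both qualify, and one continuity theorem
    serves both. *)
Record mean_functional (L : ('cV[R]_d -> R) -> R) : Prop := MeanFunctional {
  mean_add : forall f g, bounded_continuous f -> bounded_continuous g ->
    L (fun x => f x + g x) = L f + L g;
  mean_scale : forall c f, bounded_continuous f -> L (fun x => c * f x) = c * L f;
  mean_le : forall f g, bounded_continuous f -> bounded_continuous g ->
    (forall x, f x <= g x) -> L f <= L g;
  mean_one : L (fun=> 1) = 1 }.

Lemma mean_cst L c : mean_functional L -> L (fun=> c) = c.
Proof.
move=> mL; have -> : (fun _ : 'cV[R]_d => c) = (fun x => c * (fun=> 1) x).
  by apply/funext => x; rewrite mulr1.
rewrite (mean_scale mL) ?(mean_one mL) ?mulr1//.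
exact: bounded_continuous_cst.
Qed.

(** Outside the cube the two functions are only known to be bounded by [M];
    their difference there is paid for by the mean of [tail]. *)
Lemma mean_trig_approx L f g (M K e : R) : mean_functional L ->
  bounded_continuous f -> bounded_continuous g ->
  (forall x, `|f x| <= M) -> (forall x, `|g x| <= M) -> 0 < K ->
  (forall x : 'cV[R]_d, (forall i, `|x i 0| <= K) -> `|f x - g x| <= e) -> 0 <= e ->
  `|L f - L g| <= e + 2 * M * L (tail K).
Proof.
move=> mL bf bg fM gM K0 fg e0.
have M0 : 0 <= M := le_trans (normr_ge0 _) (fM 0).
have bt := bounded_continuous_tail K.
have bb : bounded_continuous (fun x => e + 2 * M * tail K x).
  by apply: bounded_continuousD; [exact: bounded_continuous_cst|exact: bounded_continuousZ].
have -> : e + 2 * M * L (tail K) = L (fun x => e + 2 * M * tail K x).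
  rewrite (mean_add mL) ?(mean_cst _ mL) ?(mean_scale mL)//.
    exact: bounded_continuous_cst.
  exact: bounded_continuousZ.
have bound x : `|f x - g x| <= e + 2 * M * tail K x.
  have [/forallP h|/forallPn[i]] := boolP [forall i, `|x i 0| <= K].
    by rewrite (le_trans (fg _ h))// lerDl !mulr_ge0// tail_ge0.
  rewrite -ltNge => h; rewrite (tail_far K0 h) mulr1.
  rewrite (le_trans (ler_normB _ _))// (le_trans (lerD (fM x) (gM x)))//.
  by lra.
have le (f1 g1 : 'cV[R]_d -> R) : bounded_continuous f1 -> bounded_continuous g1 ->
    (forall x, `|f1 x - g1 x| <= e + 2 * M * tail K x) ->
    L f1 - L g1 <= L (fun x => e + 2 * M * tail K x).
  move=> b1 b2 h; rewrite lerBlDl -(mean_add mL)//.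
  apply: (mean_le mL) => //; first exact: bounded_continuousD.
  move=> x; rewrite -lerBlDl; exact: le_trans (ler_norm _) (h x).
rewrite ler_norml le//= lerNl opprB le// => x.
by rewrite distrC.
Qed.

(** By linearity convergence on cosines extends to all trigonometric sums.
    Such a sum approximates [f] uniformly on a cube that carries almost all
    the mass, for the functionals [L n] with [n] large and for the limit. *)
Lemma levy_continuity (L : nat -> ('cV[R]_d -> R) -> R) (Loo : ('cV[R]_d -> R) -> R) :
  (forall n, mean_functional (L n)) -> mean_functional Loo ->
  (forall e : R, 0 < e -> exists2 K, 0 < K &
     (\forall n \near \oo, L n (tail K) <= e) /\ Loo (tail K) <= e) ->
  (forall (t : 'cV[R]_d) (b : R), L n (fun x => cos ((t^T *m x) 0 0 + b)) @[n --> \oo] -->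
     Loo (fun x => cos ((t^T *m x) 0 0 + b))) ->
  forall f, bounded_continuous f -> L n f @[n --> \oo] --> Loo f.
Proof.
move=> mL mLoo tight cvg_cos f bf.
have cvg_trig g : trig_fun g -> L n g @[n --> \oo] --> Loo g.
  elim=> {g} [t b|g1 g2 t1 IH1 t2 IH2|c g tg IH]; first exact: cvg_cos.
    have b1 := bounded_continuous_trig t1; have b2 := bounded_continuous_trig t2.
    rewrite (mean_add mLoo b1 b2).
    under eq_fun do rewrite (mean_add (mL _) b1 b2).
    exact: cvgD.
  have b := bounded_continuous_trig tg.
  rewrite (mean_scale mLoo c b).
  under eq_fun do rewrite (mean_scale (mL _) c b).
  by apply: cvgM => //; exact: cvg_cst.
have [cf [M0 fM0]] := bf.
pose M := Num.max M0 1.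
have M1 : 1 <= M by rewrite le_max lexx orbT.
have fM x : `|f x| <= M by rewrite le_max fM0.
apply/cvgrPdist_le => e e0.
have e5 : 0 < e / 5 by rewrite divr_gt0.
have e5M : 0 < e / 5 / (2 * M).
  by rewrite divr_gt0// mulr_gt0// (lt_le_trans _ M1).
have [K K0 [tn too]] := tight _ e5M.
have [k fk] := trig_approx_error cf fM K0 e5.
set g := trig_approx f K k in fk.
have tg : trig_fun g by exact: trig_approx_trig.
have bg := bounded_continuous_trig tg.
have gM x : `|g x| <= M by exact: trig_approx_bound.
have hoo := mean_trig_approx mLoo bf bg fM gM K0 fk (ltW e5).
have h2M : 2 * M * (e / 5 / (2 * M)) = e / 5.
  by field; rewrite gt_eqF// (lt_le_trans _ M1).
have M20 : 0 <= 2 * M by rewrite mulr_ge0// (le_trans _ M1).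
have hoo' : 2 * M * Loo (tail K) <= e / 5 by rewrite -[leRHS]h2M ler_wpM2l.
near=> n.
have hn := mean_trig_approx (mL n) bf bg fM gM K0 fk (ltW e5).
have hn' : 2 * M * L n (tail K) <= e / 5.
  by rewrite -[leRHS]h2M ler_wpM2l//; near: n.
have gn : `|Loo g - L n g| <= e / 5.
  by near: n; move/cvgrPdist_le : (cvg_trig _ tg); exact.
rewrite (_ : _ - _ = (Loo f - Loo g) + (Loo g - L n g) - (L n f - L n g)); last by ring.
rewrite (le_trans (ler_normB _ _))// (le_trans (lerD (ler_normD _ _) (lexx _)))//.
by lra.
Unshelve. all: by end_near. Qed.

End levy.

(** * Probability measures as mean functionals *)

Section bounded_integral.
Context {dT : measure_display} {T : measurableType dT} {R : realType}.
Variable P : probability T R.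
Implicit Types f g : T -> R.

Lemma bounded_integrable f M : measurable_fun setT f -> (forall x, `|f x| <= M) ->
  P.-integrable setT (EFin \o f).
Proof.
move=> mf fM; apply: measurable_bounded_integrable => //.
  by rewrite -ge0_fin_numE// fin_num_measure.
exists M; split; first exact: num_real.
by move=> y My x _ /=; rewrite (le_trans (fM x))// ltW.
Qed.

Lemma bounded_Rintegral_EFin f M : measurable_fun setT f -> (forall x, `|f x| <= M) ->
  (\int[P]_x (f x)%:E)%E = (\int[P]_x f x)%R%:E.
Proof.
move=> mf fM; rewrite /Rintegral fineK//.
by apply: integrable_fin_num => //; exact: (bounded_integrable mf fM).
Qed.

Lemma bounded_Rintegral_cvg (F : nat -> T -> R) f M :
  (forall n, measurable_fun setT (F n)) -> measurable_fun setT f ->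
  (forall n x, `|F n x| <= M) -> (forall x, F n x @[n --> \oo] --> f x) ->
  \int[P]_x F n x @[n --> \oo] --> \int[P]_x f x.
Proof.
move=> mF mf FM Ff.
have fM x : `|f x| <= M.
  have h : `|F n x| @[n --> \oo] --> `|f x| by apply: cvg_norm; exact: Ff.
  rewrite -(cvg_lim _ h)//; apply: limr_le; first by apply/cvg_ex; exists `|f x|.
  by apply: nearW => n; exact: FM.
have h : (\int[P]_x (F n x)%:E @[n --> \oo] --> \int[P]_x (f x)%:E)%E.
  apply: (@dominated_cvg _ T R P setT measurableT
    (fun n => EFin \o F n) (EFin \o f) (cst M%:E)).
  - by move=> n; apply/measurable_EFinP; exact: mF.
  - by move=> x _; apply: cvg_EFin; [exact: nearW|exact: Ff].
  - by [].
  - by apply: (@bounded_integrable (cst M) `|M|); first exact: measurable_cst.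
  - by move=> n x _; rewrite /= lee_fin; exact: FM.
apply: fine_cvg; rewrite -(bounded_Rintegral_EFin mf fM).
exact: h.
Qed.

End bounded_integral.

Section random_vector.
Context {dT : measure_display} {T : measurableType dT} {R : realType} {d : nat}.
Variables (P : probability T R) (Y : T -> borel_cV R d).
Hypothesis mY : measurable_fun setT Y.

Lemma continuous_measurable_cV (f : 'cV[R]_d -> R) : continuous f ->
  measurable_fun setT (f : borel_cV R d -> R).
Proof.
move=> cf; apply: (measurability _ (RGenOInfty.measurableE R)) => _ [_ [a ->] <-].
rewrite setTI; apply: sub_sigma_algebra.
by move/continuousP : cf; apply; exact: interval_open.
Qed.

Definition mean_of (f : 'cV[R]_d -> R) : R := \int[P]_w f (Y w).

Lemma measurable_comp_cV (f : 'cV[R]_d -> R) : continuous f ->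
  measurable_fun setT (fun w => f (Y w)).
Proof.
by move=> cf; apply: (measurableT_comp (continuous_measurable_cV cf)).
Qed.

Lemma mean_functional_mean_of : mean_functional mean_of.
Proof.
have int f : bounded_continuous f -> P.-integrable setT (EFin \o (fun w => f (Y w))).
  move=> [cf [M fM]]; apply: bounded_integrable; first exact: measurable_comp_cV.
  by move=> w; exact: fM.
split.
- by move=> f g bf bg; rewrite /mean_of RintegralD//; exact: int.
- by move=> c f bf; rewrite /mean_of RintegralZl//; exact: int.
- by move=> f g bf bg fg; apply: le_Rintegral => //; exact: int.
- rewrite /mean_of Rintegral_cst// mul1r.
  by transitivity (fine (1%E : \bar R)) => //; congr fine; exact: probability_setT.
Qed.

(** A single law is tight: the functions [tail k] decrease to [0] pointwise
    and are bounded. *)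
Lemma mean_of_tail (e : R) : 0 < e -> \forall k \near \oo, mean_of (tail k.+1%:R) <= e.
Proof.
move=> e0.
have : mean_of (tail k.+1%:R) @[k --> \oo] --> \int[P]_w (0 : R).
  apply: (@bounded_Rintegral_cvg _ _ _ P _ _ 1).
  - move=> k; apply: measurable_comp_cV.
    by case: (bounded_continuous_tail d (k.+1%:R : R)).
  - exact: measurable_cst.
  - by move=> k w; rewrite ger0_norm ?tail_ge0// /tail ge_min lexx.
  move=> w.
  apply: (@squeeze_cvgr _ _ _ _ (fun=> 0) (fun k => k.+1%:R^-1 * sqr_sum (Y w))).
  - apply: nearW => k; rewrite tail_ge0/= /tail ge_min; apply/orP; right.
    rewrite ler_wpM2r//; first by apply: sumr_ge0 => i _; exact: sqr_ge0.
    by rewrite lef_pV2 ?posrE ?exprn_gt0// expr2 ler_peMr// ler1n.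
  - exact: cvg_cst.
  - rewrite -[X in _ --> X](mul0r (sqr_sum (Y w))).
    by apply: cvgM; [exact: cvg_harmonic|exact: cvg_cst].
rewrite Rintegral_cst// mul0r => /cvgrPdist_le/(_ _ e0).
by apply: filterS => k; rewrite sub0r normrN; exact: le_trans (ler_norm _).
Qed.

End random_vector.

Section uniqueness.
Variable R : realType.

Lemma measurable_scalar_cV :
  measurable_fun setT (fun x : measurableTypeR R =>
    (const_mx (x : R) : borel_cV R 1)).
Proof.
apply: (@measurability _ _ _ (borel_cV R 1) setT _ (@open 'cV[R]_1)) => //.
move=> _ [A oA <-]; rewrite setTI; apply: open_measurable.
apply: open_comp oA => x _; apply/cvg_ballP => e e0.
by apply: filterS (nbhsx_ballx x e e0) => y xy; split=> // i j; rewrite !mxE.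
Qed.

(** The continuity theorem for a constant sequence gives equality of the
    integrals of bounded continuous functions. Truncated affine functions then
    increase to the indicators of open rays, which generate the Borel sets. *)
Lemma eq_prob_cos (nu1 nu2 : probability (measurableTypeR R) R) :
  (forall s b : R, \int[nu1]_x cos (s * (x : R) + b) = \int[nu2]_x cos (s * (x : R) + b)) ->
  forall A, measurable A -> nu1 A = nu2 A.
Proof.
move=> eq_cos.
pose L (nu : probability (measurableTypeR R) R) :=
  mean_of nu (fun x => (const_mx (x : R) : borel_cV R 1)).
have mL nu : mean_functional (L nu) by exact: (mean_functional_mean_of nu measurable_scalar_cV).
have eqL f : bounded_continuous f -> L nu1 f = L nu2 f.
  move=> bf.
  have h : (fun _ : nat => L nu1 f) @ \oo --> L nu2 f.
    apply: (@levy_continuity _ _ (fun=> L nu1)) => //.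
      move=> e e0; near \oo => k; exists k.+1%:R => //; split.
        apply: nearW => _; near: k.
        exact: (mean_of_tail nu1 measurable_scalar_cV).
      by near: k; exact: (mean_of_tail nu2 measurable_scalar_cV).
    move=> t b; have -> : L nu1 (fun x => cos ((t^T *m x) 0 0 + b)) =
        L nu2 (fun x => cos ((t^T *m x) 0 0 + b)).
      rewrite /L /mean_of.
      have e (x : R) : cos ((t^T *m (const_mx x : 'cV[R]_1)) 0 0 + b) = cos (t 0 0 * x + b).
        by rewrite mxE big_ord1 !mxE.
      by under eq_Rintegral do rewrite e; under [RHS]eq_Rintegral do rewrite e.
    exact: cvg_cst.
  have hc : (fun _ : nat => L nu1 f) @ \oo --> L nu1 f by exact: cvg_cst.
  exact: (cvg_unique _ hc h).
have eq_ray a : nu1 `]a, +oo[%classic = nu2 `]a, +oo[%classic.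
  (* The functions [F k] vanish left of [a] and reach [1] at [a + 1/k]. *)
  pose F (k : nat) (x : 'cV[R]_1) : R := Num.min 1 (Num.max 0 (k%:R * (x 0 0 - a))).
  have F1 k x : `|F k x| <= 1.
    by rewrite ger0_norm; [rewrite ge_min lexx|rewrite le_min ler01 le_max lexx].
  have bF k : bounded_continuous (F k).
    split; last by exists 1.
    move=> x; apply: (@continuous_min _ _ (cst 1) (fun x : 'cV[R]_1 => Num.max 0 (k%:R * (x 0 0 - a)))).
      exact: cst_continuous.
    apply: (@continuous_max _ _ (cst 0) (fun x : 'cV[R]_1 => k%:R * (x 0 0 - a))).
      exact: cst_continuous.
    apply: continuousM; first exact: cst_continuous.
    by apply: continuousB; [exact: coord_continuous|exact: cst_continuous].
  have lim nu : L nu (F k) @[k --> \oo] --> fine (nu `]a, +oo[%classic).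
    have -> : fine (nu `]a, +oo[%classic) = \int[nu]_x \1_(`]a, +oo[%classic) x.
      by rewrite /Rintegral integral_indic// setIT.
    apply: (@bounded_Rintegral_cvg _ _ _ nu _ _ 1).
    - by move=> k; apply: (measurable_comp_cV measurable_scalar_cV); case: (bF k).
    - exact: measurable_indic.
    - by move=> k x; exact: F1.
    - move=> x; rewrite /F; under eq_fun do rewrite mxE.
      rewrite indicE; have [xa|xa] := boolP (x \in _).
        apply: cvg_near_cst; near=> k.
        have xa0 : 0 < x - a by move: xa; rewrite inE/= in_itv/= andbT subr_gt0.
        apply/min_idPl; rewrite le_max; apply/orP; right.
        by rewrite -ler_pdivrMr// mul1r; near: k; exact: nbhs_infty_ger.
      apply: cvg_near_cst; apply: nearW => k.
      have xa0 : x - a <= 0.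
        by move: xa; rewrite notin_setE/= in_itv/= andbT => /negP; rewrite -leNgt subr_le0.
      by rewrite (max_idPl _) ?(min_idPr _)// mulr_ge0_le0.
  have h : fine (nu1 `]a, +oo[%classic) = fine (nu2 `]a, +oo[%classic).
    have l1 := lim nu1; have l2 := lim nu2.
    have e : (fun k => L nu1 (F k)) = (fun k => L nu2 (F k)).
      by apply/funext => k; exact: eqL.
    rewrite e in l1.
    exact: (cvg_unique _ l1 l2).
  by rewrite -[LHS]fineK ?fin_num_measure// -[RHS]fineK ?fin_num_measure// h.
move=> A mA; apply: (@measure_unique _ R (measurableTypeR R) (@RGenOInfty.G R) (fun n => `](- n%:R), +oo[%classic)) => //.
- exact: RGenOInfty.measurableE.
- move=> _ _ [x ->] [y ->]; exists (Num.max x y); apply/seteqP; split => z /=.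
    by rewrite !in_itv/= !andbT gt_max => -[-> ->].
  by rewrite !in_itv/= !andbT gt_max => /andP[].
- by move=> n; exists (- n%:R).
- rewrite -subTset => x _; near \oo => n; exists n => //=.
  rewrite in_itv/= andbT ltrNl.
  by near: n; exact: nbhs_infty_gtr.
- by move=> _ [x ->]; exact: eq_ray.
- by move=> k; rewrite -ge0_fin_numE// fin_num_measure.
Unshelve. all: by end_near. Qed.

End uniqueness.

(** * Characteristic function of a normal law *)

Section normal_characteristic.
Variables (R : realType) (s : R).
Hypothesis s_gt0 : 0 < s.
Local Notation mu := (@lebesgue_measure R).
Local Notation phi := (normal_pdf 0 s).

Let s_neq0 : s != 0. Proof. exact: lt0r_neq0. Qed.

(** The density of the normal law, recovered as its Radon-Nikodym derivative
    so that integrals of functions of either sign are covered. *)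
Lemma integral_normal_prob (f : R -> \bar R) :
  (normal_prob 0 s).-integrable setT f ->
  (\int[normal_prob 0 s]_x f x = \int[mu]_x (f x * (phi x)%:E))%E.
Proof.
move=> intf.
have dom : normal_prob 0 s `<< mu by exact: normal_prob_dominates.
have [mf _] := integrableP _ _ _ intf.
rewrite -(Radon_Nikodym_change_of_variables dom measurableT intf).
have mphi : measurable_fun setT (fun x => (phi x)%:E).
  by apply/measurable_EFinP; exact: measurable_normal_pdf.
have mRN : measurable_fun setT
    (Radon_Nikodym (charge_of_finite_measure (normal_prob 0 s)) mu).
  by apply: (measurable_int mu); exact: Radon_Nikodym_integrable.
apply: ae_eq_integral => //.
- exact: emeasurable_funM.
- exact: emeasurable_funM.
have : ae_eq mu setT (Radon_Nikodym (charge_of_finite_measure (normal_prob 0 s)) mu)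
    (fun x => (phi x)%:E).
  apply: integral_ae_eq => //; first exact: Radon_Nikodym_integrable.
  by move=> E _ mE; rewrite -Radon_Nikodym_integral.
by apply: filterS => x /= h Dx; rewrite h.
Qed.

Lemma normal_pdfE0 x : phi x = normal_peak s * expR (- x ^+ 2 / (2 * s ^+ 2)).
Proof.
by rewrite normal_pdfE// /normal_fun subr0 mulr_natl.
Qed.

Lemma is_derive_normal_pdf (x : R) : is_derive x 1 phi (- (x / s ^+ 2) * phi x).
Proof.
have -> : phi = (fun x => normal_peak s * expR (- x ^+ 2 / (2 * s ^+ 2))).
  by apply/funext => y; exact: normal_pdfE0.
have h : is_derive x 1 (fun x : R => - x ^+ 2 / (2 * s ^+ 2)) (- (x / s ^+ 2)).
  apply: is_derive_eq; rewrite /GRing.scale/=; by field.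
apply: is_derive_eq; rewrite /GRing.scale/=; ring.
Qed.

(** The first moment costs half of the exponent: [|x|] times the density is
    dominated by a multiple of the density of deviation [sqrt 2 s], because
    [|x| <= s (1 + u) <= s exp u] with [u = x^2 / (4 s^2)]. *)
Lemma integrable_normr_normal_pdf :
  mu.-integrable setT (fun x => (`|x| * phi x)%:E).
Proof.
pose s' := Num.sqrt 2 * s.
have s'0 : s' != 0 by rewrite mulf_neq0// sqrtr_eq0 -ltNge.
have bnd x : `|x| * phi x <= s * normal_peak s / normal_peak s' * normal_pdf 0 s' x.
  have pk := normal_peak_gt0 s'0.
  rewrite normal_pdfE0 normal_pdfE// /normal_fun subr0.
  have -> : s' ^+ 2 *+ 2 = 4 * s ^+ 2.
    by rewrite exprMn sqr_sqrtr// -[_ *+ 2]mulr_natl; ring.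
  rewrite [leRHS]mulrA divfK ?gt_eqF// mulrCA.
  set E := expR (- x ^+ 2 / (4 * s ^+ 2)).
  have -> : s * normal_peak s * E = normal_peak s * (s * E) by ring.
  rewrite ler_wpM2l ?normal_peak_ge0// /E.
  set u := x ^+ 2 / (4 * s ^+ 2).
  have u0 : 0 <= u by rewrite divr_ge0 ?sqr_ge0// mulr_ge0// sqr_ge0.
  have -> : - x ^+ 2 / (2 * s ^+ 2) = - u + - u by rewrite /u; field.
  have -> : - x ^+ 2 / (4 * s ^+ 2) = - u by rewrite /u mulNr.
  rewrite expRD mulrA mulrC [leRHS]mulrC ler_wpM2l ?expR_ge0//.
  rewrite expRN ler_pdivrMr ?expR_gt0//.
  apply: (@le_trans _ _ (s * (1 + u))); last first.
    by apply: ler_wpM2l; [exact: ltW|exact: expR_ge1Dx].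
  rewrite -subr_ge0.
  have -> : s * (1 + u) - `|x| = s * (1 - `|x| / (2 * s)) ^+ 2.
    rewrite /u -[x ^+ 2]real_normK ?num_real//; by field.
  by rewrite mulr_ge0 ?sqr_ge0// ltW.
have int' : mu.-integrable setT (fun x => (s * normal_peak s / normal_peak s')%:E *
    (normal_pdf 0 s' x)%:E)%E.
  by apply: integrableZl => //; exact: integrable_normal_pdf.
apply: le_integrable int' => //.
  apply/measurable_EFinP; apply: measurable_funM; last exact: measurable_normal_pdf.
  exact: normr_measurable.
move=> x _ /=; rewrite lee_fin ger0_norm ?mulr_ge0 ?normal_pdf_ge0//.
by rewrite (le_trans (bnd x))// ler_norm.
Qed.

Variable b : R.
(** [h t] is the derivative of [H t], which vanishes at infinity; that its
    integral is zero is the integration by parts behind the differential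
    equation of the characteristic function. *)
Let H t (x : R) := sin (t * x + b) * phi x.
Let h t (x : R) := t * (cos (t * x + b) * phi x) - s ^- 2 * (x * sin (t * x + b) * phi x).

Let is_derive_H t (x : R) : is_derive x 1 (H t) (h t x).
Proof.
have d1 : is_derive x 1 (fun x : R => t * x + b) t.
  by apply: is_derive_eq; rewrite /GRing.scale/=; ring.
have d2 := is_derive_normal_pdf x.
apply: is_derive_eq; rewrite /h /GRing.scale/=; ring.
Qed.

Let int_cos t : mu.-integrable setT (fun x => (cos (t * x + b) * phi x)%:E).
Proof.
apply: le_integrable (integrable_normal_pdf 0 s) => //.
  apply/measurable_EFinP; apply: measurable_funM; last exact: measurable_normal_pdf.
  apply: (measurableT_comp (continuous_measurable_fun (@continuous_cos R))).
  by apply: measurable_funD => //; exact: measurable_funM.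
move=> x _ /=; rewrite lee_fin normrM (ger0_norm (normal_pdf_ge0 0 s x)).
by rewrite ler_piMl ?normal_pdf_ge0// cos_max.
Qed.

Let int_xsin t : mu.-integrable setT (fun x => (x * sin (t * x + b) * phi x)%:E).
Proof.
apply: le_integrable integrable_normr_normal_pdf => //.
  apply/measurable_EFinP; apply: measurable_funM; last exact: measurable_normal_pdf.
  apply: measurable_funM => //;
  apply: (measurableT_comp (continuous_measurable_fun (@continuous_sin R))).
  by apply: measurable_funD => //; exact: measurable_funM.
move=> x _ /=; rewrite lee_fin !normrM (ger0_norm (normal_pdf_ge0 0 s x)).
by rewrite ler_wpM2r ?normal_pdf_ge0// normr_id ler_piMr// sin_max.
Qed.

Let int_h t : mu.-integrable setT (fun x => (h t x)%:E).
Proof.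
have -> : (fun x => (h t x)%:E) =
    (fun x => t%:E * (cos (t * x + b) * phi x)%:E -
      (s ^- 2)%:E * (x * sin (t * x + b) * phi x)%:E)%E.
  by apply/funext => x; rewrite -!EFinM -EFinB.
by apply: integrableB => //; apply: integrableZl.
Qed.

Let continuous_H t : continuous (H t).
Proof.
move=> x; apply: differentiable_continuous; apply/derivable1_diffP.
by have := is_derive_H t x => -[].
Qed.

Let continuous_affine t : continuous (fun x : R => t * x + b).
Proof.
by move=> x; apply: cvgD; [apply: cvgM; [exact: cvg_cst|exact: cvg_id]|exact: cvg_cst].
Qed.

Let continuous_h t : continuous (h t).
Proof.
have cphi := @continuous_normal_pdf R 0 s s_neq0.
move=> x; apply: cvgB.
  apply: cvgM; first exact: cvg_cst.
  apply: cvgM; last exact: cphi.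
  by apply: continuous_comp; [exact: continuous_affine|exact: continuous_cos].
apply: cvgM; first exact: cvg_cst.
apply: cvgM; last exact: cphi.
apply: cvgM; first exact: cvg_id.
by apply: continuous_comp; [exact: continuous_affine|exact: continuous_sin].
Qed.

Lemma normal_pdf_tail (x : R) : x != 0 ->
  phi x <= normal_peak s * (2 * s ^+ 2) / x ^+ 2.
Proof.
move=> x0; have x20 : 0 < x ^+ 2 by rewrite exprn_even_gt0.
have s20 : 0 < 2 * s ^+ 2 by rewrite mulr_gt0// exprn_gt0.
rewrite normal_pdfE0 -mulrA ler_wpM2l ?normal_peak_ge0//.
rewrite mulNr expRN -[leRHS]invrK invf_div lef_pV2 ?posrE ?expR_gt0 ?divr_gt0//.
by rewrite (le_trans _ (expR_ge1Dx _))// lerDr.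
Qed.

Let int_h_eq0 t : \int[mu]_x h t x = 0.
Proof.
have mh : measurable_fun setT (h t) by exact: (continuous_measurable_fun (@continuous_h t)).
pose A (n : nat) : set R := `[- n.+1%:R, n.+1%:R]%classic.
have mA n : measurable (A n) by exact: measurable_itv.
have ftc n : (\int[mu]_(x in A n) (h t x)%:E = (H t n.+1%:R - H t (- n.+1%:R))%:E)%E.
  rewrite EFinB; apply: continuous_FTC2.
  - by rewrite (lt_trans (_ : _ < 0)) ?oppr_lt0.
  - exact: (continuous_subspaceT (@continuous_h t)).
  - split; first by move=> x _; have [] := is_derive_H t x.
      exact: (cvg_at_right_filter (@continuous_H t _)).
    exact: (cvg_at_left_filter (@continuous_H t _)).
  - by move=> x _; rewrite derive1E; have [] := is_derive_H t x.
have l1 : (\int[mu]_(x in A n) (h t x)%:E @[n --> \oo] --> \int[mu]_x (h t x)%:E)%E.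
  under eq_fun do rewrite integral_mkcond.
  apply: (@dominated_cvg _ _ _ mu setT measurableT
    (fun n => (EFin \o h t) \_ (A n)) (EFin \o h t) (fun x => `|(h t x)%:E|%E)).
  - move=> n; apply/(measurable_restrictT _ (mA n)).
    by apply/measurable_funTS/measurable_EFinP.
  - move=> x _; apply: cvg_near_cst; near=> n.
    rewrite patchE ifT// inE /A/= in_itv/= -ler_norml.
    have : `|x| <= n%:R by near: n; exact: nbhs_infty_ger.
    by move=> /le_trans; apply; rewrite ler_nat.
  - by [].
  - exact: (integrable_abse (int_h t)).
  - move=> n x _; rewrite patchE; case: ifPn => // _; rewrite abse0; exact: abse_ge0.
have l2 : (H t n.+1%:R - H t (- n.+1%:R)) @[n --> \oo] --> (0 : R).
  apply/norm_cvg0P.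
  apply: (@squeeze_cvgr _ _ _ _ (fun=> 0) (fun n => n.+1%:R^-1 * (2 * (normal_peak s * (2 * s ^+ 2))))).
  - apply: nearW => n; rewrite normr_ge0/=.
    have Hb (x : R) : `|x| = n.+1%:R ->
        `|H t x| <= n.+1%:R^-1 * (normal_peak s * (2 * s ^+ 2)).
      move=> xn; have x0 : x != 0 by rewrite -normr_eq0 xn pnatr_eq0.
      rewrite /H normrM (ger0_norm (normal_pdf_ge0 0 s x)).
      apply: (@le_trans _ _ (phi x)); first by rewrite ler_piMl ?normal_pdf_ge0// sin_max.
      rewrite (le_trans (normal_pdf_tail x0))// mulrC ler_wpM2r//.
        by apply: mulr_ge0; [exact: normal_peak_ge0|rewrite mulr_ge0 ?sqr_ge0].
      rewrite -[x ^+ 2]real_normK ?num_real// xn lef_pV2 ?posrE ?exprn_gt0//.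
      by rewrite expr2 ler_peMr// ler1n.
    rewrite (le_trans (ler_normB _ _))// [X in _ <= _ * X]mulr_natl mulr2n mulrDr.
    by rewrite lerD// Hb// ?normrN ger0_norm.
  - exact: cvg_cst.
  - rewrite -[X in _ --> X](mul0r (2 * (normal_peak s * (2 * s ^+ 2)))).
    by apply: cvgM; [exact: cvg_harmonic|exact: cvg_cst].
have l3 : (\int[mu]_(x in A n) (h t x)%:E @[n --> \oo] --> 0%E)%E.
  under eq_fun do rewrite ftc.
  by apply: cvg_EFin; [exact: nearW|exact: l2].
rewrite /Rintegral.
have -> : (\int[mu]_x (h t x)%:E = 0)%E by exact: (cvg_unique _ l1 l3).
by [].
Unshelve. all: by end_near. Qed.

Let F t := \int[mu]_x (cos (t * x + b) * phi x).

(** Differentiating under the integral brings down a factor [x], which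
    integration by parts against the density turns into [s^2 t]. *)
Let F_derive (t : R) : is_derive t 1 F (- (s ^+ 2 * t) * F t).
Proof.
pose f (u x : R) : R := cos (u * x + b) * phi x.
have df (u x : R) : is_derive u 1 (f ^~ x) (- (x * sin (u * x + b) * phi x)).
  have d1 : is_derive u 1 (fun u : R => u * x + b) x.
    by apply: is_derive_eq; rewrite /GRing.scale/=; ring.
  by rewrite /f; apply: is_derive_eq; rewrite /GRing.scale/=; ring.
have d1f t' x : partial1of2 f t' x = - (x * sin (t' * x + b) * phi x).
  by rewrite partial1of2E; have [] := df t' x.
have tI : `]t - 1, t + 1[%classic t by rewrite /= in_itv/=; apply/andP; split; lra.
have h1 : forall x, `]t - 1, t + 1[%classic x -> mu.-integrable setT (EFin \o f x).
  by move=> x _; exact: int_cos.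
have h2 : forall x y, `]t - 1, t + 1[%classic x -> setT y -> derivable (f ^~ y) x 1.
  by move=> x y _ _; have [] := df x y.
have h3 : forall x y, `]t - 1, t + 1[%classic x -> setT y ->
    `|partial1of2 f x y| <= `|y| * phi y.
  move=> x y _ _; rewrite d1f normrN !normrM (ger0_norm (normal_pdf_ge0 0 s y)).
  by rewrite ler_wpM2r ?normal_pdf_ge0// ler_piMr// sin_max.
have G0 (y : R) : 0 <= `|y| * phi y by rewrite mulr_ge0// normal_pdf_ge0.
have der := derivable_under_integral measurableT tI h1 h2 G0 integrable_normr_normal_pdf h3.
have val := differentiation_under_integral measurableT tI h1 h2 G0 integrable_normr_normal_pdf h3.
apply: DeriveDef; first exact: der.
rewrite -derive1E val.
have := int_h_eq0 t; rewrite /h RintegralB//; last 2 first.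
  by have := integrableZl measurableT t (int_cos t).
  by have := integrableZl measurableT (s ^- 2) (int_xsin t).
rewrite RintegralZl//; last exact: int_cos.
rewrite RintegralZl//; last exact: int_xsin.
set I := \int[mu]_x (x * sin (t * x + b) * phi x); rewrite -/(F t) => /eqP.
rewrite subr_eq0 => /eqP e.
transitivity (- I).
  rewrite -[RHS]mulN1r /I -RintegralZl//; last exact: int_xsin.
  by apply: eq_Rintegral => x _; rewrite d1f mulN1r.
have -> : I = s ^+ 2 * (t * F t) by rewrite e mulVKf// expf_neq0.
by ring.
Qed.

(** The function [F] solves [F' = - s^2 t F], so that [exp (s^2 t^2 / 2) F] is
    constant. *)
Lemma normal_characteristic t :
  \int[normal_prob 0 s]_x cos (t * x + b) = expR (- (t ^+ 2 * s ^+ 2 / 2)) * cos b.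
Proof.
have -> : \int[normal_prob 0 s]_x cos (t * x + b) = F t.
  rewrite /F /Rintegral integral_normal_prob//.
  apply: measurable_bounded_integrable => //.
  - by rewrite -ge0_fin_numE// fin_num_measure.
  - apply: (measurableT_comp (continuous_measurable_fun (@continuous_cos R))).
    by apply: measurable_funD => //; exact: measurable_funM.
  - exists 1; split; first exact: num_real.
    by move=> y y1 x _ /=; rewrite (le_trans (cos_max _))// ltW.
pose g t := expR (t ^+ 2 * s ^+ 2 / 2) * F t.
have dg (u : R) : is_derive u 1 g 0.
  have d1 : is_derive u 1 (fun t : R => t ^+ 2 * s ^+ 2 / 2) (u * s ^+ 2).
    apply: is_derive_eq; rewrite /GRing.scale/=; by field.
  have d2 := F_derive u.
  rewrite /g; apply: is_derive_eq; rewrite /GRing.scale/=; ring.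
have := is_derive_0_is_cst t 0 dg; rewrite /g expr0n/= !mul0r expR0 mul1r => e.
have F0 : F 0 = cos b.
  rewrite /F; under eq_Rintegral do rewrite mul0r add0r.
  rewrite RintegralZl//; last exact: integrable_normal_pdf.
  by rewrite /Rintegral integral_normal_pdf mulr1.
by rewrite -F0 -e mulrA -expRD addNr expR0 mul1r.
Qed.

End normal_characteristic.

(** * Gaussian vectors *)

Section vector_measurability.
Context {dT : measure_display} {T : measurableType dT} {R : realType} {d : nat}.

(** An open set is a countable union of boxes with rational centres and radii
    [1 / (n + 1)], and the preimage of a box is a finite intersection of
    conditions on coordinates. *)
Lemma measurable_coords (Y : T -> borel_cV R d) :
  (forall i, measurable_fun setT (fun w => (Y w : 'cV[R]_d) i 0)) -> measurable_fun setT Y.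
Proof.
move=> mY; apply: (@measurability _ _ _ (borel_cV R d) setT _ (@open 'cV[R]_d)) => //.
move=> _ [A oA <-]; rewrite setTI.
pose c (k : 'cV[rat]_d * nat) : 'cV[R]_d := \col_i ratr (k.1 i 0).
pose box (k : 'cV[rat]_d * nat) : set 'cV[R]_d :=
  [set x | forall i, `|c k i 0 - x i 0| < k.2.+1%:R^-1].
pose good := [set k | box k `<=` A].
have -> : A = \bigcup_(k in good) box k.
  apply/seteqP; split; last by move=> x [k /= kA /kA].
  move=> x Ax; have /nbhs_ballP [e /= e0 eA] : nbhs x A by exact: open_nbhs_nbhs.
  pose n := Num.truncn (2 / e).
  have ne : n.+1%:R^-1 < e / 2.
    rewrite -[e / 2]invrK ltf_pV2 ?posrE ?invr_gt0 ?divr_gt0// invf_div.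
    by rewrite /n -[X in X < _]/(2 / e) truncnS_gt.
  have n0 : 0 < n.+1%:R^-1 :> R by rewrite invr_gt0.
  have ex i : exists q : rat, `|ratr q - x i 0| < n.+1%:R^-1.
    move: n0; set r := n.+1%:R^-1 => r0.
    have lt : x i 0 - r < x i 0 + r by lra.
    have [q] := rat_in_itvoo lt; rewrite in_itv/= => /andP[q1 q2].
    by exists q; rewrite ltr_norml; apply/andP; split; lra.
  have [g gP] := choice ex.
  exists (\col_i g i, n) => /=; last by move=> i; rewrite !mxE.
  move=> y /= By; apply: eA; split=> // i j; rewrite ord1 -ball_normE/=.
  have h1 := By i; have := gP i; rewrite /c !mxE in h1 *.
  rewrite (_ : x i 0 - y i 0 = (ratr (g i) - y i 0) - (ratr (g i) - x i 0)); last by ring.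
  move: h1 ne; set r := n.+1%:R^-1 => h1 ne h2.
  by rewrite (le_lt_trans (ler_normB _ _))//; lra.
rewrite preimage_bigcup bigcup_mkcond; apply: countable_bigcupT_measurable => // k.
case: ifPn => // _.
have -> : Y @^-1` box k = \bigcap_(i in [set: 'I_d])
    [set w | `|c k i 0 - (Y w : 'cV[R]_d) i 0| < k.2.+1%:R^-1].
  by apply/seteqP; split => w /= h i => [_|]; exact: h.
apply: fin_bigcap_measurable => // i _.
have mf : measurable_fun setT (fun w => `|c k i 0 - (Y w : 'cV[R]_d) i 0|).
  by apply: measurableT_comp => //; apply: measurable_funB.
have := mf measurableT `]-oo, k.2.+1%:R^-1[%classic (measurable_itv _).
by rewrite setTI (_ : _ @^-1` _ = [set w | `|c k i 0 - (Y w : 'cV[R]_d) i 0| < k.2.+1%:R^-1]).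
Qed.

End vector_measurability.

Definition mfun_of {d1 d2} {T1 : measurableType d1} {T2 : measurableType d2}
  (f : T1 -> T2) (mf : measurable_fun setT f) : {mfun T1 >-> T2} :=
  MeasurableFun.Pack (MeasurableFun.Class (isMeasurableFun.Build _ _ _ _ _ mf)).

Section gaussian.
Variables (R : realType) (d : nat).
Local Notation form t x := (((t : 'cV[R]_d)^T *m (x : 'cV[R]_d)) 0 0).

Lemma measurable_cos_form (t : 'cV[R]_d) b :
  measurable_fun setT (fun x : borel_cV R d => cos (form t x + b)).
Proof.
apply: continuous_measurable_cV.
exact: (proj1 (bounded_continuous_trig (trig_cos t b))).
Qed.

(** Add one vector at a time: the law of [x + xi v], with [x] distributed
    according to the law already built and [xi] an independent standard normal
    variable. The vectors may be linearly dependent, which covers singular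
    covariances. *)
Lemma gaussian_existence (vs : seq 'cV[R]_d) :
  exists mu : probability (borel_cV R d) R, forall (t : 'cV[R]_d) (b : R),
    \int[mu]_x cos (form t x + b) =
    expR (- ((\sum_(v <- vs) form t v ^+ 2) / 2)) * cos b.
Proof.
elim: vs => [|v vs [mu muE]].
  exists (dirac (0 : borel_cV R d)) => t b.
  rewrite /Rintegral integral_dirac//; last first.
    by apply/measurable_EFinP; exact: measurable_cos_form.
  rewrite diracT mul1e/= mulmx0 mxE add0r big_nil mul0r oppr0 expR0 mul1r.
  by [].
pose Y (z : borel_cV R d * measurableTypeR R) : borel_cV R d := (z.1 : 'cV[R]_d) + z.2 *: v.
have mY : measurable_fun setT Y.
  apply: measurable_coords => i; rewrite /Y.
  have -> : (fun z : borel_cV R d * measurableTypeR R => ((z.1 : 'cV[R]_d) + z.2 *: v) i 0) =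
      (fun z => (z.1 : 'cV[R]_d) i 0 + z.2 * v i 0).
    by apply/funext => z; rewrite !mxE.
  apply: measurable_funD; last by apply: measurable_funM.
  apply: (measurableT_comp (continuous_measurable_cV (@coord_continuous _ _ _ i 0))).
  exact: measurable_fst.
exists (distribution (mu \x normal_prob 0 1)%E (mfun_of mY)) => t b.
have mc := measurable_cos_form t b.
have cb (x : borel_cV R d) : `|cos (form t x + b)| <= 1 by exact: cos_max.
have mcY : measurable_fun setT (fun z => cos (form t (Y z) + b)).
  exact: (measurableT_comp mc mY).
rewrite /Rintegral integral_distribution; last 2 first.
- exact/measurable_EFinP.
- by apply: (@bounded_integrable _ _ _ _ (fun z => cos (form t (Y z) + b)) 1).
have -> : (\int[mu \x normal_prob 0 1]_z (EFin \o (fun z => cos (form t (Y z) + b))) z =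
   \int[mu]_x \int[normal_prob 0 1]_y (cos (form t (Y (x, y)) + b))%:E)%E.
  rewrite -integral12_prod_meas1//.
  by apply: (@bounded_integrable _ _ _ _ (fun z => cos (form t (Y z) + b)) 1).
have inner x : (\int[normal_prob 0 1]_y (cos (form t (Y (x, y)) + b))%:E =
    (expR (- (form t v ^+ 2 / 2)) * cos (form t x + b))%:E)%E.
  have := normal_characteristic (ltr01 : 0 < 1 :> R) (form t x + b) (form t v).
  rewrite expr1n mulr1 => <-.
  rewrite -(@bounded_Rintegral_EFin _ _ _ _ _ 1); last by move=> y; exact: cos_max.
    apply: eq_integral => y _; rewrite /Y/= mulmxDr -scalemxAr [in LHS]mxE [X in _ + X + b]mxE.
    by congr (cos _)%:E; ring.
  apply: (measurableT_comp (continuous_measurable_fun (@continuous_cos R))).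
  by apply: measurable_funD => //; exact: measurable_funM.
under eq_integral do rewrite inner.
rewrite big_cons; set a := form t v ^+ 2; set S := \sum_(j <- vs) _.
have -> : expR (- ((a + S) / 2)) = expR (- (a / 2)) * expR (- (S / 2)).
  by rewrite -expRD; congr expR; ring.
transitivity (expR (- (a / 2)) * \int[mu]_x cos (form t x + b)).
  rewrite -(@RintegralZl _ _ _ mu setT (fun x => cos (form t x + b)))//.
  exact: (@bounded_integrable _ _ _ mu (fun x => cos (form t x + b)) 1 mc cb).
by rewrite (muE t b) mulrA.
Qed.

(** The image of [mu] by the linear form and the normal law of variance [v]
    have the same cosine integrals; [v = 0] gives the Dirac mass at [0]. *)
Lemma characteristic_gaussian (mu : probability (borel_cV R d) R) (t : 'cV[R]_d) (v : R) :
  0 <= v -> (forall s b : R, \int[mu]_x cos (form (s *: t) x + b) =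
    expR (- (s ^+ 2 * v / 2)) * cos b) ->
  forall A, measurable A -> mu [set x : 'cV[R]_d | A (form t x)] = normal_law 0 v A.
Proof.
move=> v0 muE A mA.
have mt : measurable_fun setT (fun x : borel_cV R d => form t x : measurableTypeR R).
  exact: (continuous_measurable_cV (@continuous_linear_form _ _ t)).
pose nu1 : probability (measurableTypeR R) R := distribution mu (mfun_of mt).
have nu1E s b : \int[nu1]_x cos (s * x + b) = expR (- (s ^+ 2 * v / 2)) * cos b.
  have ms : measurable_fun setT (fun x : measurableTypeR R => cos (s * x + b)).
    apply: (measurableT_comp (continuous_measurable_fun (@continuous_cos R))).
    by apply: measurable_funD => //; exact: measurable_funM.
  have ig : mu.-integrable setT
      (EFin \o (fun x : borel_cV R d => cos (s * form t x + b))).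
    apply: (@bounded_integrable _ _ _ mu _ 1); first exact: (measurableT_comp ms mt).
    by move=> x; exact: cos_max.
  rewrite -muE /Rintegral integral_distribution; last 2 first.
  - exact/measurable_EFinP.
  - exact: ig.
  congr fine; apply: eq_integral => x _ /=.
  by rewrite linearZ/= -scalemxAl [in RHS]mxE.
rewrite /normal_law; have [vE|vn0] := eqVneq v 0.
  apply: (@eq_prob_cos R nu1 (dirac (0 : measurableTypeR R))) => // s b; rewrite nu1E vE.
  rewrite mulr0 mul0r oppr0 expR0 mul1r /Rintegral integral_dirac//.
    by rewrite diracT mul1e mulr0 add0r.
  apply/measurable_EFinP.
  apply: (measurableT_comp (continuous_measurable_fun (@continuous_cos R))).
  by apply: measurable_funD => //; exact: measurable_funM.
have vp : 0 < v by rewrite lt_neqAle eq_sym vn0.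
have sv : 0 < Num.sqrt v by rewrite sqrtr_gt0.
apply: (@eq_prob_cos R nu1 (normal_prob 0 (Num.sqrt v))) => // s b.
by rewrite nu1E normal_characteristic// sqr_sqrtr.
Qed.

End gaussian.

(** * The law of the walk *)

Section walk_law.
Variables (R : realType) (d : nat).
Variables (Se So : set 'cV[R]_d) (Ve Vo : {fset 'cV[R]_d}).
Hypothesis hV : erw_lattice Se So Ve Vo.
Variables (p q : R).
Variables (d0 : measure_display) (Omega : measurableType d0) (P : probability Omega R).
Variables (X1 : {RV P >-> borel_cV R d}) (U : nat -> {RV P >-> nat})
  (G : nat -> 'cV[R]_d -> {RV P >-> borel_cV R d})
  (X S : nat -> Omega -> 'cV[R]_d).
Hypothesis hERW : elephant_random_walk Ve Vo p q X1 U G X S.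

(** Turning the steps of even times brings all of them into [Vo]; whether a
    recalled step has the parity of the new one is then visible in the age of
    the recalled step only. *)
Definition flip (k : nat) (v : 'cV[R]_d) : 'cV[R]_d := if odd k then v else - v.

Lemma flipK k : involutive (flip k).
Proof. by move=> v; rewrite /flip; case: odd; rewrite ?opprK. Qed.

Lemma flip_inj k : injective (flip k).
Proof. exact: inv_inj (flipK k). Qed.

Lemma flip_steps k v : (flip k v \in steps_at Ve Vo k) = (v \in Vo).
Proof.
rewrite /flip /steps_at; case: odd => //.
rewrite (erw_opp hV); apply/idP/imfsetP => [vE|[u uE ->]].
  by exists (- v) => //; rewrite opprK.
by rewrite opprK.
Qed.

Lemma steps_at_sub k v : v \in steps_at Ve Vo k -> v \in (Vo `|` Ve)%fset.
Proof. by rewrite /steps_at in_fsetU; case: odd => ->; rewrite ?orbT. Qed.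

Lemma flip_notin_steps k j v : odd j != odd k -> v \in Vo ->
  flip j v \notin steps_at Ve Vo k.
Proof.
move=> jk vV; apply/negP => h1.
have h2 : flip j v \in steps_at Ve Vo j by rewrite flip_steps.
have /fsetP/(_ (flip j v)) := erw_disjoint hV.
rewrite in_fsetI in_fset0; move: h1 h2 jk; rewrite /steps_at.
by case: (odd k); case: (odd j) => // -> ->.
Qed.

Lemma U_range n w : (1 <= n)%N -> (1 <= U n w <= n)%N.
Proof.
move=> n1; have [+ _] := erw_U_law hERW n1 => /(_ w).
by rewrite in_fset/= mem_iota add1n ltnS.
Qed.

Lemma X_steps n w : (1 <= n)%N -> X n w \in steps_at Ve Vo n.
Proof.
elim/ltn_ind: n => -[//|[|n]] IH _.
  by rewrite (erw_X_first hERW); have [+ _] := erw_X1_law hERW => /(_ w).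
rewrite (erw_X_rec hERW)//; apply: (erw_G_values hERW) => //.
have /andP[u1 un] := U_range w (ltn0Sn n).
by apply: (@steps_at_sub (U n.+1 w)); apply: IH.
Qed.

Definition Y (k : nat) (w : Omega) : 'cV[R]_d := flip k (X k w).

Fixpoint history (n : nat) (w : Omega) : seq 'cV[R]_d :=
  if n is n'.+1 then Y n'.+1 w :: history n' w else [::].

Lemma size_history n w : size (history n w) = n.
Proof. by elim: n => //= n ->. Qed.

Lemma Y_steps k w : (1 <= k)%N -> Y k w \in Vo.
Proof. by move=> k1; rewrite -(flip_steps k) /Y flipK X_steps. Qed.

Lemma history_steps n w : all (mem Vo) (history n w).
Proof. by elim: n => //= n ->; rewrite andbT; exact: Y_steps. Qed.

(** On this event the value of every past step is known, which makes the
    recalled step deterministic once [U] is given. *)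
Definition event (h : seq 'cV[R]_d) : set Omega := [set w | history (size h) w = h].

Lemma event_nth h w k : event h w -> (k < size h)%N ->
  X (size h - k) w = flip (size h - k) (nth 0 h k).
Proof.
rewrite /event/=; elim: h k => [|y h IH] k //= [yE hE] kh.
case: k kh => [_|k kh]; first by rewrite subn0 /= -yE /Y flipK.
by rewrite subSS; exact: IH.
Qed.

(** The sets are indexed by consecutive blocks so that induction on histories
    can consume the blocks one by one. *)
Fixpoint meet_from (n k : nat) (C : nat -> set Omega) : set Omega :=
  if k is k'.+1 then C n `&` meet_from n.+1 k' C else setT.

Fixpoint prob_from (n k : nat) (C : nat -> set Omega) : \bar R :=
  if k is k'.+1 then (P (C n) * prob_from n.+1 k' C)%E else 1%E.

Lemma meet_from_bigcap n k C : meet_from n k C = \bigcap_(j in [set` iota n k]) C j.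
Proof.
elim: k n => [|k IH] n /=; first by apply/seteqP; split.
rewrite IH; apply/seteqP; split => w /=.
  by move=> [h1 h2] j /=; rewrite inE => /orP[/eqP->//|]; exact: h2.
move=> h; split; first by apply: h; rewrite /= inE eqxx.
by move=> j /= jk; apply: h; rewrite /= inE jk orbT.
Qed.

Lemma prob_from_prod n k C : prob_from n k C = (\prod_(j <- iota n k) P (C j))%E.
Proof. by elim: k n => [|k IH] n /=; rewrite ?big_nil// big_cons IH. Qed.

Definition block (n : nat) := sigma_block Ve Vo X1 U G n.

Lemma indep_from n k C : (forall j, block j (C j)) ->
  P (meet_from n k C) = prob_from n k C.
Proof.
move=> hC; have := erw_independent hERW (J := [fset i in iota n k]%fset) (E := C) (fun j _ => hC j).
rewrite meet_from_bigcap prob_from_prod => e.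
have -> : \bigcap_(j in [set` iota n k]) C j =
    \bigcap_(j in [set` [fset i in iota n k]%fset]) C j.
  by apply/seteqP; split => w h j /= jk; apply: h; move: jk; rewrite /= in_fset.
rewrite e; apply: perm_big; apply: uniq_perm; rewrite ?iota_uniq//.
by move=> j; rewrite in_fset.
Qed.

Lemma prob_from_eq n k C C' : (forall j, (n <= j)%N -> C j = C' j) ->
  prob_from n k C = prob_from n k C' /\ meet_from n k C = meet_from n k C'.
Proof.
elim: k n => [|k IH] n CC' //=.
have [-> ->] := IH n.+1 (fun j nj => CC' j (ltnW nj)).
by rewrite CC'.
Qed.

(** Singletons are closed. *)
Lemma measurable_cV1 (v : 'cV[R]_d) : measurable ([set v] : set (borel_cV R d)).
Proof.
rewrite -[[set v]]setCK; apply: measurableC; apply: sub_sigma_algebra.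
apply: closed_openC; apply: accessible_closed_set1; apply: hausdorff_accessible.
exact: norm_hausdorff.
Qed.

Lemma X1_eq_block v : block 0 [set w | (X1 w : 'cV[R]_d) = v].
Proof.
rewrite /block /sigma_block eqxx.
by exists [set v]; [exact: measurable_cV1 | rewrite setTI].
Qed.

Lemma U_eq_preimage n u : g_sigma_algebra_preimage (U n) [set w | U n w = u].
Proof. by exists [set u] => //; rewrite setTI. Qed.

Lemma G_eq_steps n v x : v \in (Vo `|` Ve)%fset ->
  sigma_steps Ve Vo G n [set w | (G n v w : 'cV[R]_d) = x].
Proof.
move=> vV; apply: sub_sigma_algebra; exists v => //.
by exists [set x]; [exact: measurable_cV1 | rewrite setTI].
Qed.

Lemma UG_block n u v x : v \in (Vo `|` Ve)%fset -> (1 <= n)%N ->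
  block n ([set w | U n w = u] `&` [set w | (G n.+1 v w : 'cV[R]_d) = x]).
Proof.
move=> vV n1; rewrite /block /sigma_block gtn_eqF//.
apply: (@measurableI _ (g_sigma_algebraType
  (g_sigma_algebra_preimage (U n) `|` sigma_steps Ve Vo G n.+1))).
  by apply: sub_sigma_algebra; left; exact: U_eq_preimage.
by apply: sub_sigma_algebra; right; exact: G_eq_steps.
Qed.

Lemma measurable_U_eq n u : measurable [set w | U n w = u].
Proof.
by have := @measurable_funPT _ _ _ _ (U n) measurableT [set u] I; rewrite setTI.
Qed.

Lemma measurable_G_eq n v x : measurable [set w | (G n v w : 'cV[R]_d) = x].
Proof.
have := @measurable_funPT _ _ _ _ (G n v) measurableT [set x] (measurable_cV1 x).
by rewrite setTI.
Qed.

Lemma measurable_X1_eq x : measurable [set w | (X1 w : 'cV[R]_d) = x].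
Proof.
have := @measurable_funPT _ _ _ _ X1 measurableT [set x] (measurable_cV1 x).
by rewrite setTI.
Qed.

(** The choice by [U] of the step at position [k] of [h], followed by the
    outcome [y]. It involves only the block numbered [size h], as the recalled
    value is a constant. *)
Definition recall (y : 'cV[R]_d) h k : set Omega :=
  [set w | U (size h) w = (size h - k)%N] `&`
  [set w | (G (size h).+1 (flip (size h - k) (nth 0 h k)) w : 'cV[R]_d) =
           flip (size h).+1 y].

Lemma measurable_recall y h k : measurable (recall y h k).
Proof. by apply: measurableI; [exact: measurable_U_eq|exact: measurable_G_eq]. Qed.

(** The recalled position splits the event into disjoint pieces, each of them
    the intersection of the past with a condition on a fresh block. *)
Lemma event_cons y h : (0 < size h)%N ->
  event (y :: h) = \big[setU/set0]_(k < size h) (event h `&` recall y h k).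
Proof.
move=> h0; rewrite -(bigcup_mkord (size h) (fun k => event h `&` recall y h k)).
apply/seteqP; split => w.
  rewrite /event /= => -[yE hE].
  have /andP[u1 un] := U_range w h0.
  have kE : (size h - (size h - U (size h) w))%N = U (size h) w by rewrite subKn.
  exists (size h - U (size h) w)%N; first by rewrite /= ltn_subrL u1.
  split=> //; split => /=; first by rewrite kE.
  rewrite -yE /Y flipK (erw_X_rec hERW)//.
  by rewrite -(@event_nth h w)// ?kE// ltn_subrL u1.
move=> [k /= kh [hE [uE gE]]]; rewrite /event /= hE; congr (_ :: _).
rewrite /Y (erw_X_rec hERW)// uE (event_nth hE)//.
by apply: (@flip_inj (size h).+1); rewrite flipK.
Qed.

Lemma recall_trivIset y h D : (0 < size h)%N ->
  trivIset setT (fun k => (event h `&` recall y h k) `&` D).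
Proof.
move=> h0; apply/trivIsetP => i j _ _ ij; apply/seteqP; split => // w.
move=> [[[_ [/= iU _]] _] [[_ [/= jU _]] _]]; apply/eqP: ij.
have /andP[u1 _] := U_range w h0; move: u1 iU jU; clear; lia.
Qed.

Lemma measurable_event h : measurable (event h).
Proof.
elim: h => [|y [|x h] IH].
- by rewrite /event /=; have -> : [set _ : Omega | [::] = [::] :> seq 'cV[R]_d] = setT by apply/seteqP; split.
- have -> : event [:: y] = [set w | (X1 w : 'cV[R]_d) = y].
    apply/seteqP; split => w; rewrite /event /= /Y /flip /= (erw_X_first hERW).
      by case.
    by move=> ->.
  exact: measurable_X1_eq.
- rewrite event_cons//; apply: bigsetU_measurable => i _.
  by apply: measurableI => //; exact: measurable_recall.
Qed.

Lemma prob_event_cons y h D : (0 < size h)%N -> measurable D ->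
  P (event (y :: h) `&` D) =
  (\sum_(k < size h) P ((event h `&` recall y h k) `&` D))%E.
Proof.
move=> h0 mD; rewrite event_cons// big_distrl/=.
rewrite (@measure_bigsetU _ _ _ P (fun k => (event h `&` recall y h k) `&` D))//;
  last exact: recall_trivIset.
move=> i; apply: measurableI => //; apply: measurableI; first exact: measurable_event.
exact: measurable_recall.
Qed.

Lemma block_measurable n A : block n A -> measurable A.
Proof.
have X1m : g_sigma_algebra_preimage X1 `<=` measurable.
  by move=> _ [B mB <-]; exact: measurable_funPT.
have Um k : g_sigma_algebra_preimage (U k) `<=` measurable.
  by move=> _ [B mB <-]; exact: measurable_funPT.
have Gm k : sigma_steps Ve Vo G k `<=` measurable.
  apply: smallest_sub; first exact: sigma_algebra_measurable.
  by move=> B [v _ [C mC <-]]; exact: measurable_funPT.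
rewrite /block /sigma_block; case: ifP => _; first exact: X1m.
apply: smallest_sub; first exact: sigma_algebra_measurable.
by move=> B [/Um|/Gm].
Qed.

Lemma recall_block y h k : (k < size h)%N -> all (mem Vo) h ->
  block (size h) (recall y h k).
Proof.
move=> kh hV'; apply: UG_block; last exact: leq_ltn_trans kh.
apply: (@steps_at_sub (size h - k)); rewrite flip_steps.
by move/allP: hV'; apply; exact: mem_nth.
Qed.

Lemma measurable_meet_from n k C : (forall j, block j (C j)) ->
  measurable (meet_from n k C).
Proof.
move=> hC; elim: k n => //= k IH n; apply: measurableI => //.
exact: block_measurable (hC n).
Qed.

(** A history of length [n] is determined by the blocks below [n]. For the
    induction independence is claimed from all later blocks at once: one step
    moves the block [n] from the future to the past. *)
Lemma indep_event h : (0 < size h)%N -> all (mem Vo) h ->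
  forall k C, (forall j, block j (C j)) ->
  P (event h `&` meet_from (size h) k C) = (P (event h) * prob_from (size h) k C)%E.
Proof.
elim: h => [//|y [|x h] IH] _ hV' k C hC.
  have evE : event [:: y] = [set w | (X1 w : 'cV[R]_d) = y].
    apply/seteqP; split => w; rewrite /event /= /Y /flip /= (erw_X_first hERW).
      by case.
    by move=> ->.
  pose C' j := if j == 0%N then event [:: y] else C j.
  have hC' j : block j (C' j).
    by rewrite /C'; case: eqP => [->|_]//; rewrite evE; exact: X1_eq_block.
  have /= := @indep_from 0 k.+1 C' hC'.
  have [-> ->] := @prob_from_eq 1 k C' C (fun j j1 => ifF _ _ (gtn_eqF j1)).
  by rewrite /C' eqxx.
have {}IH : forall k C, (forall j, block j (C j)) ->
    P (event (x :: h) `&` meet_from (size (x :: h)) k C) =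
    (P (event (x :: h)) * prob_from (size (x :: h)) k C)%E.
  by apply: IH => //; case/andP: hV'.
move: hV' IH; set h' := x :: h => hV' IH; have h0 : (0 < size h')%N by [].
have hV'' : all (mem Vo) h' by case/andP: hV'.
have step i K : (i < size h')%N ->
    P ((event h' `&` recall y h' i) `&` meet_from (size h').+1 K C) =
    (P (event h') * (P (recall y h' i) * prob_from (size h').+1 K C))%E.
  move=> ih; pose C' j := if j == size h' then recall y h' i else C j.
  have hC' j : block j (C' j).
    by rewrite /C'; case: eqP => [->|_]//; exact: recall_block.
  have /= := IH K.+1 C' hC'.
  have [-> ->] := @prob_from_eq (size h').+1 K C' C (fun j j1 => ifF _ _ (gtn_eqF j1)).
  by rewrite /C' eqxx setIA.
rewrite prob_event_cons//; last exact: measurable_meet_from.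
have -> : P (event (y :: h')) = (\sum_(i < size h') (P (event h') * P (recall y h' i)))%E.
  rewrite -[event _]setIT prob_event_cons//; apply: eq_bigr => i _.
  by have := step i 0%N (ltn_ord i); rewrite /= mule1.
rewrite ge0_sume_distrl; last by move=> i _; exact: mule_ge0.
by apply: eq_bigr => i _; rewrite step// muleA.
Qed.

Lemma prob_recall y h k : y \in Vo -> all (mem Vo) h -> (k < size h)%N ->
  P (recall y h k) = ((size h)%:R^-1 *
    copy_weight Vo (if odd k then p else q) (nth 0 h k) y)%:E.
Proof.
move=> yV hV' kh; have h0 := leq_ltn_trans (leq0n k) kh.
set v := nth 0 h k; have vV : v \in Vo by move/allP: hV'; apply; exact: mem_nth.
have vV' : flip (size h - k) v \in (Vo `|` Ve)%fset.
  by apply: (@steps_at_sub (size h - k)); rewrite flip_steps.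
rewrite /recall (erw_U_G_independent hERW h0); [|exact: U_eq_preimage|exact: G_eq_steps].
have [_ ->] := erw_U_law hERW h0; last first.
  by rewrite in_fset /= mem_iota add1n ltnS subn_gt0 kh leq_subr.
rewrite (erw_G_law hERW)//; last by rewrite flip_steps.
rewrite card_fseq undup_id ?iota_uniq// size_iota -EFinM; congr (_ * _)%:E.
have oE : odd (size h - k) = odd (size h) (+) odd k by rewrite oddB// ltnW.
rewrite /step_weight /copy_weight -/v.
have [kk|kk] := boolP (odd k).
  have fE : flip (size h - k) v = flip (size h).+1 v.
    by rewrite /flip oE kk /=; case: odd.
  by rewrite fE flip_steps vV (inj_eq (@flip_inj _)).
have fE : - flip (size h - k) v = flip (size h).+1 v.
  by rewrite /flip oE (negbTE kk) /=; case: odd; rewrite /= ?opprK.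
rewrite (negbTE (flip_notin_steps _ vV)); last by rewrite oE /= (negbTE kk); case: odd.
by rewrite fE (inj_eq (@flip_inj _)).
Qed.

Lemma prob_event1 y : y \in Vo -> P (event [:: y]) = ((#|` Vo|%:R)^-1)%:E.
Proof.
move=> yV; have [_ /(_ _ yV) <-] := erw_X1_law hERW; congr (P _).
apply/seteqP; split => w; rewrite /event /= /Y /flip /= (erw_X_first hERW).
  by case.
by move=> ->.
Qed.

(** Independence of the past from the block [size h], used with a single
    non-trivial set. *)
Lemma prob_event_trans y h : y \in Vo -> all (mem Vo) h -> (0 < size h)%N ->
  P (event (y :: h)) = (P (event h) * (trans 0 Vo p q h y)%:E)%E.
Proof.
move=> yV hV' h0.
rewrite -[event (y :: h)]setIT prob_event_cons// /trans.
rewrite mulr_sumr -sumEFin ge0_sume_distrr; last first.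
  by move=> i _; rewrite -prob_recall.
apply: eq_bigr => i _; rewrite setIT -prob_recall//.
pose C' j := if j == size h then recall y h i else setT.
have hC' j : block j (C' j).
  rewrite /C'; case: eqP => [->|_]; first exact: recall_block.
  rewrite /block /sigma_block; case: ifP => _.
    by exists setT => //; rewrite setTI.
  exact: (@measurableT _ (g_sigma_algebraType
    (g_sigma_algebra_preimage (U j) `|` sigma_steps Ve Vo G j.+1))).
have /= := indep_event h0 hV' 1 hC'.
by rewrite /C' eqxx setIT mule1.
Qed.

Fixpoint hists (n : nat) : seq (seq 'cV[R]_d) :=
  if n is n'.+1 then [seq y :: h | h <- hists n', y <- (Vo : seq _)]
  else [seq [:: y] | y <- (Vo : seq _)].

Lemma mem_hists n h : (h \in hists n) = hist Vo n h.
Proof.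
elim: n h => [|n IH] h; apply/idP/idP.
- by move/mapP => [y yV ->]; rewrite /hist /= yV.
- case: h => [|y [|]]; rewrite /hist //= => /andP[yV _].
  by apply/mapP; exists y.
- move/allpairsPdep => [h' [y [h'n yV ->]]].
  by apply: hist_cons => //; rewrite -IH.
- case: h => [|y h]; rewrite /hist //= eqSS => /andP[sh /andP[yV hV']].
  by apply/allpairsPdep; exists h, y; split=> //; rewrite IH /hist sh.
Qed.

Lemma hists_uniq n : uniq (hists n).
Proof.
elim: n => [|n IH] /=; first by rewrite map_inj_uniq ?fset_uniq// => x y [].
apply: allpairs_uniq => //; first exact: fset_uniq.
by move=> [h y] [h' y'] _ _ /= [-> ->].
Qed.

Lemma hist_avg_prob n F :
  (\sum_(h <- hists n) (F h)%:E * P (event h))%E = (hist_avg 0 Vo p q n F)%:E.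
Proof.
elim: n F => [|n IH] F /=.
  rewrite big_map mulr_sumr -sumEFin; apply: eq_big_seq => y yV.
  by rewrite prob_event1// -EFinM mulrC.
rewrite big_allpairs_dep /= -IH; apply: eq_big_seq => h.
rewrite mem_hists => /andP[/eqP sh hV'].
have h0 : (0 < size h)%N by rewrite sh.
have fE : P (event h) \is a fin_num by apply: fin_num_measure; exact: measurable_event.
rewrite -(fineK fE) -EFinM /step_avg mulr_suml -sumEFin; apply: eq_big_seq => y yV.
rewrite prob_event_trans// -(fineK fE) -!EFinM; congr (_%:E); ring.
Qed.

(** The walk takes finitely many values up to each time, so that its
    expectations are sums over histories; this reduces the probability space
    to the averages studied above. *)
Lemma integral_history n (F : seq 'cV[R]_d -> R) :
  (\int[P]_w (F (history n.+1 w))%:E)%E = (hist_avg 0 Vo p q n F)%:E.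
Proof.
have -> : (fun w => (F (history n.+1 w))%:E) =
    (fun w => (\sum_(h <- hists n) (F h)%:E * (\1_(event h) w)%:E)%E).
  apply/funext => w.
  have hin : history n.+1 w \in hists n.
    by rewrite mem_hists /hist size_history eqxx history_steps.
  rewrite (bigD1_seq _ hin (hists_uniq n)) /= big1_seq.
    rewrite adde0 indicE (_ : (w \in event (history n.+1 w)) = true) ?mule1//.
    by apply/mem_set; rewrite /event /= size_history.
  move=> h /andP[hn]; rewrite mem_hists => /andP[/eqP sh _].
  rewrite indicE memNset ?mule0// /event /= sh => e.
  by move/eqP: hn; apply; rewrite -e.
rewrite integral_sum//; last first.
  move=> h; apply: integrableZl => //; apply: integrable_indic.
  exact: measurable_event.
rewrite -hist_avg_prob; apply: eq_bigr => h _.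
rewrite integralZl//; last by apply: integrable_indic; exact: measurable_event.
by rewrite integral_indic ?setIT//; exact: measurable_event.
Qed.

End walk_law.

Section walk_sum.
Variables (R : realType) (d : nat).
Implicit Types (h : seq 'cV[R]_d) (t : 'cV[R]_d).

Fixpoint walk_sum h : 'cV[R]_d :=
  if h is y :: h' then flip (size h) y + walk_sum h' else 0.

(** Centring the steps at [a] leaves the alternating sum [a - a + a - ...],
    which is [0] or [a]. *)
Lemma walk_sum_form t h (a : 'cV[R]_d) :
  (t^T *m walk_sum h) 0 0 =
  signed_sum (-1) (fun v => (t^T *m (v - a)) 0 0) h +
  (if odd (size h) then (t^T *m a) 0 0 else 0).
Proof.
elim: h => [|y h IH] /=; first by rewrite mulmx0 mxE addr0.
rewrite mulmxDr mxE IH /flip /=; case: (odd (size h)) (signr_odd R (size h)) => <- /=;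
  rewrite ?mulmxN ?mulmxBr !mxE; ring.
Qed.

End walk_sum.

(** * The limit theorem *)

Section limit.
Variables (R : realType) (d : nat) (Vo : {fset 'cV[R]_d}).
Hypothesis hm : (2 <= #|` Vo|)%N.
Local Notation a := (step_mean Vo).
Local Notation m := (#|` Vo|%:R : R).
Local Notation form t x := (((t : 'cV[R]_d)^T *m (x : 'cV[R]_d)) 0 0).

Definition centred (t v : 'cV[R]_d) : R := form t (v - a).

Let m_gt0 : 0 < m. Proof. by rewrite ltr0n (leq_trans _ hm). Qed.

Lemma formZr (t : 'cV[R]_d) (c : R) (x : 'cV[R]_d) : form t (c *: x) = c * form t x.
Proof. by rewrite -scalemxAr mxE. Qed.

Lemma formZl (t : 'cV[R]_d) (c : R) (x : 'cV[R]_d) : form (c *: t) x = c * form t x.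
Proof. by rewrite linearZ /= -scalemxAl mxE. Qed.

Lemma form_outer (t u : 'cV[R]_d) : (t^T *m (u *m u^T) *m t) 0 0 = form t u ^+ 2.
Proof.
rewrite mulmxA -(mulmxA (t^T *m u)) mxE big_ord1 expr2; congr (_ * _).
by rewrite -[u^T *m t]trmxK trmx_mul trmxK mxE.
Qed.

Lemma sum_centred t : \sum_(v <- Vo) centred t v = 0.
Proof.
rewrite /centred -summxE -mulmx_sumr sumrB.
rewrite big_const_seq count_predT iter_addr_0 -scaler_nat /step_mean scalerA.
by rewrite mulfV ?lt0r_neq0// scale1r subrr mulmx0 mxE.
Qed.

Lemma centred_variance t :
  (t^T *m step_covariance Vo *m t) 0 0 = step_variance (Vo : seq _) (centred t).
Proof.
rewrite /step_covariance /step_variance -scalemxAr -scalemxAl mxE; congr (_ * _).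
rewrite mulmx_sumr mulmx_suml summxE; apply: eq_bigr => v _.
exact: form_outer.
Qed.

(** The covariance is that of the uniform law on [Vo]; it is the sum of the
    matrices [u u^T] over the vectors [u = (v - a) / sqrt m], which is the
    covariance of a combination of these vectors with independent standard
    normal coefficients. *)
Lemma step_gaussian : exists2 mu : probability (borel_cV R d) R,
  is_gaussian mu 0 (step_covariance Vo) &
  forall (t : 'cV[R]_d) (b : R), \int[mu]_x cos (form t x + b) =
    expR (- (step_variance (Vo : seq _) (centred t) / 2)) * cos b.
Proof.
have [mu muE] := gaussian_existence
  [seq (Num.sqrt m)^-1 *: (v - a) | v <- (Vo : seq _)].
have {}muE (t : 'cV[R]_d) (b : R) : \int[mu]_x cos (form t x + b) =
    expR (- (step_variance (Vo : seq _) (centred t) / 2)) * cos b.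
  rewrite muE big_map /step_variance; congr (expR (- (_ / 2)) * _).
  rewrite mulr_sumr; apply: eq_bigr => v _; rewrite formZr exprMn exprVn.
  by rewrite sqr_sqrtr ?ler0n.
exists mu => // t A mA; rewrite mulmx0 mxE centred_variance.
apply: characteristic_gaussian => //.
  rewrite mulr_ge0 ?invr_ge0 ?ler0n//; apply: sumr_ge0 => v _; exact: sqr_ge0.
move=> s b; rewrite muE; congr (expR (- (_ / 2)) * _).
rewrite /step_variance mulrCA; congr (_ * _); rewrite mulr_sumr.
by apply: eq_bigr => v _; rewrite /centred formZl exprMn.
Qed.

Variables (p q : R).
Hypotheses (hp : 0 <= p <= 1) (hq : 0 <= q <= 1).
Hypothesis hdelta : erw_delta Vo p q = 2^-1.

Definition scale n : R := (Num.sqrt (n.+1%:R * ln n.+1%:R))^-1.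

Lemma memory_coefN1 : memory_coef (Vo : seq _) p q (-1) = 2^-1.
Proof.
rewrite -hdelta /erw_delta /memory_coef mulN1r mulrC; by [].
Qed.

(** Since [alpha <= 1] and [alpha - beta = 1], [(alpha + beta) / 2 = alpha -
    1/2 <= 1/2]: the companion sum is at most critical. *)
Lemma memory_coef1 : memory_coef (Vo : seq _) p q (- -1) <= 2^-1.
Proof.
have := memory_coefN1; rewrite /memory_coef opprK mul1r mulN1r.
have : (m * p - 1) / (m - 1) <= 1.
  have m1 : 0 < m - 1 by rewrite subr_gt0 ltr1n.
  rewrite ler_pdivrMr// mul1r lerD2r ler_piMr ?ler0n//.
  by case/andP: hp.
set x := _ / _; set y := (_ * q - 1) / _; lra.
Qed.

Let B t : R := 1 + \sum_(v <- (Vo : seq _)) `|centred t v|.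

Let centred_B t v : v \in (Vo : seq _) -> `|centred t v| <= B t.
Proof.
move=> vV; rewrite /B (bigD1_seq v) ?fset_uniq//= addrCA lerDl addr_ge0//.
by apply: sumr_ge0.
Qed.

Let B_ge1 t : 1 <= B t.
Proof. by rewrite lerDl sumr_ge0. Qed.

Let walk_close t n h : hist (Vo : seq _) n h ->
  `|form t (walk_sum h) - signed_sum (-1) (centred t) h| <= `|form t a|.
Proof.
move=> _; rewrite (walk_sum_form _ _ a) addrAC subrr add0r.
by case: ifP; rewrite ?normr0.
Qed.

Let N1sq : (-1) ^+ 2 = 1 :> R. Proof. by rewrite sqrrN expr1n. Qed.

(** The walk in the direction [t] differs from a signed sum by at most the
    constant [<t, a>]. *)
Lemma walk_char_cvg t b :
  hist_avg 0 (Vo : seq _) p q n (fun h => cos (scale n * form t (walk_sum h) + b))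
    @[n --> \oo] --> expR (- (step_variance (Vo : seq _) (centred t) / 2)) * cos b.
Proof.
refine (scaled_char_cvg 0 (fset_uniq Vo) hm hp hq (sum_centred t) (@centred_B t) (B_ge1 t)
  N1sq memory_coefN1 memory_coef1 (@walk_close t)).
Qed.

Lemma walk_second_moment t : exists C : R, \forall n \near \oo,
  hist_avg 0 (Vo : seq _) p q n (fun h => (scale n * form t (walk_sum h)) ^+ 2) <= C.
Proof.
exists (116 * B t ^+ 2 + 2 * `|form t a| ^+ 2).
refine (scaled_second_moment 0 (fset_uniq Vo) hm hp hq (sum_centred t) (@centred_B t)
  N1sq memory_coefN1 (normr_ge0 _) (@walk_close t)).
Qed.

Definition rescaled n h : 'cV[R]_d := scale n *: walk_sum h.

Definition walk_mean n (f : 'cV[R]_d -> R) : R :=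
  hist_avg 0 (Vo : seq _) p q n (fun h => f (rescaled n h)).

Lemma mean_functional_walk_mean n : mean_functional (walk_mean n).
Proof.
split.
- by move=> f g _ _; rewrite /walk_mean hist_avgD.
- by move=> k f _; rewrite /walk_mean hist_avgZ.
- by move=> f g _ _ fg; apply: (hist_avg_le 0 hm hp hq) => h _; exact: fg.
- exact: (hist_avg_cst 0 (fset_uniq Vo) hm hp hq).
Qed.

Lemma hist_avg_sum n (I : Type) (r : seq I) (F : I -> seq 'cV[R]_d -> R) :
  hist_avg 0 (Vo : seq _) p q n (fun h => \sum_(i <- r) F i h) =
  \sum_(i <- r) hist_avg 0 (Vo : seq _) p q n (F i).
Proof.
elim: r => [|i r IH].
  under eq_fun do rewrite big_nil.
  by rewrite big_nil (hist_avg_cst 0 (fset_uniq Vo) hm hp hq).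
under eq_fun do rewrite big_cons.
by rewrite big_cons (hist_avgD 0 hm hp hq) IH.
Qed.

Lemma walk_sqr_sum : exists C : R, \forall n \near \oo,
  walk_mean n (fun x => sqr_sum x) <= C.
Proof.
have [C hC] := choice (fun i : 'I_d => walk_second_moment (delta_mx i 0)).
exists (\sum_i C i); near=> n.
have hn : forall i, hist_avg 0 (Vo : seq _) p q n
    (fun h => (scale n * form (delta_mx i 0) (walk_sum h)) ^+ 2) <= C i.
  by near: n; exact: filter_forall.
 rewrite /walk_mean /sqr_sum hist_avg_sum; apply: ler_sum => i _.
apply: le_trans (hn i).
apply: (hist_avg_le 0 hm hp hq) => h _.
by rewrite -formZr trmx_delta -rowE !mxE.
Unshelve. all: by end_near. Qed.

(** The coordinates have bounded second moments, which controls [tail] by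
    Markov's inequality. *)
Lemma walk_tail (e : R) : 0 < e ->
  \forall k \near \oo, \forall n \near \oo, walk_mean n (tail k.+1%:R) <= e.
Proof.
move=> e0; have [C hC] := walk_sqr_sum.
near=> k; apply: filterS hC => n nC.
apply: (@le_trans _ _ (walk_mean n (fun x => k.+1%:R ^- 2 * sqr_sum x))).
  by apply: (hist_avg_le 0 hm hp hq) => h _; rewrite /tail ge_min lexx orbT.
rewrite /walk_mean (hist_avgZ 0 hm hp hq).
apply: (@le_trans _ _ (k.+1%:R ^- 2 * C)).
  by rewrite ler_wpM2l// invr_ge0 sqr_ge0.
rewrite ler_pdivrMl ?exprn_gt0//.
have kC : C / e <= k.+1%:R.
  apply: (@le_trans _ _ k%:R); last by rewrite ler_nat.
  near: k; exact: nbhs_infty_ger.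
rewrite -ler_pdivrMr// (le_trans kC)// ler_peMr// ler1n.
Unshelve. all: by end_near. Qed.

Lemma walk_limit (mu : probability (borel_cV R d) R) :
  (forall (t : 'cV[R]_d) (b : R), \int[mu]_x cos (form t x + b) =
    expR (- (step_variance (Vo : seq _) (centred t) / 2)) * cos b) ->
  forall f, bounded_continuous f ->
  walk_mean n f @[n --> \oo] --> mean_of mu (fun x : borel_cV R d => x) f.
Proof.
move=> muE; apply: levy_continuity => //.
- exact: mean_functional_walk_mean.
- exact: (mean_functional_mean_of mu (@measurable_id _ _ _)).
- move=> e e0.
  have h1 := walk_tail e0.
  have h2 := mean_of_tail mu (@measurable_id _ (borel_cV R d) setT) e0.
  have [k [k1 k2]] := filter_ex (filterI h1 h2).
  by exists k.+1%:R.
move=> t b; rewrite /mean_of muE /walk_mean /rescaled.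
have := @walk_char_cvg t b.
by under eq_fun do under eq_fun do rewrite -formZr.
Qed.

End limit.

Unset Implicit Arguments.

Theorem theorem2p17 (R : realType) (d : nat) (hd : (1 <= d)%N)
    (Se So : set 'cV[R]_d) (Ve Vo : {fset 'cV[R]_d})
    (hV : erw_lattice Se So Ve Vo)
    (hm : (2 <= #|` Vo|)%N)
    (p q : R) (hp : 0 <= p <= 1) (hq : 0 <= q <= 1)
    (d0 : measure_display) (Omega : measurableType d0)
    (P : probability Omega R)
    (X1 : {RV P >-> borel_cV R d}) (U : nat -> {RV P >-> nat})
    (G : nat -> 'cV[R]_d -> {RV P >-> borel_cV R d})
    (X S : nat -> Omega -> 'cV[R]_d)
    (hERW : elephant_random_walk Ve Vo p q X1 U G X S)
    (hdelta : erw_delta Vo p q = 2^-1) :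
  exists2 mu : probability (borel_cV R d) R,
    is_gaussian mu 0 (step_covariance Vo) &
    cvg_in_distribution P
      (fun n w => (Num.sqrt (n%:R * ln n%:R))^-1 *: S n w) mu.
Proof.
have [mu muG muE] := step_gaussian Vo.
exists mu => // f cf fb; have bf : bounded_continuous f by [].
have [M fM] := fb.
have SE n w : S n w = walk_sum (history X n w).
  elim: n => [|n IH] /=; first exact: (erw_S_first hERW).
  rewrite (erw_S_rec hERW) IH addrC /Y size_history.
  by rewrite flipK.
have -> : (\int[mu]_x (f x)%:E)%E = (mean_of mu (fun x : borel_cV R d => x) f)%:E.
  exact: (@bounded_Rintegral_EFin _ _ _ mu f M (continuous_measurable_cV cf) fM).
have LE n : (\int[P]_w (f ((Num.sqrt (n.+1%:R * ln n.+1%:R))^-1 *: S n.+1 w))%:E)%E =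
    (walk_mean Vo p q n f)%:E.
  under eq_integral do rewrite SE.
  exact: (integral_history hV hERW n (fun h => f (rescaled n h))).
(* Histories are indexed from length one, and the sequence is shifted
   accordingly. *)
rewrite -cvg_shiftS; under eq_fun do rewrite LE.
apply: cvg_EFin; first by near=> n.
exact: (@walk_limit _ _ _ hm _ _ hp hq hdelta mu muE f bf).
Unshelve. all: by end_near. Qed.
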